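(* Consider the triangular time-delay control system $$\dot x_i(t)=f_i(t,d(t),T_r(t)x_1,\dots,T_r(t)x_i)+g_i(t,d(t),T_r(t)x_1,\dots,T_r(t)x_i)\,x_{i+1}(t),\quad i=1,\dots,n-1,$$ $$\dot x_n(t)=f_n(t,d(t),T_r(t)x)+g_n(t,d(t),T_r(t)x)\,u(t),$$ with $x(t)=(x_1(t),\dots,x_n(t))\in\mathbb{R}^n$, $d(t)\in D$, $u(t)\in\mathbb{R}$, $t\ge0$, where $r>0$, $D\subset\mathbb{R}^l$ is a compact set, the mappings $f_i,g_i:\mathbb{R}^+\times D\times C^0([-r,0];\mathbb{R}^i)\to\mathbb{R}$ ($i=1,\dots,n$) are continuous with $f_i(t,d,0)=0$ for all $(t,d)\in\mathbb{R}^+\times D$, and each $g_i$ ($i=1,\dots,n$) is completely locally Lipschitz with respect to $x\in C^0([-r,0];\mathbb{R}^i)$. Suppose that there exists a non-decreasing function $\varphi\in C^\infty(\mathbb{R}^+;(0,+\infty))$ such that for every $i=1,\dots,n$ $$\frac{1}{\varphi(\|x\|_r)}\le g_i(t,d,x)\le\varphi(\|x\|_r),\quad\forall(t,x,d)\in\mathbb{R}^+\times C^0([-r,0];\mathbb{R}^i)\times D.$$ Moreover, suppose that for every $i=1,\dots,n$ and every bounded $S\subset C^0([-r,0];\mathbb{R}^i)$ $$\sup\left\{\frac{|f_i(t,d,x)-f_i(t,d,y)|}{\|x-y\|_r}:(t,d)\in\mathbb{R}^+\times D,\ x\in S,\ y\in S,\ x\ne y\right\}<+\infty.$$ Then for every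 $\sigma>0$ there exist functions $\mu_i\in C^\infty(\mathbb{R}^i;(0,+\infty))$, $k_i\in C^\infty(\mathbb{R}^i;\mathbb{R})$ ($i=1,\dots,n$) with $$k_1(\xi_1):=-\mu_1(\xi_1)\xi_1,\qquad k_j(\xi_1,\dots,\xi_j):=-\mu_j(\xi_1,\dots,\xi_j)\big(\xi_j-k_{j-1}(\xi_1,\dots,\xi_{j-1})\big),\ j=2,\dots,n,$$ such that the functional $$V(x):=\max_{\theta\in[-r,0]}\exp(2\sigma\theta)\left(x_1^2(\theta)+\sum_{j=2}^n|x_j(\theta)-k_{j-1}(x_1(\theta),\dots,x_{j-1}(\theta))|^2\right)$$ is a State Robust Control Lyapunov Functional (SRCLF) for the control system, which satisfies the small-control property. Moreover, the closed-loop system with $u(t)=k_n(x(t))$ is URGAS. More specifically, the inequality $V^0(x;v)\le-2\sigma V(x)$ holds for all $(t,x,d)\in\mathbb{R}^+\times C^0([-r,0];\mathbb{R}^n)\times D$ with $$v=\big(f_1(t,d,x_1)+g_1(t,d,x_1)x_2(0),\ \dots,\ f_n(t,d,x)+g_n(t,d,x)k_n(x(0))\big)'\in\mathbb{R}^n$$ (i.e. the $i$-th component of $v$ is $f_i(t,d,x_1,\dots,x_i)+g_i(t,d,x_1,\dots,x_i)x_{i+1}(0)$ for $i\le n-1$).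
   Context: Notation. $\mathbb{R}^+=[0,+\infty)$; $\|x\|_r:=\max_{\theta\in[-r,0]}|x(\theta)|$; $T_r(t)x$ is the function $\theta\mapsto x(t+\theta)$, $\theta\in[-r,0]$. $K^+$: positive continuous functions on $\mathbb{R}^+$. $\rho:\mathbb{R}^+\to\mathbb{R}^+$ is positive definite if $\rho(0)=0$, $\rho(s)>0$ for $s>0$. $K_\infty$: positive definite, increasing, continuous $a:\mathbb{R}^+\to\mathbb{R}^+$ with $a(s)\to+\infty$ as $s\to+\infty$. $\mathcal{E}$: continuous $q:\mathbb{R}^+\to\mathbb{R}^+$ with $\int_0^{+\infty}q<+\infty$ and $q(t)\to0$ as $t\to+\infty$. $M_D$: Lebesgue measurable, locally essentially bounded $d:\mathbb{R}^+\to D$. A continuous map $k(z,x)$, with $z$ in a subset $A$ of a normed space and $x\in C^0([-r,0];\mathbb{R}^i)$, is completely locally Lipschitz with respect to $x$ if for every closed and bounded $S\subseteq A\times C^0([-r,0];\mathbb{R}^i)$, $\sup\{|k(z,x)-k(z,y)|/\|x-y\|_r:(z,x)\in S,(z,y)\in S,x\ne y\}<+\infty$. URGAS. For a system $\dot x(t)=F(t,d(t),T_r(t)x)$, for $(t_0,x_0,d)\in\mathbb{R}^+\times C^0([-r,0];\mathbb{R}^n)\times M_D$ consider the unique maximal solution with $T_r(t_0)x=x_0$ (continuous, absolutely continuous for $t\ge t_0$, satisfying the equation a.e.) and let $x(t,t_0,x_0,d)\in C^0([-r,0];\mathbb{R}^n)$ denote its $r$-history $T_r(t)x$. The system is Uniformly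 Robustly Globally Asymptotically Stable (URGAS) if: for all $s,T\ge0$, $\sup\{\|x(t_0+\xi,t_0,x_0,d)\|_r:\xi\in[0,T],\|x_0\|_r\le s,t_0\in[0,T],d\in M_D\}<+\infty$; for every $\varepsilon>0$, $\sup\{\|x(t,t_0,x_0,d)\|_r:t\ge t_0,\|x_0\|_r\le\varepsilon,t_0\ge0,d\in M_D\}<+\infty$ and there is $\delta=\delta(\varepsilon)>0$ such that $\|x_0\|_r\le\delta$, $t_0\ge0$ imply $\|x(t,t_0,x_0,d)\|_r\le\varepsilon$ for all $t\ge t_0$, $d\in M_D$; and for every $\varepsilon>0$, $R\ge0$ there is $\tau=\tau(\varepsilon,R)\ge0$ such that $\|x_0\|_r\le R$, $t_0\ge0$ imply $\|x(t,t_0,x_0,d)\|_r\le\varepsilon$ for all $t\ge t_0+\tau$, $d\in M_D$. Derivative. For $x\in C^0([-r,0];\mathbb{R}^n)$, $0\le h<r$, $v\in\mathbb{R}^n$, let $E_h(x;v)(\theta)=x(0)+(\theta+h)v$ for $-h<\theta\le0$ and $E_h(x;v)(\theta)=x(\theta+h)$ for $-r\le\theta\le-h$. For locally bounded $V:\mathbb{R}^+\times C^0([-r,0];\mathbb{R}^n)\to\mathbb{R}$, $$V^0(t,x;v):=\limsup_{h\to0^+,\ y\to0,\ y\in C^0([-r,0];\mathbb{R}^n)}\frac{V(t+h,E_h(x;v)+hy)-V(t,x)}{h};$$ for $V$ independent of $t$ this is written $V^0(x;v)$. Almost Lipschitz on bounded sets. A continuous $V:\mathbb{R}^+\times C^0([-r,0];\mathbb{R}^n)\to\mathbb{R}^+$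 is almost Lipschitz on bounded sets if there are non-decreasing $L_V,P:\mathbb{R}^+\to\mathbb{R}^+$, $G:\mathbb{R}^+\to[1,+\infty)$ such that for all $R\ge0$: $|V(t,y)-V(t,x)|\le L_V(R)\|y-x\|_r$ whenever $\|x\|_r,\|y\|_r\le R$, $t\in[0,R]$; and for every absolutely continuous $x:[-r,0]\to\mathbb{R}^n$ with $\|x\|_r\le R$ and essentially bounded derivative, $|V(t+h,x)-V(t,x)|\le hP(R)(1+\sup_{-r\le\tau\le0}|\dot x(\tau)|)$ for all $t\in[0,R]$ and $0\le h\le1/G(R+\sup_{-r\le\tau\le0}|\dot x(\tau)|)$. SRCLF. For a control system $\dot x(t)=f(t,d(t),T_r(t)x,u(t))$ with $u(t)\in U$ (here $U=\mathbb{R}$ and $f$ is the right-hand side of the triangular system), a functional $V:\mathbb{R}^+\times C^0([-r,0];\mathbb{R}^n)\to\mathbb{R}^+$, almost Lipschitz on bounded sets, is an SRCLF if: (i) there exist $a_1,a_2\in K_\infty$, $\beta,\mu\in K^+$ with $\max\{a_1(\|x\|_r),a_1(\mu(t)\|x\|_r)\}\le V(t,x)\le a_2(\beta(t)\|x\|_r)$ for all $(t,x)$; (ii) there exist (for some positive integer $p$) a function $\Psi:\mathbb{R}^+\times\mathbb{R}^p\times U\to\mathbb{R}\cup\{+\infty\}$ with $\Psi(t,0,0)=0$ for all $t\ge0$ and $(t,\varphi)\mapsto\Psi(t,\varphi,u)$ upper semi-continuous for each $u\in U$, a function $q\in\mathcal{E}$, a continuous mapping $\Phi:\mathbb{R}^+\times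 C^0([-r,0];\mathbb{R}^n)\to\mathbb{R}^p$ completely locally Lipschitz with respect to $x$ with $\Phi(t,0)=0$ for all $t\ge0$, and a continuous positive definite $\rho:\mathbb{R}^+\to\mathbb{R}^+$ such that $\inf_{u\in U}\Psi(t,\varphi,u)\le q(t)$ for all $t\ge0$, $\varphi\in\mathbb{R}^p$, and for every finite $\{u_1,\dots,u_N\}\subset U$ and $\lambda_i\in[0,1]$ with $\sum_{i=1}^N\lambda_i=1$, $$\sup_{d\in D}V^0\Big(t,x;f\big(t,d,x,\textstyle\sum_{i=1}^N\lambda_iu_i\big)\Big)\le-\rho(V(t,x))+\max\{\Psi(t,\Phi(t,x),u_i):i=1,\dots,N\}\quad\forall(t,x)\in\mathbb{R}^+\times C^0([-r,0];\mathbb{R}^n).$$ It satisfies the small-control property if in addition there exist $a\in K_\infty$, $\gamma\in K^+$ such that for every $(t,\varphi)\in\mathbb{R}^+\times\mathbb{R}^p$ there is $u\in U$ with $|u|\le a(\gamma(t)|\varphi|)$ and $\Psi(t,\varphi,u)\le q(t)$. *)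

(* Defs.v *)
From HB Require Import structures.
From mathcomp Require Import all_boot all_order all_algebra.
From mathcomp Require Import all_classical all_reals all_analysis.
From mathcomp Require Import ess_sup_inf.
Set Implicit Arguments.
Unset Strict Implicit.
Unset Printing Implicit Defensive.
Import Order.TTheory GRing.Theory Num.Theory.
Import numFieldNormedType.Exports.
Local Open Scope classical_set_scope.
Local Open Scope ring_scope.

(* R^m is 'rV[R]_m.  Topological notions use the library's (sup-norm)
   structure; every norm |.| that occurs quantitatively is Euclidean. *)
Definition enorm {R : realType} {m : nat} (x : 'rV[R]_m) : R :=
  Num.sqrt (\sum_(j < m) x ord0 j ^+ 2).

Definition finite_sup {R : realType} (S : set R) : Prop :=
  (ereal_sup (EFin @` S) < +oo)%E.

(* Coordinates and initial segments are numbered from 0 and are total: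
   out-of-range coordinates are 0. *)
Definition entry {R : realType} {m : nat} (x : 'rV[R]_m) (i : nat) : R :=
  if insub i is Some j then x ord0 (j : 'I_m) else 0.

Definition initial {R : realType} {m : nat} (i : nat) (x : 'rV[R]_m) : 'rV[R]_i :=
  \row_(j < i) entry x j.

(* An element of C^0([-r,0]; R^m) is represented by any function R -> R^m whose
   restriction to [-r,0] is continuous.  A map that is continuous for the
   sup-norm on [-r,0] depends only on this restriction. *)
Definition C0 {R : realType} (r : R) {m : nat} : set (R -> 'rV[R]_m) :=
  [set x | {within `[- r, 0], continuous x}].

Definition snorm {R : realType} (r : R) {m : nat} (x : R -> 'rV[R]_m) : R :=
  sup [set enorm (x theta) | theta in `[- r, 0]].

Definition hist {R : realType} {m : nat} (t : R) (x : R -> 'rV[R]_m) :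
  R -> 'rV[R]_m := fun theta => x (t + theta).

Definition initialC {R : realType} {m : nat} (i : nat) (x : R -> 'rV[R]_m) :
  R -> 'rV[R]_i := fun theta => initial i (x theta).

Definition bounded_C0 {R : realType} (r : R) {m : nat}
    (S : set (R -> 'rV[R]_m)) : Prop :=
  S `<=` C0 r /\ exists M : R, forall x, S x -> snorm r x <= M.

Section MapsOnC0.
Context {R : realType} (r : R) {Z Y : normedModType R} {m : nat}.
Implicit Types (A : set Z) (k : Z -> (R -> 'rV[R]_m) -> Y)
  (S : set (Z * (R -> 'rV[R]_m))).

Definition continuous_on_C0 A k : Prop :=
  forall z x, A z -> C0 r x -> forall e : R, 0 < e ->
  exists2 delta : R, 0 < delta &
    forall z' x', A z' -> C0 r x' -> `|z' - z| < delta ->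
      snorm r (x' \- x) < delta -> `|k z' x' - k z x| < e.

Definition closed_bounded A S : Prop :=
  [/\ forall p, S p -> A p.1 /\ C0 r p.2,
      forall z x, C0 r x ->
        (forall e : R, 0 < e -> exists z' x',
          [/\ S (z', x'), `|z' - z| < e & snorm r (x' \- x) < e]) ->
        S (z, x)
    & exists M : R, forall p, S p -> `|p.1| <= M /\ snorm r p.2 <= M].

(* x <> y in C^0([-r,0]; R^m) is expressed by 0 < ||x - y||_r. *)
Definition completely_locally_lipschitz A k : Prop :=
  forall S, closed_bounded A S ->
  finite_sup [set q | exists z x y,
     [/\ S (z, x), S (z, y), 0 < snorm r (x \- y) &
         q = `|k z x - k z y| / snorm r (x \- y)]].

End MapsOnC0.

Fixpoint Ck {R : realType} {m : nat} (k : nat) (F : 'rV[R]_m -> R) : Prop :=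
  if k is k'.+1 then
    [/\ continuous F,
        forall (j : 'I_m) x, derivable F x (delta_mx ord0 j)
      & forall j : 'I_m, Ck k' (fun x => 'D_(delta_mx ord0 j) F x)]
  else continuous F.

Definition smooth {R : realType} {m : nat} (F : 'rV[R]_m -> R) : Prop :=
  forall k, Ck k F.

(* C^oo(R^+): derivatives relative to [0,+oo), hence one-sided at 0. *)
Definition smooth_Rplus {R : realType} (phi : R -> R) : Prop :=
  exists dphi : nat -> R -> R,
    (forall t, 0 <= t -> dphi 0%N t = phi t) /\
    (forall k t, 0 <= t ->
       (dphi k s - dphi k t) / (s - t)
         @[s --> within [set s | 0 <= s /\ s != t] (nbhs t)] --> dphi k.+1 t).

Definition positive_definite {R : realType} (rho : R -> R) : Prop :=
  rho 0 = 0 /\ forall s, 0 < s -> 0 < rho s.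

Definition Kinfty {R : realType} (a : R -> R) : Prop :=
  [/\ positive_definite a,
      forall s s', 0 <= s -> s < s' -> a s < a s',
      {within `[0, +oo[, continuous a}
    & a s @[s --> +oo] --> +oo].

Definition Kplus {R : realType} (b : R -> R) : Prop :=
  (forall t, 0 <= t -> 0 < b t) /\ {within `[0, +oo[, continuous b}.

Definition classE {R : realType} (q : R -> R) : Prop :=
  [/\ forall t, 0 <= t -> 0 <= q t,
      {within `[0, +oo[, continuous q},
      (\int[lebesgue_measure]_(t in `[0%R, +oo[) (q t)%:E < +oo)%E
    & q t @[t --> +oo] --> 0].

Definition nondecreasing_Rplus {R : realType} (L : R -> R) : Prop :=
  forall s s', 0 <= s -> s <= s' -> L s <= L s'.

Definition absolutely_continuous {R : realType} {m : nat} (a b : R)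
    (x : R -> 'rV[R]_m) : Prop :=
  forall e : R, 0 < e -> exists2 delta : R, 0 < delta &
    forall (N : nat) (s t : 'I_N -> R),
      (forall i, a <= s i /\ s i <= t i /\ t i <= b) ->
      (forall i j, i != j -> t i <= s j \/ t j <= s i) ->
      \sum_(i < N) (t i - s i) < delta ->
      \sum_(i < N) enorm (x (t i) - x (s i)) < e.

(* Lebesgue measurability refers to the Caratheodory sigma-algebra, i.e. the
   domain of [completed_lebesgue_measure], rather than the Borel one. *)
Definition lebesgue_measurable_Rplus {R : realType} (h : R -> R) : Prop :=
  @measurable_fun _ _ (caratheodory_type (@wlength R idfun)^*%mu)
    (measurableTypeR R) `[0, +oo[ h.

Definition MD {R : realType} {l : nat} (D : set 'rV[R]_l) :
    set (R -> 'rV[R]_l) :=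
  [set d | [/\ forall t, 0 <= t -> D (d t),
     forall j : 'I_l, lebesgue_measurable_Rplus (fun t => d t ord0 j)
   & forall T : R, exists M : R,
       {ae lebesgue_measure, forall t : R, 0 <= t <= T -> enorm (d t) <= M}]].

Section Systems.
Context {R : realType} (r : R) {l m : nat} (D : set 'rV[R]_l)
  (F : R -> 'rV[R]_l -> (R -> 'rV[R]_m) -> 'rV[R]_m).

Definition is_solution (t0 : R) (x0 : R -> 'rV[R]_m) (d : R -> 'rV[R]_l)
    (T : \bar R) (x : R -> 'rV[R]_m) : Prop :=
  [/\ (t0%:E < T)%E,
      forall theta, - r <= theta <= 0 -> x (t0 + theta) = x0 theta,
      {within [set t | t0 - r <= t /\ (t%:E < T)%E], continuous x},
      forall b : R, t0 < b -> (b%:E < T)%E -> absolutely_continuous t0 b x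
    & {ae lebesgue_measure, forall t : R, t0 <= t -> (t%:E < T)%E ->
         is_derive t 1 x (F t (d t) (hist t x))}].

(* [x] on [t0 - r, T) is the unique maximal solution: every solution is one of
   its restrictions. *)
Definition is_maximal_solution (t0 : R) (x0 : R -> 'rV[R]_m) (d : R -> 'rV[R]_l)
    (T : \bar R) (x : R -> 'rV[R]_m) : Prop :=
  is_solution t0 x0 d T x /\
  forall T' x', is_solution t0 x0 d T' x' ->
    (T' <= T)%E /\
    forall t, t0 - r <= t -> (t%:E < T')%E -> x' t = x t.

(* [X t0 x0 d] is the solution; the suprema and estimates range over all
   t >= t0, so the maximal solutions have to be defined on [t0 - r, +oo). *)
Definition URGAS : Prop :=
  exists X : R -> (R -> 'rV[R]_m) -> (R -> 'rV[R]_l) -> R -> 'rV[R]_m,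
  [/\ forall t0 x0 d, 0 <= t0 -> C0 r x0 -> MD D d ->
        is_maximal_solution t0 x0 d +oo%E (X t0 x0 d),
      forall s T : R, 0 <= s -> 0 <= T ->
        finite_sup [set q | exists xi t0 x0 d,
           [/\ 0 <= xi <= T, C0 r x0 /\ snorm r x0 <= s, 0 <= t0 <= T, MD D d
             & q = snorm r (hist (t0 + xi) (X t0 x0 d))]],
      forall e : R, 0 < e ->
        finite_sup [set q | exists t t0 x0 d,
           [/\ t0 <= t, C0 r x0 /\ snorm r x0 <= e, 0 <= t0, MD D d
             & q = snorm r (hist t (X t0 x0 d))]] /\
        exists2 delta : R, 0 < delta &
          forall t0 x0 d, 0 <= t0 -> C0 r x0 -> snorm r x0 <= delta ->
            MD D d -> forall t, t0 <= t -> snorm r (hist t (X t0 x0 d)) <= e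
    & forall e M : R, 0 < e -> 0 <= M ->
        exists2 tau : R, 0 <= tau &
          forall t0 x0 d, 0 <= t0 -> C0 r x0 -> snorm r x0 <= M ->
            MD D d -> forall t, t0 + tau <= t ->
            snorm r (hist t (X t0 x0 d)) <= e].

End Systems.

Section Functionals.
Context {R : realType} (r : R) {m : nat}.
Implicit Types (V : R -> (R -> 'rV[R]_m) -> R) (x y : R -> 'rV[R]_m).

Definition Eh (h : R) x (v : 'rV[R]_m) : R -> 'rV[R]_m :=
  fun theta => if theta <= - h then x (theta + h) else x 0 + (theta + h) *: v.

(* The limsup over h -> 0+, y -> 0 as an infimum of suprema, in [-oo,+oo]. *)
Definition upper_deriv V (t : R) x (v : 'rV[R]_m) : \bar R :=
  ereal_inf [set S | exists2 delta : R, 0 < delta &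
    S = ereal_sup [set q | exists h y,
      [/\ 0 < h < delta, h < r, C0 r y, snorm r y < delta &
          q = ((V (t + h) (Eh h x v \+ (fun theta => h *: y theta)) - V t x)
                 / h)%:E]]].

Definition ess_derivative_bound x : \bar R :=
  ess_sup lebesgue_measure
    ((fun tau : R => (enorm ('D_1 x tau))%:E) \_ `[- r, 0]).

Definition almost_lipschitz V : Prop :=
  [/\ continuous_on_C0 r [set t : R | 0 <= t] V,
      forall t x, 0 <= t -> C0 r x -> 0 <= V t x &
  exists L P G : R -> R,
  [/\ [/\ nondecreasing_Rplus L, nondecreasing_Rplus P & nondecreasing_Rplus G],
      forall s, 0 <= s -> [/\ 0 <= L s, 0 <= P s & 1 <= G s],
      forall M : R, 0 <= M -> forall t x y, 0 <= t <= M ->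
        C0 r x -> C0 r y -> snorm r x <= M -> snorm r y <= M ->
        `|V t y - V t x| <= L M * snorm r (y \- x)
    & forall M : R, 0 <= M -> forall x, absolutely_continuous (- r) 0 x ->
        snorm r x <= M -> (ess_derivative_bound x < +oo)%E ->
        let b := fine (ess_derivative_bound x) in
        forall t h, 0 <= t <= M -> 0 <= h <= 1 / G (M + b) ->
          `|V (t + h) x - V t x| <= h * P M * (1 + b)]].

End Functionals.

(* The control space U is R. *)
Section SRCLF.
Context {R : realType} (r : R) {l m : nat} (D : set 'rV[R]_l)
  (f : R -> 'rV[R]_l -> (R -> 'rV[R]_m) -> R -> 'rV[R]_m)
  (V : R -> (R -> 'rV[R]_m) -> R).

Definition SRCLF_bounds : Prop :=
  exists a1 a2 beta mu : R -> R,
  [/\ Kinfty a1 /\ Kinfty a2, Kplus beta /\ Kplus mu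
    & forall t x, 0 <= t -> C0 r x ->
        Num.max (a1 (snorm r x)) (a1 (mu t * snorm r x)) <= V t x
        /\ V t x <= a2 (beta t * snorm r x)].

Definition SRCLF_decrease (p : nat) (Psi : R -> 'rV[R]_p -> R -> \bar R)
    (q : R -> R) (Phi : R -> (R -> 'rV[R]_m) -> 'rV[R]_p) (rho : R -> R) :
    Prop :=
  [/\ [/\ forall t phi u, 0 <= t -> Psi t phi u <> -oo%E,
          forall t, 0 <= t -> Psi t 0 0 = 0%E
        & forall u t phi, 0 <= t -> forall c : R, (Psi t phi u < c%:E)%E ->
            exists2 delta : R, 0 < delta &
            forall t' phi', 0 <= t' -> `|t' - t| < delta ->
              enorm (phi' - phi) < delta -> (Psi t' phi' u < c%:E)%E],
      classE q,
      [/\ continuous_on_C0 r [set t : R | 0 <= t] Phi,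
          completely_locally_lipschitz r [set t : R | 0 <= t] Phi
        & forall t, 0 <= t -> Phi t (fun=> 0) = 0],
      {within `[0, +oo[, continuous rho} /\ positive_definite rho
    & (forall t phi, 0 <= t ->
         (ereal_inf [set Psi t phi u | u in [set: R]] <= (q t)%:E)%E) /\
      forall (N : nat) (u lambda : 'I_N -> R),
        (forall i, 0 <= lambda i <= 1) -> \sum_(i < N) lambda i = 1 ->
        forall t x, 0 <= t -> C0 r x ->
        (ereal_sup [set upper_deriv r V t x
                          (f t d x (\sum_(i < N) lambda i * u i)%R) | d in D]
         <= (- rho (V t x))%:E
            + \big[Order.max/-oo]_(i < N) Psi t (Phi t x) (u i))%E].

Definition small_control (p : nat) (Psi : R -> 'rV[R]_p -> R -> \bar R)
    (q : R -> R) : Prop :=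
  exists a gamma : R -> R,
  [/\ Kinfty a, Kplus gamma
    & forall t phi, 0 <= t -> exists u : R,
        `|u| <= a (gamma t * enorm phi) /\ (Psi t phi u <= (q t)%:E)%E].

(* An SRCLF with the small-control property: Psi and q are common to the decrease
   condition and the small-control property, so the two are stated together. *)
Definition SRCLF_small_control : Prop :=
  [/\ almost_lipschitz r V, SRCLF_bounds
    & exists (p : nat) Psi q Phi rho,
        [/\ (0 < p)%N, @SRCLF_decrease p Psi q Phi rho
          & small_control Psi q]].

End SRCLF.

(* The state dimension is n.+1 and indices start at 0: [f i], [g i], [mu i],
   [k i] with i <= n stand for f_(i+1), g_(i+1), mu_(i+1), k_(i+1), and depend
   on the first i.+1 state components.  Their values for i > n are not used. *)

Definition triangular {R : realType} {l n : nat}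
    (f g : forall i : nat, R -> 'rV[R]_l -> (R -> 'rV[R]_i.+1) -> R)
    (t : R) (d : 'rV[R]_l) (x : R -> 'rV[R]_n.+1) (u : R) : 'rV[R]_n.+1 :=
  \row_(i < n.+1)
    (f i t d (initialC i.+1 x)
     + g i t d (initialC i.+1 x) * (if (i < n)%N then entry (x 0) i.+1 else u)).

Definition closed_loop {R : realType} {l n : nat}
    (f g : forall i : nat, R -> 'rV[R]_l -> (R -> 'rV[R]_i.+1) -> R)
    (kn : 'rV[R]_n.+1 -> R)
    (t : R) (d : 'rV[R]_l) (x : R -> 'rV[R]_n.+1) : 'rV[R]_n.+1 :=
  triangular f g t d x (kn (x 0)).

Definition lyapunov {R : realType} {n : nat} (r sigma : R)
    (k : forall i : nat, 'rV[R]_i.+1 -> R) (x : R -> 'rV[R]_n.+1) : R :=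
  sup [set expR (2 * sigma * theta) *
           (entry (x theta) 0 ^+ 2
            + \sum_(j < n) `|entry (x theta) j.+1
                             - k j (initial j.+1 (x theta))| ^+ 2)
      | theta in `[- r, 0]].

(* Main.v *)
Require Import Defs.
From HB Require Import structures.
From mathcomp Require Import all_boot all_order all_algebra.
From mathcomp Require Import all_classical all_reals all_analysis.
From mathcomp Require Import measurable_realfun.
From mathcomp Require Import ring lra.
Set Implicit Arguments.
Unset Strict Implicit.
Unset Printing Implicit Defensive.
Import Order.TTheory GRing.Theory Num.Theory.
Import numFieldNormedType.Exports.
Local Open Scope classical_set_scope.
Local Open Scope ring_scope.

(** Put [z_1 = x_1], [z_{j+1} = x_{j+1} - k_j], [W = sum_j z_j^2], and look for
    [mu_j(xi) = h_j(|xi|^2)] with [h_j] the sum of an everywhere convergent power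
    series with nonnegative coefficients: such functions are smooth, increasing
    on [R^+], and can be made larger than any prescribed function.  Suppose
    [W(x(theta)) <= 2 exp(2 sigma r) W(x(0))] on the history and let [M] be the
    largest [|z_j|] at time [0].  Then all error coordinates are at most a constant
    times [M] on the whole history, so every term of [z_j'] except [- g_j h_j z_j]
    is at most [3 N_j M], where [N_j] involves only [h_i] with [i < j] and an
    integer bound of [M].  For the largest [m] with [6 N_m |z_m| >= M], the terms of
    index above [m] contribute at most [M^2] each, and a large [h_m] makes
    [- g_m h_m z_m^2] absorb all the others: [W' <= - 2 sigma W].  This
    Razumikhin-type estimate bounds the derivative of [V], and it forces
    [exp(2 sigma t) W(x(t))] to stay below its initial supremum along solutions,
    which exist by Picard iteration and do not blow up because of this bound.

    Absolute continuity is used only through the fact that a function with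
    nonpositive derivative almost everywhere is nonincreasing; the exceptional null
    set is covered by an open set of small measure.  Indices start at [0]. *)

(** * Absolutely continuous functions *)

(** The obstacle is that the gain [h_m] sees only x_1, ..., x_m, while the terms it must absorb are
    proportional to M, the largest of all error coordinates, with constants that grow with M. The
    choice of m removes the conflict: the coordinate at which M is attained passes the selection
    test itself, so its index is at most m and M is determined by the coordinates that [h_m] sees.
    Coordinates of larger index fail the test and are small without any help from their gains.
    Bounding M by an integer leaves countably many constants for each index, which a single power
    series can dominate. In the bound on the history, exp(2 sigma r) is what a maximum of V at theta
    = 0 provides; the further factor 2 is a reserve for the argument along solutions, where the
    present value is only known to be at least half of a maximum. For the control Lyapunov property
    the decay estimate is perturbed by the input. It enters z_n' alone and linearly, so its effect
    is |z_n| |u - k_n| times a factor that depends on the present state. *)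

Section AbsolutelyContinuous.
Context {R : realType}.
Implicit Types (f : R -> R) (a b c e : R) (U : set R) (s : seq (R * R)).
Local Notation mu := (@lebesgue_measure R).

Definition scalar_ac a b f := forall e, 0 < e -> exists2 delta, 0 < delta &
  forall (N : nat) (s t : 'I_N -> R),
    (forall i, a <= s i /\ s i <= t i /\ t i <= b) ->
    (forall i j, i != j -> t i <= s j \/ t j <= s i) ->
    \sum_(i < N) (t i - s i) < delta ->
    \sum_(i < N) `|f (t i) - f (s i)| < e.

(* [s] lists the subintervals of [[a, c]] that lie in the exceptional set [U];
   everywhere else [f] grows at rate at most [e]. *)
Let excess f a e U c s :=
  [/\ all (fun p : R * R => [&& a <= p.1, p.1 <= p.2 & p.2 <= c]) s,
      pairwise (fun p q : R * R => p.2 <= q.1) s,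
      ((\sum_(p <- s) (p.2 - p.1))%:E <= mu (U `&` `[a, c[))%E
    & f c - f a <= e * (c - a) + \sum_(p <- s) `|f p.2 - f p.1|].

Let excess_slope f a e U c c' s : a <= c <= c' -> excess f a e U c s ->
  measurable U ->
  f c' - f c <= e * (c' - c) -> excess f a e U c' s.
Proof.
move=> /andP[ac cc'] [s1 s2 s3 s4] mU fcc'; split=> //.
- apply: sub_all s1 => p /and3P[-> -> /= pc]; exact: le_trans pc cc'.
- apply: (le_trans s3); apply: le_measure; rewrite ?inE; try by apply: measurableI.
  by move=> x [Ux]; rewrite /= !in_itv/= => /andP[-> /lt_le_trans->].
- have -> : f c' - f a = (f c' - f c) + (f c - f a) by ring.
  have -> : e * (c' - a) = e * (c' - c) + e * (c - a) by ring.
  by rewrite -[leRHS]addrA; apply: lerD.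
Qed.

(** The new interval is charged to the list: its length is paid for by the part of [U] in [c, c'),
    which is disjoint from the part counted so far. *)
Let excess_bad f a e U c c' s : 0 <= e -> a <= c <= c' -> excess f a e U c s ->
  measurable U ->
  `[c, c'] `<=` U -> excess f a e U c' (rcons s (c, c')).
Proof.
move=> e0 /andP[ac cc'] [s1 s2 s3 s4] mU cU; split=> //.
- rewrite all_rcons /= ac cc' lexx /=.
  by apply: sub_all s1 => p /and3P[-> -> /= pc]; exact: le_trans pc cc'.
- rewrite pairwise_rcons s2 andbT.
  by apply: sub_all s1 => p /and3P[].
- rewrite -cats1 big_cat big_seq1 /= EFinD.
  have -> : U `&` `[a, c'[ = (U `&` `[a, c[) `|` `[c, c'[.
    apply/seteqP; split => x /=; rewrite !in_itv/=.
      move=> [Ux /andP[ax xc]]; case: (ltP x c) => xc'; last by right; rewrite xc.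
      by left; rewrite ax.
    move=> [[Ux /andP[-> xc]]|/andP[cx xc]]; first by rewrite (lt_le_trans xc cc').
    rewrite (le_trans ac cx) xc; split=> //; apply: cU => /=.
    by rewrite in_itv/= cx ltW.
  rewrite measureU //.
  + apply: leeD => //.
    have -> : (c' - c)%:E = mu `[c, c'[%classic; last by [].
    rewrite lebesgue_measure_itv/= lte_fin.
    case: ltP => h; first by rewrite EFinD.
    by have -> : c' = c; [apply/eqP; rewrite eq_le h | rewrite subrr].
  + by apply: measurableI.
  + apply/seteqP; split => x //=; rewrite !in_itv/=.
    by move=> [[_ /andP[_ xc]] /andP[cx _]]; move: xc; rewrite ltNge cx.
- rewrite -cats1 big_cat big_seq1 /=.
  have -> : f c' - f a = (f c - f a) + (f c' - f c) by ring.
  have -> : e * (c' - a) = e * (c - a) + e * (c' - c) by ring.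
  have := ler_norm (f c' - f c).
  have : 0 <= e * (c' - c) by rewrite mulr_ge0// subr_ge0.
  lra.
Qed.

(** The two one-sided bounds let an interval [c, c'] around t be split at t, so that no difference
    quotient with two moving ends is needed. *)
Let derive_straddle f (t l : R) e : is_derive t 1 f l -> l <= 0 -> 0 < e ->
  exists2 eta, 0 < eta & forall u, `|u - t| < eta ->
    (t <= u -> f u - f t <= e * (u - t)) /\ (u <= t -> f t - f u <= e * (t - u)).
Proof.
move=> [df fl] l0 e0.
have : h^-1 *: (f (h + t) - f t) @[h --> 0^'] --> l.
  by rewrite -fl -derive1E; have := (derivable_nbhsP f t 1).1 df => _; rewrite derive1E;
    move: df; rewrite /derivable /derive /=;
    under eq_fun do rewrite [_%:A]mulr1.
move/cvgrPdist_lt => /(_ _ e0); rewrite near_withinE.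
move=> [eta /= eta0 H]; exists eta => // u utau.
have [-> | ut] := eqVneq u t; first by rewrite !subrr mulr0.
have ut0 : u - t != 0 by rewrite subr_eq0.
have := H (u - t); rewrite /ball /= sub0r normrN => /(_ utau ut0).
rewrite subrK => /ltr_distlCDr.
rewrite /GRing.scale /= => hq.
have {}hq : (u - t)^-1 * (f u - f t) < e by lra.
split=> tu.
  have tu' : 0 < u - t by rewrite subr_gt0 lt_neqAle eq_sym ut.
  by apply: ltW; move: hq; rewrite ltr_pdivrMl// mulrC.
have tu' : u - t < 0 by rewrite subr_lt0 lt_neqAle ut.
move: hq; rewrite ltr_ndivrMl// => hq.
have -> : f t - f u = - (f u - f t) by ring.
have -> : e * (t - u) = - ((u - t) * e) by ring.
by rewrite lerN2 ltW.
Qed.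

(** Continuous induction in place of a Vitali covering. The supremum [sg] of the points reached lies
    either in the open set [U], where a whole neighbourhood is charged to the list, or at a point
    with derivative at most 0, around which the growth rate is at most [e]. The list has total
    length below [delta], so absolute continuity bounds its contribution by [e]. *)
Lemma ac_nonincreasing a b f : a <= b -> scalar_ac a b f ->
  {ae mu, forall t : R, a < t < b -> exists2 l : R, l <= 0 & is_derive t 1 f l} ->
  f b <= f a.
Proof.
move=> ab acf [N [mN muN NP]].
suff key e : 0 < e -> f b - f a <= e * (b - a) + e.
  rewrite -subr_le0; apply/ler_addgt0Pr => e e0; rewrite add0r.
  have b1 : 0 < b - a + 1 by rewrite ltr_wpDl// subr_ge0.
  have := key (e / (b - a + 1)); rewrite divr_gt0// => /(_ isT).
  suff -> : e / (b - a + 1) * (b - a) + e / (b - a + 1) = e by [].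
  by field; rewrite gt_eqF.
move=> e0; have [delta delta0 Hdelta] := acf _ e0.
(* The end points join the exceptional set because the derivative is assumed only strictly between
   them. *)
pose N' := N `|` [set a; b].
have mN' : measurable N' by apply: measurableU => //; apply: measurableU.
have muN' : mu N' = 0%E.
  apply/eqP; rewrite eq_le measure_ge0 andbT.
  have h1 : (mu N' <= mu N + mu [set a; b])%E.
    by apply: measureU2 => //; exact: measurableU.
  have h2 : (mu [set a; b] <= mu [set a] + mu [set b])%E by exact: measureU2.
  apply: (le_trans h1); rewrite muN add0e; apply: (le_trans h2).
  by rewrite !lebesgue_measure_set1 adde0.
have muN'oo : (mu N' < +oo)%E by rewrite muN' ltry.
have [U [oU NU muUN]] := lebesgue_regularity_outer mN' muN'oo delta0.
have mU : measurable U by exact: open_measurable.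
have muU : (mu U < delta%:E)%E.
  have -> : U = N' `|` (U `\` N') by rewrite setDUK.
  have h : (mu (N' `|` (U `\` N')) <= mu N' + mu (U `\` N'))%E.
    by apply: measureU2 => //; exact: measurableD.
  by apply: (le_lt_trans h); rewrite muN' add0e.
pose S := [set c | a <= c <= b /\ exists s, excess f a e U c s].
have Sa : S a.
  split; first by rewrite lexx.
  exists [::]; split=> //; first by rewrite big_nil measure_ge0.
  by rewrite !subrr mulr0 big_nil addr0.
have supS : has_sup S by split; [exists a | exists b => c [/andP[]]].
pose sg := sup S.
have asg : a <= sg by apply: ub_le_sup => //; exact: supS.2.
have sgb : sg <= b by apply: ge_sup; [exists a | move=> c [/andP[]]].
have step : exists2 eta, 0 < eta & forall c c', a <= c -> c <= sg -> sg <= c' -> c' <= b ->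
    `|c - sg| < eta -> `|c' - sg| < eta ->
    (exists s, excess f a e U c s) -> exists s, excess f a e U c' s.
  have [sgU|sgU] := pselect (U sg).
    move: oU; rewrite openE => /(_ _ sgU) [eta /= eta0 Heta].
    exists eta => // c c' ac csg sgc c'b ceta c'eta [s es].
    exists (rcons s (c, c')); apply: excess_bad => //; first exact: ltW.
      by rewrite ac (le_trans csg).
    move=> x /=; rewrite in_itv/= => /andP[cx xc']; apply: Heta.
    rewrite /ball/=; move: ceta c'eta.
    by rewrite !ltr_distl => /andP[? ?] /andP[? ?]; apply/andP; split; lra.
  have sgN' : ~ N' sg by move/NU.
  have sga : sg != a by apply/eqP => h; apply: sgN'; right; left.
  have sgb' : sg != b by apply/eqP => h; apply: sgN'; right; right.
  have : ~ ~ (a < sg < b -> exists2 l : R, l <= 0 & is_derive sg 1 f l).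
    by move=> h; apply: sgN'; left; apply: NP.
  move/contrapT; case.
    by rewrite !lt_neqAle eq_sym sga asg sgb' sgb.
  move=> l l0 fl; have [eta eta0 Heta] := derive_straddle fl l0 e0.
  exists eta => // c c' ac csg sgc c'b ceta c'eta [s es].
  exists s; apply: (@excess_slope f a e U sg) => //; first by rewrite asg.
    apply: excess_slope es _ _ => //; first by rewrite ac.
    by apply: (Heta _ ceta).2.
  by apply: (Heta _ c'eta).1.
have [eta eta0 Heta] := step.
have [c [cab cS] csg] : exists2 c, S c & sg - eta < c.
  by have [c Sc h] := sup_adherent eta0 supS; exists c.
have csg' : c <= sg by apply: ub_le_sup; [exact: supS.2 | split].
have cD : `|c - sg| < eta by rewrite ltr_distl; lra.
have [s [s1 s2 s3 s4]] : exists s, excess f a e U b s.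
  (* Either [b] is within reach of [sg], or [sg + eta / 2] is reached too, against the choice of
     [sg]. *)
  case: (leP b (sg + eta / 2)) => [bs|sb].
    apply: (Heta c b) => //; first by case/andP: cab.
    by rewrite ltr_distl; lra.
  exfalso.
  have : sg + eta / 2 <= sg.
    apply: ub_le_sup; first exact: supS.2.
    split; first lra.
    apply: (Heta c) => //; [by case/andP: cab|lra|exact: ltW|].
    by rewrite ltr_distl; lra.
  lra.
apply: (le_trans s4); rewrite lerD2l; apply: ltW.
have nthP i : (i < size s)%N -> a <= (nth (0,0) s i).1 /\
   (nth (0,0) s i).1 <= (nth (0,0) s i).2 /\ (nth (0,0) s i).2 <= b.
  by move=> h; have /and3P[-> -> ->] := (all_nthP (0,0) s1) _ h.
have := Hdelta (size s) (fun i => (nth (0,0) s i).1) (fun i => (nth (0,0) s i).2).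
rewrite (big_nth (0,0)) big_mkord; apply => //.
- by move=> i; apply: nthP.
- move=> i j ij; move/(pairwiseP (0,0)): s2 => s2.
  case: (ltngtP i j) => h; [left|right|].
  + by apply: s2 => //=; rewrite inE.
  + by apply: s2 => //=; rewrite inE.
  + by move/val_inj : h ij => ->; rewrite eqxx.
- rewrite -lte_fin; apply: (le_lt_trans _ muU).
  rewrite (big_nth (0,0)) big_mkord in s3; apply: (le_trans s3).
  by apply: le_measure; rewrite ?inE//; apply: measurableI.
Qed.

End AbsolutelyContinuous.

(** * Euclidean and history norms *)

Section EuclideanNorm.
Context {R : realType}.
Implicit Types (m : nat).

Lemma enorm_ge0 m (x : 'rV[R]_m) : 0 <= enorm x.
Proof. exact: sqrtr_ge0. Qed.

Lemma enorm_sqr m (x : 'rV[R]_m) : enorm x ^+ 2 = \sum_(j < m) x ord0 j ^+ 2.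
Proof. by rewrite sqr_sqrtr// sumr_ge0// => j _; exact: sqr_ge0. Qed.

Lemma enorm0 m : enorm (0 : 'rV[R]_m) = 0.
Proof. by rewrite /enorm big1 ?sqrtr0// => j _; rewrite mxE expr0n. Qed.

Lemma enormN m (x : 'rV[R]_m) : enorm (- x) = enorm x.
Proof. by rewrite /enorm; under eq_bigr do rewrite mxE sqrrN. Qed.

Lemma enormB m (x y : 'rV[R]_m) : enorm (x - y) = enorm (y - x).
Proof. by rewrite -enormN opprB. Qed.

Lemma enormZ m (a : R) (x : 'rV[R]_m) : enorm (a *: x) = `|a| * enorm x.
Proof.
rewrite /enorm; under eq_bigr do rewrite mxE exprMn.
by rewrite -mulr_sumr sqrtrM ?sqr_ge0// sqrtr_sqr.
Qed.

Lemma sqr_le_enorm_sqr m (x : 'rV[R]_m) j : x ord0 j ^+ 2 <= enorm x ^+ 2.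
Proof.
rewrite enorm_sqr (bigD1 j)//= lerDl sumr_ge0// => i _; exact: sqr_ge0.
Qed.

Lemma coord_le_enorm m (x : 'rV[R]_m) j : `|x ord0 j| <= enorm x.
Proof.
rewrite -(@ler_pXn2r _ 2)// ?nnegrE ?enorm_ge0//.
by rewrite real_normK ?num_real// sqr_le_enorm_sqr.
Qed.

(** Lagrange's identity: the right side minus the left is half the double sum of
    [(a i * b j - a j * b i) ^+ 2]. *)
Lemma cauchy_schwarz m (a b : 'I_m -> R) :
  (\sum_i a i * b i) ^+ 2 <= (\sum_i a i ^+ 2) * (\sum_i b i ^+ 2).
Proof.
rewrite -subr_ge0.
have -> : (\sum_i a i ^+ 2) * (\sum_i b i ^+ 2) - (\sum_i a i * b i) ^+ 2 =
    2^-1 * \sum_i \sum_j (a i * b j - a j * b i) ^+ 2.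
  have e1 : (\sum_i a i ^+ 2) * (\sum_i b i ^+ 2) = \sum_i \sum_j a i ^+ 2 * b j ^+ 2.
    by rewrite mulr_suml; apply: eq_bigr => i _; rewrite mulr_sumr.
  have e2 : (\sum_i a i ^+ 2) * (\sum_i b i ^+ 2) = \sum_i \sum_j a j ^+ 2 * b i ^+ 2.
    by rewrite e1 exchange_big.
  have e3 : (\sum_i a i * b i) ^+ 2 = \sum_i \sum_j (a i * b i) * (a j * b j).
    by rewrite expr2 mulr_suml; apply: eq_bigr => i _; rewrite mulr_sumr.
  have -> : \sum_i \sum_j (a i * b j - a j * b i) ^+ 2 =
    \sum_i \sum_j a i ^+ 2 * b j ^+ 2 + \sum_i \sum_j a j ^+ 2 * b i ^+ 2
      - 2 * \sum_i \sum_j (a i * b i) * (a j * b j).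
    rewrite mulr_sumr -big_split -sumrB; apply: eq_bigr => i _ /=.
    rewrite mulr_sumr -big_split -sumrB; apply: eq_bigr => j _ /=; ring.
  by rewrite -e1 -e2 e3; field.
rewrite mulr_ge0 ?invr_ge0// sumr_ge0// => i _; rewrite sumr_ge0// => j _.
exact: sqr_ge0.
Qed.

Lemma ler_enormD m (x y : 'rV[R]_m) : enorm (x + y) <= enorm x + enorm y.
Proof.
rewrite -(@ler_pXn2r _ 2)// ?nnegrE ?addr_ge0 ?enorm_ge0//.
rewrite sqrrD !enorm_sqr.
have -> : \sum_(j < m) (x + y) ord0 j ^+ 2 =
  \sum_(j < m) x ord0 j ^+ 2 + (\sum_(j < m) x ord0 j * y ord0 j) *+ 2
   + \sum_(j < m) y ord0 j ^+ 2.
  rewrite -mulr_natr mulr_suml -!big_split /=; apply: eq_bigr => j _.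
  rewrite !mxE; ring.
rewrite lerD2r lerD2l lerMn2r/=.
apply: (le_trans (ler_norm _)).
rewrite -(@ler_pXn2r _ 2)// ?nnegrE ?mulr_ge0 ?enorm_ge0//.
by rewrite real_normK ?num_real// exprMn !enorm_sqr cauchy_schwarz.
Qed.

Lemma ler_enormB m (x y : 'rV[R]_m) : enorm (x - y) <= enorm x + enorm y.
Proof. by rewrite -(enormN y) ler_enormD. Qed.

Lemma ler_dist_enorm m (x y : 'rV[R]_m) : `|enorm x - enorm y| <= enorm (x - y).
Proof.
have h1 := ler_enormD (x - y) y; have h2 := ler_enormD (y - x) x.
move: h1 h2; rewrite !subrK (enormB y) => h1 h2.
by rewrite ler_norml; apply/andP; split; lra.
Qed.

Lemma enorm_le_sum m (x : 'rV[R]_m) : enorm x <= \sum_j `|x ord0 j|.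
Proof.
rewrite -(@ler_pXn2r _ 2)// ?nnegrE ?enorm_ge0// ?sumr_ge0//.
rewrite enorm_sqr expr2 mulr_suml; apply: ler_sum => j _.
rewrite -real_normK ?num_real// expr2 ler_wpM2l//.
by rewrite (bigD1 j)//= lerDl sumr_ge0.
Qed.

Lemma enorm_le_bound m (x : 'rV[R]_m) (B : R) :
  (forall j, `|x ord0 j| <= B) -> enorm x <= m%:R * B.
Proof.
move=> xB; apply: (le_trans (enorm_le_sum x)).
by apply: le_trans (ler_sum _ (fun j _ => xB j)) _; rewrite sumr_const card_ord mulr_natl.
Qed.

Lemma norm_le_enorm m (x : 'rV[R]_m) : `|x| <= enorm x.
Proof.
rewrite [leLHS]/Num.Def.normr/= mx_normrE (bigmax_le _ (enorm_ge0 x))//= => -[i j] _.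
by rewrite /= ord1 coord_le_enorm.
Qed.

Lemma coord_le_norm m (x : 'rV[R]_m) j : `|x ord0 j| <= `|x|.
Proof.
rewrite [leRHS]/Num.Def.normr/= mx_normrE.
exact: (@le_bigmax _ _ _ 0 (fun i : 'I_1 * 'I_m => `|x i.1 i.2|) (ord0, j)).
Qed.

Lemma enorm_le_norm m (x : 'rV[R]_m) : enorm x <= m%:R * `|x|.
Proof. by apply: enorm_le_bound => j; exact: coord_le_norm. Qed.

Lemma enorm_eq0 m (x : 'rV[R]_m) : enorm x <= 0 -> x = 0.
Proof.
move=> x0; apply/rowP => j; rewrite mxE; apply/eqP; rewrite -normr_eq0 eq_le normr_ge0 andbT.
exact: le_trans (coord_le_enorm x j) x0.
Qed.

Lemma entry_le_enorm m (x : 'rV[R]_m) i : `|entry x i| <= enorm x.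
Proof.
rewrite /entry; case: insubP => [j _ _|_]; first exact: coord_le_enorm.
by rewrite normr0 enorm_ge0.
Qed.

Lemma entryE m (x : 'rV[R]_m) i (h : (i < m)%N) : entry x i = x ord0 (Ordinal h).
Proof. by rewrite /entry insubT. Qed.

Lemma entry_ord m (x : 'rV[R]_m) (i : 'I_m) : entry x i = x ord0 i.
Proof. by rewrite (entryE x (ltn_ord i)); congr (x _ _); exact: val_inj. Qed.

Lemma entry_initial m i j (x : 'rV[R]_m) : (j < i)%N -> entry (initial i x) j = entry x j.
Proof. by move=> h; rewrite (entryE _ h) mxE. Qed.

Lemma initial_initial m i j (x : 'rV[R]_m) : (j <= i)%N ->
  initial j (initial i x) = initial j x.
Proof.
move=> ij; apply/rowP => s; rewrite !mxE entry_initial//.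
exact: leq_trans (ltn_ord s) ij.
Qed.

Lemma initial_id m (x : 'rV[R]_m) : initial m x = x.
Proof. by apply/rowP => s; rewrite mxE entry_ord. Qed.

Lemma entryD m (x y : 'rV[R]_m) i : entry (x + y) i = entry x i + entry y i.
Proof. by rewrite /entry; case: insubP => [j _ _|_]; rewrite ?mxE ?addr0. Qed.

Lemma entryZ m a (x : 'rV[R]_m) i : entry (a *: x) i = a * entry x i.
Proof. by rewrite /entry; case: insubP => [j _ _|_]; rewrite ?mxE ?mulr0. Qed.

Lemma entry0 m i : entry (0 : 'rV[R]_m) i = 0.
Proof. by rewrite -(scale0r 0) entryZ mul0r. Qed.

Lemma entryN m (x : 'rV[R]_m) i : entry (- x) i = - entry x i.
Proof. by rewrite -scaleN1r entryZ mulN1r. Qed.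

Lemma initialD m i (x y : 'rV[R]_m) : initial i (x + y) = initial i x + initial i y.
Proof. by apply/rowP => j; rewrite !mxE entryD. Qed.

Lemma initialZ m i a (x : 'rV[R]_m) : initial i (a *: x) = a *: initial i x.
Proof. by apply/rowP => j; rewrite !mxE entryZ. Qed.

Lemma initialN m i (x : 'rV[R]_m) : initial i (- x) = - initial i x.
Proof. by apply/rowP => j; rewrite !mxE entryN. Qed.

Lemma initialB m i (x y : 'rV[R]_m) : initial i (x - y) = initial i x - initial i y.
Proof. by rewrite initialD initialN. Qed.

Lemma enorm_initialS_sqr m i (x : 'rV[R]_m) :
  enorm (initial i.+1 x) ^+ 2 = enorm (initial i x) ^+ 2 + entry x i ^+ 2.
Proof.
rewrite !enorm_sqr big_ord_recr/=; congr (_ + _); last by rewrite mxE.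
by apply: eq_bigr => j _; rewrite !mxE.
Qed.

Lemma enorm_initialS m i (x : 'rV[R]_m) :
  enorm (initial i.+1 x) <= enorm (initial i x) + `|entry x i|.
Proof.
rewrite -(@ler_pXn2r _ 2)// ?nnegrE ?addr_ge0 ?enorm_ge0//.
rewrite enorm_initialS_sqr sqrrD real_normK ?num_real// lerD2r lerDl.
by rewrite mulrn_wge0// mulr_ge0 ?enorm_ge0.
Qed.

Lemma enorm_initial_le m i j (x : 'rV[R]_m) : (i <= j)%N ->
  enorm (initial i x) <= enorm (initial j x).
Proof.
elim: j => [|j IH]; first by rewrite leqn0 => /eqP ->.
rewrite leq_eqVlt => /orP[/eqP -> //|/IH h]; apply: (le_trans h).
rewrite -(@ler_pXn2r _ 2)// ?nnegrE ?enorm_ge0//.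
by rewrite enorm_initialS_sqr lerDl sqr_ge0.
Qed.

Lemma enorm_initial m i (x : 'rV[R]_m) : enorm (initial i x) <= enorm x.
Proof.
case: (leqP i m) => h; first by rewrite -[in leRHS](initial_id x) enorm_initial_le.
rewrite -(@ler_pXn2r _ 2)// ?nnegrE ?enorm_ge0//.
(* Here [m < i]: the coordinates of index at least [m] have the default value 0 of [entry]. *)
rewrite -(subnKC (ltnW h)) enorm_sqr big_split_ord/= enorm_sqr.
rewrite (_ : \sum_(j < _) _ = \sum_(j < m) x ord0 j ^+ 2); last first.
  by apply: eq_bigr => j _; rewrite mxE/= entry_ord.
rewrite (_ : \sum_(j < i - m) _ = 0) ?addr0// big1// => j _.
by rewrite mxE/= /entry insubF ?expr0n//= ltnNge leq_addr.
Qed.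

End EuclideanNorm.

(** * Histories and their norms *)

Section History.
Context {R : realType}.
Implicit Types (m : nat) (r : R).

Lemma within_continuousP (V : normedModType R) (A : set R) (x : R -> V) :
  {within A, continuous x} <->
  forall t, A t -> forall e, 0 < e -> exists2 d, 0 < d &
    forall s, A s -> `|s - t| < d -> `|x s - x t| < e.
Proof.
split=> [cx t At e e0|H].
  have /cvgrPdist_lt/(_ _ e0) := (subspace_continuousP A x).1 cx t At.
  rewrite /= near_withinE => -[d /= d0 Hd]; exists d => // s As st.
  by rewrite distrC; apply: Hd => //=; rewrite distrC.
apply/subspace_continuousP => t At; apply/cvgrPdist_lt => e e0.
have [d d0 Hd] := H t At e e0.
rewrite near_withinE; exists d => //= s st As; rewrite distrC; apply: Hd => //.
by rewrite distrC.
Qed.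

Lemma within_continuous_enormP m (A : set R) (x : R -> 'rV[R]_m) :
  {within A, continuous x} <->
  forall t, A t -> forall e, 0 < e -> exists2 d, 0 < d &
    forall s, A s -> `|s - t| < d -> enorm (x s - x t) < e.
Proof.
split=> [/within_continuousP cx t At e e0|H].
  have [d d0 Hd] := cx t At (e / m.+1%:R) (divr_gt0 e0 (ltr0Sn _ _)).
  exists d => // s As st; apply: (le_lt_trans (enorm_le_norm _)).
  apply: (@le_lt_trans _ _ (m.+1%:R * `|x s - x t|)).
    by rewrite ler_wpM2r// ler_nat.
  by rewrite mulrC -ltr_pdivlMr// Hd.
apply/within_continuousP => t At e e0; have [d d0 Hd] := H t At e e0.
by exists d => // s As st; apply: (le_lt_trans (norm_le_enorm _)); exact: Hd.
Qed.

Lemma continuous_withinT (V : normedModType R) (A : set R) (x : R -> V) :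
  continuous x -> {within A, continuous x}.
Proof. by move=> cx; exact: continuous_subspaceT. Qed.

Definition C0_enormP r m (x : R -> 'rV[R]_m) := within_continuous_enormP `[- r, 0] x.

Lemma C0B r m (x y : R -> 'rV[R]_m) : C0 r x -> C0 r y -> C0 r (x \- y).
Proof. by move=> cx cy t; exact: cvgB (cx t) (cy t). Qed.

Lemma C0_cst r m (v : 'rV[R]_m) : C0 r (fun=> v).
Proof. by move=> t; exact: cvg_cst. Qed.

Lemma C0_comp r m p (x : R -> 'rV[R]_m) (phi : 'rV[R]_m -> 'rV[R]_p) :
  (forall u v, enorm (phi u - phi v) <= enorm (u - v)) -> C0 r x -> C0 r (phi \o x).
Proof.
move=> lip /C0_enormP cx; apply/C0_enormP => t At e e0.
by have [d d0 Hd] := cx t At e e0; exists d => // s As st; apply: (le_lt_trans (lip _ _)); exact: Hd.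
Qed.

Lemma C0_initial r m i (x : R -> 'rV[R]_m) : C0 r x -> C0 r (initialC i x).
Proof. by apply: C0_comp => u v; rewrite -initialB enorm_initial. Qed.

Lemma C0_bounded r m (x : R -> 'rV[R]_m) : 0 <= r -> C0 r x ->
  exists M, forall t, - r <= t <= 0 -> enorm (x t) <= M.
Proof.
move=> r0 /C0_enormP cx.
have r0' : - r <= 0 by rewrite oppr_le0.
have cn : {within `[- r, 0], continuous (fun t => enorm (x t))}.
  apply/within_continuousP => t At e e0; have [d d0 Hd] := cx t At e e0.
  exists d => // s As st; apply: le_lt_trans (Hd s As st).
  exact: ler_dist_enorm.
have [c cI Hc] := EVT_max r0' cn.
by exists (enorm (x c)) => t ti; apply: Hc; rewrite in_itv.
Qed.

Lemma snorm_nonempty r m (x : R -> 'rV[R]_m) : 0 <= r ->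
  [set enorm (x theta) | theta in `[- r, 0]] (enorm (x 0)).
Proof. by move=> r0; exists 0 => //=; rewrite in_itv/= lexx andbT oppr_le0. Qed.

Lemma enorm_le_snorm r m (x : R -> 'rV[R]_m) t : 0 <= r -> C0 r x ->
  - r <= t <= 0 -> enorm (x t) <= snorm r x.
Proof.
move=> r0 cx tr; apply: ub_le_sup; last by exists t => //=; rewrite in_itv.
have [M HM] := C0_bounded r0 cx.
by exists M => _ [s /= + <-]; rewrite in_itv/=; exact: HM.
Qed.

Lemma enorm0_le_snorm r m (x : R -> 'rV[R]_m) : 0 <= r -> C0 r x ->
  enorm (x 0) <= snorm r x.
Proof. by move=> r0 cx; apply: enorm_le_snorm => //; rewrite lexx andbT oppr_le0. Qed.

Lemma snorm_le r m (x : R -> 'rV[R]_m) M : 0 <= r ->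
  (forall t, - r <= t <= 0 -> enorm (x t) <= M) -> snorm r x <= M.
Proof.
move=> r0 H; apply: ge_sup; first by exists (enorm (x 0)); exact: snorm_nonempty.
by move=> _ [s /= + <-]; rewrite in_itv/=; exact: H.
Qed.

Lemma snorm_ge0 r m (x : R -> 'rV[R]_m) : 0 <= snorm r x.
Proof.
rewrite /snorm; set S := (X in sup X).
have [[[v Sv] hub]|hs] := pselect (has_sup S); last by rewrite sup_out.
apply: (@le_trans _ _ v); last exact: ub_le_sup.
by case: Sv => s _ <-; exact: enorm_ge0.
Qed.

Lemma snorm0 r m : 0 <= r -> snorm r (fun=> 0 : 'rV[R]_m) = 0.
Proof.
move=> r0; apply/eqP; rewrite eq_le snorm_ge0 andbT; apply: snorm_le => // t _.
by rewrite enorm0.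
Qed.

Lemma ler_snormD r m (x y : R -> 'rV[R]_m) : 0 <= r -> C0 r x -> C0 r y ->
  snorm r (x \+ y) <= snorm r x + snorm r y.
Proof.
move=> r0 cx cy; apply: snorm_le => // t tr /=.
by apply: (le_trans (ler_enormD _ _)); apply: lerD; exact: enorm_le_snorm.
Qed.

Lemma snorm_initial r m i (x : R -> 'rV[R]_m) : 0 <= r -> C0 r x ->
  snorm r (initialC i x) <= snorm r x.
Proof.
move=> r0 cx; apply: snorm_le => // t tr; apply: (le_trans (enorm_initial _ _)).
exact: enorm_le_snorm.
Qed.

Lemma snormC r m (x y : R -> 'rV[R]_m) : snorm r (x \- y) = snorm r (y \- x).
Proof.
by congr sup; apply/seteqP; split => _ [s sr <-]; exists s => //=; rewrite enormB.
Qed.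

Lemma C0_hist r m (t : R) (x : R -> 'rV[R]_m) (A : set R) :
  {within A, continuous x} -> `[t - r, t] `<=` A -> C0 r (hist t x).
Proof.
move=> /within_continuous_enormP cx tA; apply/C0_enormP => s /=.
rewrite in_itv/= => sr e e0.
have As u : - r <= u <= 0 -> A (t + u).
  by move=> ur; apply: tA; rewrite /= in_itv/=; lra.
have [d d0 Hd] := cx _ (As _ sr) e e0; exists d => // u /=; rewrite in_itv/= => ur us.
by apply: Hd; [exact: As|rewrite [X in `|X|](_ : _ = u - s)//; ring].
Qed.

Lemma continuous_hist r m (t : R) (x : R -> 'rV[R]_m) : continuous x -> C0 r (hist t x).
Proof. by move=> cx; apply: (@C0_hist _ _ _ _ setT) => //; exact: continuous_withinT. Qed.

End History.

(** * Primitives and Caratheodory measurability *)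

Section Primitive.
Context {R : realType}.
Local Notation mu := (@lebesgue_measure R).

Lemma bounded_integrable_itv (phi : R -> R) (t0 T B : R) (b : bool) :
  measurable_fun setT phi -> (forall t, t <= T -> `|phi t| <= B) ->
  mu.-integrable [set` Interval (BSide b t0) (BRight T)] (EFin \o phi).
Proof.
move=> mphi bphi.
have fin : (mu [set` Interval (BSide b t0) (BRight T)] < +oo)%E.
  rewrite lebesgue_measure_itv/=; case: ifPn => _; last exact: ltry.
  by rewrite -EFinB ltry.
apply: measurable_bounded_integrable => //.
- exact: measurable_funS mphi.
- exists B; split; first exact: num_real.
  move=> M BM t /=; rewrite in_itv/= => /andP[_ tT].
  by apply: le_trans (ltW BM); exact: bphi.
Qed.

(** Integration from [t0], continued by 0 to the left, gives one function on the whole line. The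
    bound on [phi] yields the Lipschitz estimate, and the fundamental theorem for Lebesgue integrals
    the derivative almost everywhere. *)
Lemma primitive_exists (phi : R -> R) (t0 : R) (B : R -> R) :
  measurable_fun setT phi ->
  (forall t, t < t0 -> phi t = 0) ->
  (forall T t, t <= T -> `|phi t| <= B T) ->
  exists Phi : R -> R,
  [/\ forall t, t <= t0 -> Phi t = 0,
      forall s t T, s <= t -> t <= T -> `|Phi t - Phi s| <= B T * (t - s)
    & {ae mu, forall t : R, t0 < t -> is_derive t 1 Phi (phi t)}].
Proof.
move=> mphi phi0 bphi.
have B0 T : 0 <= B T by apply: le_trans (bphi T T _).
have int y : mu.-integrable [set` Interval (BLeft t0) (BRight y)] (EFin \o phi).
  exact: bounded_integrable_itv (bphi y).
pose Phi t := (\int[mu]_(s in [set` Interval (BLeft t0) (BRight t)]) (phi s))%R.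
have Phi0 t : t <= t0 -> Phi t = 0.
  move=> tt0; rewrite /Phi; have [->|tt0'] := eqVneq t t0.
    by rewrite set_itv1 Rintegral_set1.
  by rewrite set_itv_ge ?Rintegral_set0// bnd_simp -ltNge lt_neqAle tt0'.
exists Phi; split => //.
- move=> s t T.
  wlog t0s : s / t0 <= s => [H|st tT].
    move=> st tT; have [/H|st0] := leP t0 s; first exact.
    have [tt0|t0t] := leP t t0.
      by rewrite !Phi0 ?subrr ?normr0 ?mulr_ge0 ?subr_ge0// ltW.
    rewrite (Phi0 s (ltW st0)) -(Phi0 t0 (lexx _)).
    apply: (le_trans (H t0 _ _ _)) => //; first exact: ltW.
    by rewrite ler_wpM2l// lerD2l lerN2 ltW.
  rewrite /Phi (Rintegral_itvB (int t)) ?bnd_simp//.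
  have ints : mu.-integrable `]s, t] (EFin \o phi).
    by apply: (@bounded_integrable_itv _ s t (B T)) => // u ut; apply: bphi; exact: le_trans ut tT.
  apply: (le_trans (le_normr_Rintegral _ ints)) => //.
  apply: (@le_trans _ _ (\int[mu]_(u in `]s, t]) (B T))).
    apply: le_Rintegral => //.
    + by move: ints => /integrable_norm.
    + apply: (@bounded_integrable_itv (cst (B T)) s t (B T)) => //.
      by move=> u _ /=; rewrite ger0_norm.
    + by move=> u /=; rewrite in_itv/= => /andP[_ ut]; apply: bphi; exact: le_trans ut tT.
  rewrite Rintegral_cst//.
  have -> : fine (mu `]s, t]%classic) = t - s; last by [].
  rewrite lebesgue_measure_itv/= lte_fin; case: ltP => //= ts.
  by have -> : s = t; [apply/eqP; rewrite eq_le st | rewrite subrr].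
- have locint : locally_integrable [set: R] phi.
    split => //; first exact: openT.
    move=> K _ cK; have /compact_bounded [M [_ HM]] := cK.
    have mK := compact_measurable cK.
    have : mu.-integrable K (EFin \o phi).
      apply: measurable_bounded_integrable => //.
      - exact: compact_finite_measure.
      - exact: measurable_funS mphi.
      - exists (B (M + 1)); split; first exact: num_real.
        move=> N BN t Kt; apply: le_trans (ltW BN); apply: bphi.
        by apply: le_trans (ler_norm _) _; apply: (HM (M + 1)) => //; rewrite ltrDl.
    by move=> /integrableP[_].
  have := FTC1 int locint.
  apply: filterS; first exact: (ae_filter_ringOfSetsType mu).
  move=> t /= H t0t.
  have [|dF eF] := H _; first by rewrite lte_fin.
  by apply: DeriveDef; [exact: dF|rewrite -derive1E eF].
Qed.

End Primitive.

(** * Measurable disturbances *)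

Section Measurability.
Context {R : realType}.
Local Notation mu := (@lebesgue_measure R).

Lemma negligible_bigcup_countable (J : countType) (Z : J -> set R) :
  (forall i, mu.-negligible (Z i)) -> mu.-negligible (\bigcup_i Z i).
Proof.
move=> NZ; pose W n := if unpickle n is Some i then Z i else set0.
have sub : \bigcup_i Z i `<=` \bigcup_n W n.
  by move=> x [i _ xi]; exists (pickle i); [exact: I|rewrite /W pickleK].
apply: (@negligibleS _ (measurableTypeR R) _ mu _ _ sub).
by apply: negligible_bigcup => n; rewrite /W; case: unpickle => [i|]; [exact: NZ|exists set0; split => //; exact: measure0].
Qed.

(** Caratheodory measurable sets are Borel sets up to null sets. Rational levels suffice to generate
    all the sets where h < x, so only countably many null sets have to be removed. *)
Lemma lebesgue_measurable_borel (h : R -> R) : lebesgue_measurable_Rplus h ->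
  exists Z : set R, [/\ measurable Z, mu Z = 0%E &
    measurable_fun (`[0%R, +oo[ `\` Z) h].
Proof.
move=> mh.
have mI : ((wlength (@idfun R))^*%mu).-cara.-measurable `[0%R, +oo[%classic.
  by apply: sub_caratheodory.
have lvl (q : rat) : exists XZ : set R * set R,
    [/\ measurable XZ.1, measurable XZ.2, mu XZ.2 = 0%E,
      XZ.1 `<=` `[0, +oo[ `&` h @^-1` `]-oo, ratr q[ &
      `[0, +oo[ `&` h @^-1` `]-oo, ratr q[ `<=` XZ.1 `|` XZ.2].
  have := mh mI `]-oo, ratr q[%classic (measurable_itv _).
  rewrite -completed_caratheodory_measurable g_sigma_completed_algebra_genE.
  move=> [X mX [N [Z [mZ Z0 NZ]] XN]].
  exists (X, Z); split => //=.
  - by rewrite -XN => x; left.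
  - by rewrite -XN => x [|/NZ]; [left|right].
have /choice [XZ HXZ] := lvl.
pose Z := \bigcup_q (XZ q).2.
have mZ : measurable Z by apply: bigcupT_measurable_rat => q; have [] := HXZ q.
have Z0 : mu Z = 0%E.
  apply/negligibleP => //.
  by apply: negligible_bigcup_countable => q; have [? ? ? ? ?] := HXZ q; exact/negligibleP.
exists Z; split => //.
apply: (measurability (@RGenInftyO.G R)); first exact: RGenInftyO.measurableE.
move=> _ [_ [x ->] <-].
have -> : (`[0%R, +oo[ `\` Z) `&` h @^-1` `]-oo, x[ =
    \bigcup_(q : rat) (if ratr q <= x then (XZ q).1 `\` Z else set0).
  apply/seteqP; split => [t [[t0 Zt] /=]|t [q _]].
    rewrite in_itv/= => htx.
    have [q] := rat_in_itvoo htx; rewrite in_itv/= => /andP[hq qx].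
    exists q => //; rewrite (ltW qx); split=> //.
    have [_ _ _ _ /(_ t)] := HXZ q; case => //; last by move=> h2; exfalso; apply: Zt; exists q.
  case: ifPn => // qx [Xt Zt]; have [_ _ _ /(_ t Xt)[t0 hq] _] := HXZ q.
  move: t0 hq; rewrite /= !in_itv/= => t0 hq.
  by split; [split|exact: lt_le_trans hq qx].
apply: bigcupT_measurable_rat => q; case: ifPn => // _.
by apply: measurableD => //; have [] := HXZ q.
Qed.

Lemma MD_borel l (D : set 'rV[R]_l) d : MD D d ->
  exists Z : set R, [/\ measurable Z, mu Z = 0%E &
    forall j, measurable_fun (`[0%R, +oo[ `\` Z) (fun t => d t ord0 j)].
Proof.
move=> [_ md _].
have /choice [Z HZ] := fun j => lebesgue_measurable_borel (md j).
have mZ : measurable (\bigcup_j Z j).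
  by apply: countable_bigcupT_measurable => [|j]; [exact: countableP|have [] := HZ j].
exists (\bigcup_j Z j); split => //.
- apply/negligibleP => //; apply: negligible_bigcup_countable => j.
  by have [? ? _] := HZ j; exact/negligibleP.
- move=> j; have [mZj _ mj] := HZ j.
  apply: measurable_funS mj; first by apply: measurableD.
  by apply: setDS => x Zx; exists j.
Qed.

(** The index of the dyadic cube of side 2^-k that contains [v]. *)
Let code l (k : nat) (v : 'rV[R]_l) : {ffun 'I_l -> int} :=
  [ffun j => Num.floor (2 ^+ k * v ord0 j)].

Let code_close l k (v w : 'rV[R]_l) : code k v = code k w -> `|v - w| <= (2 ^+ k)^-1.
Proof.
move=> /ffunP vw; have k0 : 0 < 2 ^+ k :> R by rewrite exprn_gt0.
rewrite [leLHS]/Num.Def.normr/= mx_normrE.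
rewrite (bigmax_le _)//= => -[i j] _.
rewrite /= ord1 !mxE -(ler_pM2l k0) divff ?gt_eqF//.
rewrite -[X in X * _](gtr0_norm k0) -normrM mulrBr.
have := vw j; rewrite !ffunE => e.
have := floor_itv (2 ^+ k * v ord0 j).
have := floor_itv (2 ^+ k * w ord0 j).
rewrite -e !intrD; set c := (_%:~R); rewrite ler_norml.
move=> /andP[? ?] /andP[? ?]; apply/andP; split; lra.
Qed.

(* Caratheodory composition: [d] is approximated by functions with countably
   many values, all of them in [D], where [phi] is controlled. *)
Lemma measurable_fun_caratheodory l (D : set 'rV[R]_l) (d : R -> 'rV[R]_l)
    (phi : R -> 'rV[R]_l -> R) (E : set R) : measurable E ->
  E `<=` `[0, +oo[ ->
  (forall t, 0 <= t -> D (d t)) ->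
  (forall j, measurable_fun E (fun t => d t ord0 j)) ->
  (forall w, D w -> {within `[0, +oo[, continuous (phi^~ w)}) ->
  (forall t w, 0 <= t -> D w -> forall e, 0 < e -> exists2 eta, 0 < eta &
     forall w', D w' -> `|w' - w| < eta -> `|phi t w' - phi t w| < e) ->
  measurable_fun E (fun t => phi t (d t)).
Proof.
move=> mE E0 Dd md c1 c2.
(* A point of [D] in the cube of code [c] if there is one. The default [d 0] also lies in [D], so
   the approximations never leave the set on which [phi] is controlled. *)
pose rep k c := if pselect (exists2 w, D w & code k w = c) is left h
  then sval (cid2 h) else d 0.
have Drep k c : D (rep k c).
  by rewrite /rep; case: pselect => [h|_]; [case: cid2|exact: Dd].
have code_rep k w : D w -> code k (rep k (code k w)) = code k w.
  move=> Dw; rewrite /rep; case: pselect => [h|]; first by case: cid2.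
  by move=> h; exfalso; apply: h; exists w.
pose phik k t := phi t (rep k (code k (d t))).
apply: (@measurable_fun_cvg _ _ _ _ phik) => [k|t Et].
- move=> _ Y mY.
  (* On the piece of each of the countably many codes the approximation is a function [phi^~ w] with
     [w] fixed, continuous in time. *)
  have -> : E `&` phik k @^-1` Y = \bigcup_(c : {ffun 'I_l -> int})
     ((E `&` \bigcap_(j : 'I_l) (E `&` (fun t => d t ord0 j) @^-1`
         [set y | Num.floor (2 ^+ k * y) = c j]))
       `&` (E `&` (phi^~ (rep k c)) @^-1` Y)).
    apply/seteqP; split => [t [Et Yt]|t [c _] [[Et ct] [_ /= Yt]]].
      exists (code k (d t)) => //; split; last by split.
      by split=> // j _; split => //=; rewrite ffunE.
    split => //=; rewrite /phik.
    suff -> : code k (d t) = c by [].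
    by apply/ffunP => j; rewrite ffunE; have [] := ct j I.
  apply: countable_bigcupT_measurable => [|c].
    by apply: countableP.
  apply: measurableI; last first.
    apply: (_ : measurable_fun E (phi^~ (rep k c))) => //.
    have mc : measurable_fun (`[0%R, +oo[%classic : set R) (phi^~ (rep k c)).
      by apply: subspace_continuous_measurable_fun => //; apply: c1.
    exact: measurable_funS mc.
  apply: measurableI => //.
  rewrite -[X in measurable X]setCK setC_bigcap; apply: measurableC.
  apply: countable_bigcupT_measurable => [|j]; first exact: countableP.
  apply: measurableC; apply: (md j) => //.
  have -> : [set y : R | Num.floor (2 ^+ k * y) = c j] =
      `[(c j)%:~R / 2 ^+ k, ((c j) + 1)%:~R / 2 ^+ k[%classic.
    apply/seteqP; split => y /=; rewrite in_itv/=.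
      move=> <-; have := floor_itv (2 ^+ k * y).
      by rewrite ler_pdivrMr ?exprn_gt0// ltr_pdivlMr ?exprn_gt0// mulrC.
    rewrite ler_pdivrMr ?exprn_gt0// ltr_pdivlMr ?exprn_gt0// mulrC => h.
    exact: floor_def.
  exact: measurable_itv.
- have t0 : 0 <= t by have := E0 _ Et; rewrite /= in_itv/= andbT.
  apply/cvgrPdist_lt => e e0.
  have [eta eta0 Heta] := c2 t _ t0 (Dd _ t0) e e0.
  have : ((2 ^+ k)^-1 : R) @[k --> \oo] --> 0.
    rewrite (_ : (fun k => _) = (fun k => 2^-1 ^+ k)); last first.
      by apply/funext => k; rewrite exprVn.
    by apply: cvg_expr; rewrite ger0_norm ?invr_ge0// invf_lt1// ltr1n.
  move/cvgrPdist_lt => /(_ _ eta0); apply: filterS => k /=.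
  rewrite sub0r normrN ger0_norm ?invr_ge0 ?exprn_ge0// => h.
  rewrite distrC; apply: Heta; first exact: Drep.
  by apply: le_lt_trans h; apply: code_close; apply: code_rep; exact: Dd.
Qed.

End Measurability.

(** * Comparison of absolutely continuous curves *)

Section Comparison.
Context {R : realType}.
Local Notation mu := (@lebesgue_measure R).

Lemma scalar_ac_lipschitz (a b B : R) (f : R -> R) :
  (forall s t, a <= s -> s <= t -> t <= b -> `|f t - f s| <= B * (t - s)) ->
  scalar_ac a b f.
Proof.
move=> lip e e0; exists (e / (`|B| + 1)); first by rewrite divr_gt0// ltr_wpDl.
move=> N s t H _ lt; have B1 : 0 < `|B| + 1 by rewrite ltr_wpDl.
apply: (@le_lt_trans _ _ (\sum_(i < N) (`|B| + 1) * (t i - s i))).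
  apply: ler_sum => i _; have [h1 [h2 h3]] := H i.
  apply: (le_trans (lip _ _ h1 h2 h3)); rewrite ler_wpM2r ?subr_ge0//.
  by apply: (le_trans (ler_norm B)); rewrite lerDl.
by rewrite -mulr_sumr mulrC -ltr_pdivlMr.
Qed.

Lemma scalar_acB (a b : R) (f g : R -> R) :
  scalar_ac a b f -> scalar_ac a b g -> scalar_ac a b (f \- g).
Proof.
move=> acf acg e e0; have e2 : 0 < e / 2 by rewrite divr_gt0.
have [d1 d10 H1] := acf _ e2; have [d2 d20 H2] := acg _ e2.
exists (Num.min d1 d2) => [|N s t H1' H2']; first by rewrite lt_min d10.
rewrite lt_min => /andP[l1 l2].
apply: (@le_lt_trans _ _ (\sum_(i < N) `|f (t i) - f (s i)| + \sum_(i < N) `|g (t i) - g (s i)|)).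
  rewrite -big_split; apply: ler_sum => i _ /=.
  rewrite [X in `|X|](_ : _ = (f (t i) - f (s i)) - (g (t i) - g (s i))); last by ring.
  exact: ler_normB.
by rewrite [e]splitr ltrD// ?H1 ?H2.
Qed.

Lemma scalar_ac_coord m (a b : R) (x : R -> 'rV[R]_m) j :
  absolutely_continuous a b x -> scalar_ac a b (fun t => x t ord0 j).
Proof.
move=> acx e e0; have [d d0 Hd] := acx e e0; exists d => // N s t H1 H2 H3.
apply: le_lt_trans (Hd N s t H1 H2 H3); apply: ler_sum => i _.
by have := coord_le_enorm (x (t i) - x (s i)) j; rewrite !mxE.
Qed.

Lemma ac_lipschitz m (a b B : R) (x : R -> 'rV[R]_m) :
  (forall s t, a <= s -> s <= t -> t <= b -> enorm (x t - x s) <= B * (t - s)) ->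
  absolutely_continuous a b x.
Proof.
move=> lip e e0; exists (e / (`|B| + 1)); first by rewrite divr_gt0// ltr_wpDl.
move=> N s t H _ lt; have B1 : 0 < `|B| + 1 by rewrite ltr_wpDl.
apply: (@le_lt_trans _ _ (\sum_(i < N) (`|B| + 1) * (t i - s i))).
  apply: ler_sum => i _; have [h1 [h2 h3]] := H i.
  apply: (le_trans (lip _ _ h1 h2 h3)); rewrite ler_wpM2r ?subr_ge0//.
  by apply: (le_trans (ler_norm B)); rewrite lerDl.
by rewrite -mulr_sumr mulrC -ltr_pdivlMr.
Qed.

Lemma acB m (a b : R) (x y : R -> 'rV[R]_m) :
  absolutely_continuous a b x -> absolutely_continuous a b y ->
  absolutely_continuous a b (x \- y).
Proof.
move=> acf acg e e0; have e2 : 0 < e / 2 by rewrite divr_gt0.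
have [d1 d10 H1] := acf _ e2; have [d2 d20 H2] := acg _ e2.
exists (Num.min d1 d2) => [|N s t H1' H2']; first by rewrite lt_min d10.
rewrite lt_min => /andP[l1 l2].
apply: (@le_lt_trans _ _ (\sum_(i < N) enorm (x (t i) - x (s i)) + \sum_(i < N) enorm (y (t i) - y (s i)))).
  rewrite -big_split; apply: ler_sum => i _ /=.
  have -> : x (t i) - y (t i) - (x (s i) - y (s i)) = (x (t i) - x (s i)) - (y (t i) - y (s i)).
    by apply/rowP => j; rewrite !mxE; ring.
  exact: ler_enormB.
by rewrite [e]splitr ltrD// ?H1 ?H2.
Qed.

Lemma ac_sub m (a b a' b' : R) (x : R -> 'rV[R]_m) : a <= a' -> b' <= b ->
  absolutely_continuous a b x -> absolutely_continuous a' b' x.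
Proof.
move=> aa bb acx e e0; have [d d0 Hd] := acx e e0; exists d => // N s t H.
by apply: Hd => i; have [? [? ?]] := H i; split; [|split] => //; lra.
Qed.

Lemma is_derive_coord m (x : R -> 'rV[R]_m) (t : R) (v : 'rV[R]_m) j :
  is_derive t 1 x v -> is_derive t 1 (fun u => x u ord0 j) (v ord0 j).
Proof.
move=> [dx <-]; have := derive_mx dx => ->; rewrite mxE.
by apply: DeriveDef => //; exact: (derivable_mxP x t 1).1 dx ord0 j.
Qed.

Lemma is_derive_rowP m (x : R -> 'rV[R]_m) (t : R) (v : 'rV[R]_m) :
  (forall j, is_derive t 1 (fun u => x u ord0 j) (v ord0 j)) -> is_derive t 1 x v.
Proof.
move=> H; have dx : derivable x t 1.
  by apply/derivable_mxP => i j; rewrite ord1; have [] := H j.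
apply: DeriveDef => //; rewrite derive_mx//; apply/rowP => j; rewrite mxE.
by have [] := H j.
Qed.

Lemma ac_compare (a b : R) (f c : R -> R) : a <= b ->
  scalar_ac a b f -> scalar_ac a b c ->
  {ae mu, forall t : R, a < t < b -> exists l l' : R,
     [/\ l <= l', is_derive t 1 f l & is_derive t 1 c l']} ->
  f b - f a <= c b - c a.
Proof.
move=> ab acf acc H.
suff : (f \- c) b <= (f \- c) a by rewrite /=; lra.
apply: ac_nonincreasing => //; first exact: scalar_acB.
move: H; apply: filterS; first exact: (ae_filter_ringOfSetsType mu).
move=> t /= H atb; have [l [l' [ll' dl dl']]] := H atb.
by exists (l - l'); [rewrite subr_le0|exact: is_deriveB].
Qed.

(** The comparison is made coordinate by coordinate and from both sides. The resulting factor [m] is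
    compensated later in the length of a step or in the weight of the Picard iteration. *)
Lemma ac_compare_enorm m (a b : R) (x : R -> 'rV[R]_m) (c c' : R -> R) : a <= b ->
  absolutely_continuous a b x -> scalar_ac a b c ->
  (forall t : R, a < t < b -> is_derive t 1 c (c' t)) ->
  {ae mu, forall t : R, a < t < b -> exists2 v : 'rV[R]_m,
     is_derive t 1 x v & enorm v <= c' t} ->
  enorm (x b - x a) <= m%:R * (c b - c a).
Proof.
move=> ab acx acc dc H; apply: enorm_le_bound => j; rewrite !mxE ler_norml.
have acj := scalar_ac_coord j acx.
have acn : scalar_ac a b (fun t => - c t).
  move=> e e0; have [d d0 Hd] := acc e e0; exists d => // N s t H1 H2 H3.
  rewrite (eq_bigr (fun i => `|c (t i) - c (s i)|)) ?Hd// => i _.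
  by rewrite -opprD normrN.
apply/andP; split.
- suff : - c b - - c a <= x b ord0 j - x a ord0 j by lra.
  apply: (ac_compare (f := fun t => - c t) (c := fun t => x t ord0 j)) => //.
  move: H; apply: filterS; first exact: (ae_filter_ringOfSetsType mu).
  move=> t /= H atb; have [v dv vc] := H atb.
  exists (- c' t), (v ord0 j); split.
  + by have := ler_norm (- v ord0 j); rewrite normrN; have := coord_le_enorm v j; lra.
  + by apply: is_deriveN; exact: dc.
  + exact: is_derive_coord.
- apply: (ac_compare (f := fun t => x t ord0 j)) => //.
  move: H; apply: filterS; first exact: (ae_filter_ringOfSetsType mu).
  move=> t /= H atb; have [v dv vc] := H atb.
  exists (v ord0 j), (c' t); split.
  + by apply: le_trans vc; apply: (le_trans _ (coord_le_enorm v j)); exact: ler_norm.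
  + exact: is_derive_coord.
  + exact: dc.
Qed.

Lemma ac_bounded_speed m (a b B : R) (x : R -> 'rV[R]_m) : a <= b ->
  absolutely_continuous a b x ->
  {ae mu, forall t : R, a < t < b -> exists2 v : 'rV[R]_m,
     is_derive t 1 x v & enorm v <= B} ->
  enorm (x b - x a) <= m%:R * B * (b - a).
Proof.
move=> ab acx H; rewrite -mulrA.
have -> : B * (b - a) = (B * b) - (B * a) by ring.
apply: (ac_compare_enorm (c := fun t => B * t) (c' := cst B)) => //.
- apply: (@scalar_ac_lipschitz _ _ `|B|) => s t _ st _.
  by rewrite -mulrBr normrM (ger0_norm (_ : 0 <= t - s)) ?subr_ge0.
- move=> t _ /=; have := is_deriveZ (B : R) (is_derive_id t (1 : R)).
  by rewrite [B *: _]mulr1.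
Qed.

Lemma bounded_enorm_within m (a b : R) (x : R -> 'rV[R]_m) (A : set R) : a <= b ->
  {within A, continuous x} -> `[a, b] `<=` A ->
  exists M, forall t, a <= t <= b -> enorm (x t) <= M.
Proof.
move=> ab /within_continuous_enormP cx abA.
have r0 : 0 <= b - a by rewrite subr_ge0.
have [|M HM] := @C0_bounded _ (b - a) _ (hist b x) r0.
  apply: (@C0_hist _ _ _ _ _ A); first exact/within_continuous_enormP.
  by rewrite subKr.
exists M => t tab; have := HM (t - b); rewrite /hist subrKC; apply.
by apply/andP; lra.
Qed.

End Comparison.

(** * Retarded equations: uniqueness *)

Section HistoryContinuity.
Context {R : realType}.

(** Heine's theorem with [v] free to leave [a, b], since comparing the histories at two times leads
    outside the interval. The proof is a continuous induction on the right end point. *)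
Lemma heine_enorm m (x : R -> 'rV[R]_m) (a b e : R) : a <= b ->
  continuous x -> 0 < e ->
  exists2 d, 0 < d & forall u v, a <= u <= b -> `|v - u| < d -> enorm (x v - x u) <= e.
Proof.
move=> ab cx e0.
have cx' s : exists2 eta, 0 < eta & forall v, `|v - s| < eta -> enorm (x v - x s) < e / 2.
  have /within_continuous_enormP := @continuous_withinT R _ setT x cx.
  move=> /(_ s I (e / 2)); rewrite divr_gt0// => /(_ isT)[eta eta0 H].
  by exists eta => // v; exact: H.
pose S := [set c | a <= c <= b /\ exists2 d, 0 < d &
  forall u v, a <= u <= c -> `|v - u| < d -> enorm (x v - x u) <= e].
have extend s c eta : S c -> (forall v, `|v - s| < eta -> enorm (x v - x s) < e / 2) ->
    0 < eta -> s - eta / 2 < c -> forall c', c' <= b -> a <= c' -> c' <= s + eta / 2 -> S c'.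
  move=> [_ [d d0 Hd]] Heta eta0 sc c' c'b ac' c's; split; first by rewrite ac'.
  exists (Num.min d (eta / 2)); first by rewrite lt_min d0 divr_gt0.
  move=> u v /andP[au uc']; rewrite lt_min => /andP[vud vue].
  have [uc|cu] := leP u c; first by apply: Hd => //; rewrite au.
  have us : `|u - s| < eta by rewrite ltr_distl; lra.
  have vs : `|v - s| < eta by move: vue; rewrite !ltr_distl; lra.
  have -> : x v - x u = (x v - x s) - (x u - x s) by rewrite opprB addrA subrK.
  apply: (le_trans (ler_enormB _ _)).
  by have := Heta _ us; have := Heta _ vs; lra.
have Sa : S a.
  split; first by rewrite lexx.
  have [eta eta0 Heta] := cx' a; exists eta => // u v /le_anti <- vu.
  by have := Heta _ vu; lra.
have supS : has_sup S by split; [exists a | exists b => c [/andP[]]].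
have asg : a <= sup S by apply: ub_le_sup => //; exact: supS.2.
have sgb : sup S <= b by apply: ge_sup; [exists a | move=> c [/andP[]]].
have [eta eta0 Heta] := cx' (sup S).
have [c Sc cs] : exists2 c, S c & sup S - eta / 2 < c.
  by apply: sup_adherent => //; rewrite divr_gt0.
have ext := extend _ _ _ Sc Heta eta0 cs.
have [bs|sb] := leP b (sup S + eta / 2); first by have [] := ext b (lexx _) ab bs.
have : sup S + eta / 2 <= sup S.
  by apply: ub_le_sup; [exact: supS.2 | apply: ext => //; lra].
lra.
Qed.

Lemma hist_cvg r m (x : R -> 'rV[R]_m) (t e : R) : 0 <= r -> continuous x -> 0 < e ->
  exists2 d, 0 < d & forall t', `|t' - t| < d -> snorm r (hist t' x \- hist t x) < e.
Proof.
move=> r0 cx e0; have [||d d0 Hd] := @heine_enorm _ x (t - r) t (e / 2) _ cx; [lra|lra|].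
exists d => // t' tt'; apply: (@le_lt_trans _ _ (e / 2)); last lra.
apply: snorm_le => // s sr /=; rewrite /hist; apply: Hd; first lra.
by rewrite [X in `|X|](_ : _ = t' - t)//; ring.
Qed.

End HistoryContinuity.

Section Uniqueness.
Context {R : realType} (r : R) {l m : nat} (D : set 'rV[R]_l)
  (F : R -> 'rV[R]_l -> (R -> 'rV[R]_m) -> 'rV[R]_m).
Local Notation mu := (@lebesgue_measure R).

Definition rhs_continuous := forall t w x, 0 <= t -> D w -> C0 r x ->
  forall e, 0 < e -> exists2 delta : R, 0 < delta & forall t' w' x',
    0 <= t' -> D w' -> C0 r x' -> `|t' - t| < delta -> `|w' - w| < delta ->
    snorm r (x' \- x) < delta -> enorm (F t' w' x' - F t w x) < e.

Definition rhs_locally_lipschitz := forall T M, exists2 L, 0 <= L &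
  forall t w x y, 0 <= t <= T -> D w -> C0 r x -> C0 r y ->
    snorm r x <= M -> snorm r y <= M ->
    enorm (F t w x - F t w y) <= L * snorm r (x \- y).

(** Histories are functions on the whole line of which only the values on [-r, 0] matter; continuity
    for [snorm] makes [F] blind to the others. This allows a history to be exchanged with its
    truncation. *)
Lemma rhs_ext t w x y : 0 <= r -> rhs_continuous -> 0 <= t -> D w -> C0 r x -> C0 r y ->
  (forall s, - r <= s <= 0 -> x s = y s) -> F t w x = F t w y.
Proof.
move=> r0 cF t0 Dw cx cy xy; apply/eqP; rewrite -subr_eq0; apply/eqP.
apply: enorm_eq0; apply/ler_addgt0Pr => e e0; rewrite add0r ltW//.
have [d d0 Hd] := cF t w y t0 Dw cy e e0.
apply: Hd => //; rewrite ?subrr ?normr0//.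
apply: le_lt_trans d0; apply: snorm_le => // s sr /=.
by rewrite xy// subrr enorm0.
Qed.

Lemma solution_hist_C0 t0 x0 d T x t : is_solution r F t0 x0 d T x ->
  t0 <= t -> (t%:E < T)%E -> C0 r (hist t x).
Proof.
move=> [_ _ cx _ _] t0t tT; apply: C0_hist cx _ => s /=; rewrite in_itv/= => /andP[s1 s2].
split; first lra.
by apply: le_lt_trans tT; rewrite lee_fin.
Qed.

(** On a stretch of length [eta] after a time up to which the solutions agree, the maximum K of
    their distance satisfies K <= K / 2. The length [eta] is the same at every step, so finitely
    many steps reach [b]. *)
Lemma solution_unique t0 x0 d T T' x x' : 0 < r -> rhs_locally_lipschitz -> 0 <= t0 ->
  (forall t, 0 <= t -> D (d t)) ->
  is_solution r F t0 x0 d T x -> is_solution r F t0 x0 d T' x' ->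
  forall t : R, t0 - r <= t -> (t%:E < T)%E -> (t%:E < T')%E -> x' t = x t.
Proof.
move=> r0 lipF t00 Dd solx solx' b.
have [h1 hx cx acx dx] := solx; have [h1' hx' cx' acx' dx'] := solx'.
have [bt0|t0b] := leP b t0.
  move=> h _ _; have h2 : - r <= b - t0 <= 0 by lra.
  by have := hx _ h2; have := hx' _ h2; rewrite subrKC => -> ->.
move=> t0rb bT bT'.
have sub U : (b%:E < U)%E ->
    `[t0 - r, b] `<=` [set t | t0 - r <= t /\ (t%:E < U)%E].
  move=> bU s; rewrite /= in_itv/= => /andP[-> sb]; split=> //.
  by apply: le_lt_trans bU; rewrite lee_fin.
have [M HM] := bounded_enorm_within t0rb cx (sub _ bT).
have [M' HM'] := bounded_enorm_within t0rb cx' (sub _ bT').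
have [L L0 HL] := lipF b (Num.max M M').
pose w := x' \- x.
have acw : absolutely_continuous t0 b w by apply: acB; [exact: acx'|exact: acx].
have hb (y : R -> 'rV[R]_m) (N : R) : (forall t : R, t0 - r <= t <= b -> enorm (y t) <= N) ->
    forall t : R, t0 <= t <= b -> snorm r (hist t y) <= N.
  by move=> H t tb; apply: snorm_le (ltW r0) _ => s sr; apply: H; lra.
have ltU U (t : R) : t <= b -> (b%:E < U)%E -> (t%:E < U)%E.
  by move=> tb; apply: le_lt_trans; rewrite lee_fin.
have w0 (t : R) : t0 - r <= t <= t0 -> w t = 0.
  move=> tt; have h2 : - r <= t - t0 <= 0 by lra.
  by have := hx _ h2; have := hx' _ h2; rewrite subrKC /w /= => -> ->; rewrite subrr.
(* The factor [m] of [ac_bounded_speed] and the Lipschitz constant [L], each increased by 1 against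
   vanishing, and 2 for the halving. *)
pose eta := (2 * (L + 1) * m.+1%:R)^-1.
have eta0 : 0 < eta by rewrite invr_gt0 !mulr_gt0// ltr_wpDl.
have step (s : R) : t0 <= s <= b -> (forall u : R, t0 - r <= u <= s -> w u = 0) ->
   forall u : R, t0 - r <= u <= Num.min b (s + eta) -> w u = 0.
  move=> sb ws; set s' := Num.min _ _.
  have ss' : s <= s' by rewrite /s' le_min; apply/andP; split; lra.
  have s'b : s' <= b by rewrite /s' ge_min lexx.
  have s's : s' - s <= eta by rewrite /s' lerBlDl ge_min lexx orbT.
  have : {within `[s, s'], continuous (fun u => enorm (w u))}.
    apply/within_continuousP => t; rewrite /= in_itv/= => tss' e e0.
    have cw : {within `[t0 - r, b], continuous w}.
      move=> u; apply: cvgB.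
        exact: (continuous_subspaceW (sub _ bT') cx').
      exact: (continuous_subspaceW (sub _ bT) cx).
    have /within_continuous_enormP/(_ t) := cw.
    rewrite /= in_itv/= => /(_ _ e e0)[|d' d0 Hd]; first lra.
    exists d' => // u; rewrite !in_itv/= => uss' ut.
    apply: (@le_lt_trans _ _ (enorm (w u - w t))); last first.
      by apply: Hd => //; rewrite in_itv/=; lra.
    exact: ler_dist_enorm.
  move=> /(EVT_max ss')[c cI Hc].
  pose K := enorm (w c).
  have K0 : 0 <= K by exact: enorm_ge0.
  have wK (u : R) : t0 - r <= u <= s' -> enorm (w u) <= K.
    move=> us'; have [us|su] := leP u s; first by rewrite ws ?enorm0//; lra.
    by apply: Hc; rewrite in_itv/=; lra.
  move: (cI); rewrite in_itv/= => /andP[sc cs'].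
  have : enorm (w c - w s) <= m%:R * (L * K) * (c - s).
    apply: ac_bounded_speed => //; first by apply: ac_sub acw; [case/andP: sb | exact: le_trans cs' s'b].
    have : {ae mu, forall t, (t0 <= t -> (t%:E < T)%E -> is_derive t 1 x (F t (d t) (hist t x))) /\
       (t0 <= t -> (t%:E < T')%E -> is_derive t 1 x' (F t (d t) (hist t x')))}.
      apply: (@filterI _ _ _ _ _ dx dx'); exact: (ae_filter_ringOfSetsType mu).
    apply: filterS; first exact: (ae_filter_ringOfSetsType mu).
    move=> t /= [dxt dxt'] tsc.
    have t0t : t0 <= t by lra.
    have tb : t <= b by lra.
    have tT := ltU _ _ tb bT; have tT' := ltU _ _ tb bT'.
    exists (F t (d t) (hist t x') - F t (d t) (hist t x)).
      by apply: is_deriveB; [exact: dxt'|exact: dxt].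
    apply: (le_trans (HL _ _ _ _ _ _ _ _ _ _)).
    + by apply/andP; lra.
    + by apply: Dd; lra.
    + exact: solution_hist_C0 solx' t0t tT'.
    + exact: solution_hist_C0 solx t0t tT.
    + apply: hb => [u ub|]; last lra.
      by rewrite le_max (HM' _ ub) orbT.
    + apply: hb => [u ub|]; last lra.
      by rewrite le_max (HM _ ub).
    + rewrite ler_wpM2l//; apply: snorm_le (ltW r0) _ => u ur.
      by apply: (wK (t + u)); lra.
  rewrite (ws s) ?subr0; last lra.
  rewrite -/K => hK.
  have : K <= K / 2.
    apply: (le_trans hK).
    apply: (@le_trans _ _ (m%:R * (L * K) * eta)).
      by rewrite ler_wpM2l ?mulr_ge0//; lra.
    rewrite /eta.
    have -> : m%:R * (L * K) / (2 * (L + 1) * m.+1%:R) =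
       K / 2 * ((L / (L + 1)) * (m%:R / m.+1%:R)).
      have L1 : L + 1 != 0 by rewrite gt_eqF// ltr_wpDl.
      have : m.+1%:R != 0 :> R by rewrite pnatr_eq0.
      by move: (m.+1%:R : R) => p p0; field; rewrite p0 L1.
    rewrite ler_piMr ?divr_ge0// mulr_ile1 ?divr_ge0 ?addr_ge0//.
      by rewrite ler_pdivrMr ?mul1r ?lerDl// ltr_wpDl.
    by rewrite ler_pdivrMr ?mul1r ?ler_nat.
  move=> K2 u us'; apply: enorm_eq0; apply: (le_trans (wK _ us')); lra.
have iter (k : nat) : forall u : R, t0 - r <= u <= Num.min b (t0 + k%:R * eta) -> w u = 0.
  elim: k => [|k IH] u.
    by rewrite mul0r addr0 le_min => /and3P[? ? ?]; apply: w0; lra.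
  move=> /andP[u1]; rewrite le_min => /andP[ub u2].
  pose s := Num.min b (t0 + k%:R * eta).
  apply: (step s _ IH).
    rewrite /s le_min ge_min lexx (ltW t0b)/=.
    by rewrite lerDl mulr_ge0// ltW.
  rewrite u1 le_min ub/= /s addr_minl le_min.
  rewrite (_ : t0 + _ + eta = t0 + k.+1%:R * eta) ?u2 ?andbT; first lra.
  by rewrite -natr1; ring.
have [k kb] : exists k : nat, b - t0 <= k%:R * eta.
  exists (Num.truncn ((b - t0) / eta)).+1.
  by rewrite -ler_pdivrMr// ltW// truncnS_gt.
apply/subr0_eq; apply: (iter k b).
by rewrite t0rb le_min lexx/= -lerBlDl.
Qed.

End Uniqueness.

(** * Retarded equations: existence *)

Section GeometricLimit.
Context {R : realType}.

Lemma le_geometric (a b c : R) : (forall k : nat, a <= b + c / 2 ^+ k) -> a <= b.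
Proof.
move=> H; apply/ler_addgt0Pr => e e0.
pose k := (Num.truncn (`|c| / e)).+1.
apply: (le_trans (H k)); rewrite lerD2l ler_pdivrMr ?exprn_gt0//.
apply: (le_trans (ler_norm c)); rewrite mulrC -ler_pdivrMr//.
apply: (le_trans (ltW (truncnS_gt _))).
by rewrite -natrX ler_nat ltnW// ltn_expl.
Qed.

(* The interval [[u k - 2 A / 2^k, u k + 2 A / 2^k]] shrinks with [k]. *)
Lemma geometric_limit (u : nat -> R) :
  (exists A, forall k, `|u k.+1 - u k| <= A / 2 ^+ k) ->
  exists l, forall A, (forall k, `|u k.+1 - u k| <= A / 2 ^+ k) ->
    forall k, `|l - u k| <= 2 * A / 2 ^+ k.
Proof.
move=> [A1 HA1].
have p2 (k : nat) : 0 < 2 ^+ k :> R by rewrite exprn_gt0.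
pose S := [set 2 ^+ k * `|u k.+1 - u k| | k in [set: nat]].
have bS A : (forall k, `|u k.+1 - u k| <= A / 2 ^+ k) -> ubound S A.
  by move=> HA _ [k _ <-]; rewrite mulrC -ler_pdivlMr.
have nS : S !=set0 by exists (2 ^+ 0 * `|u 1%N - u 0%N|); exists 0%N.
(* The least admissible constant: intervals built with it give a limit chosen before [A], as the
   order of the quantifiers demands. *)
pose A0 := sup S.
have HA0 k : `|u k.+1 - u k| <= A0 / 2 ^+ k.
  rewrite ler_pdivlMr// mulrC; apply: ub_le_sup; last by exists k.
  by exists A1; exact: bS.
have halve (k : nat) : A0 / 2 ^+ k = 2 * A0 / 2 ^+ k.+1.
  by rewrite exprS; field; rewrite gt_eqF// exprn_gt0.
have two (k : nat) : 2 * A0 / 2 ^+ k = A0 / 2 ^+ k + A0 / 2 ^+ k by field; rewrite gt_eqF.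
have lo k : u k - 2 * A0 / 2 ^+ k <= u k.+1 - 2 * A0 / 2 ^+ k.+1.
  have := HA0 k; rewrite -halve two ler_norml => /andP[h _]; lra.
have hi k : u k.+1 + 2 * A0 / 2 ^+ k.+1 <= u k + 2 * A0 / 2 ^+ k.
  have := HA0 k; rewrite -halve two ler_norml => /andP[_ h]; lra.
have A00 : 0 <= A0 by have := HA0 0%N; rewrite expr0 divr1; apply: le_trans.
have loD k p : u k - 2 * A0 / 2 ^+ k <= u (k + p)%N - 2 * A0 / 2 ^+ (k + p).
  by elim: p => [|p IH]; rewrite ?addn0// addnS (le_trans IH).
have hiD k p : u (k + p)%N + 2 * A0 / 2 ^+ (k + p) <= u k + 2 * A0 / 2 ^+ k.
  by elim: p => [|p IH]; rewrite ?addn0// addnS (le_trans _ IH).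
have pos (k : nat) : 0 <= 2 * A0 / 2 ^+ k by rewrite !mulr_ge0// invr_ge0 ltW.
have lohi j k : u j - 2 * A0 / 2 ^+ j <= u k + 2 * A0 / 2 ^+ k.
  apply: (le_trans (loD j k)); apply: (le_trans _ (hiD k j)).
  by rewrite (addnC k j); have := pos (j + k)%N; lra.
pose S' := [set u k - 2 * A0 / 2 ^+ k | k in [set: nat]].
have nS' : S' !=set0 by exists (u 0%N - 2 * A0 / 2 ^+ 0); exists 0%N.
exists (sup S') => A HA k.
apply: (@le_trans _ _ (2 * A0 / 2 ^+ k)); last first.
  rewrite ler_pM2r ?invr_gt0// ler_pM2l//; apply: ge_sup => //; exact: bS.
rewrite ler_distl; apply/andP; split.
  apply: ub_le_sup; last by exists k.
  by exists (u 0%N + 2 * A0 / 2 ^+ 0) => _ [j _ <-]; exact: lohi.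
by apply: ge_sup => // _ [j _ <-]; exact: lohi.
Qed.

End GeometricLimit.

Lemma clamp_nonexpansive {R : realType} (a b s t : R) :
  `|Num.min b (Num.max a s) - Num.min b (Num.max a t)| <= `|s - t|.
Proof.
have max1 (u v : R) : `|Num.max a u - Num.max a v| <= `|u - v|.
  have h1 := ler_norm (u - v); have := ler_norm (v - u); rewrite distrC => h2.
  by rewrite ler_norml /Order.max; case: ltP => ?; case: ltP => ?; apply/andP; split; lra.
have min1 (u v : R) : `|Num.min b u - Num.min b v| <= `|u - v|.
  have h1 := ler_norm (u - v); have := ler_norm (v - u); rewrite distrC => h2.
  by rewrite ler_norml /Order.min; case: ltP => ?; case: ltP => ?; apply/andP; split; lra.
exact: le_trans (min1 _ _) (max1 _ _).
Qed.

Section Caratheodory.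
Context {R : realType} (r : R) {l m : nat} (D : set 'rV[R]_l)
  (F : R -> 'rV[R]_l -> (R -> 'rV[R]_m) -> 'rV[R]_m).
Local Notation mu := (@lebesgue_measure R).

Definition rhs_lipschitz := forall T, exists2 L, 0 <= L &
  forall t w x y, 0 <= t <= T -> D w -> C0 r x -> C0 r y ->
    enorm (F t w x - F t w y) <= L * snorm r (x \- y).

Definition rhs_bounded := forall T, exists B,
  forall t w x, 0 <= t <= T -> D w -> C0 r x -> enorm (F t w x) <= B.

Definition constant_extension (t0 : R) (x0 : R -> 'rV[R]_m) (t : R) : 'rV[R]_m :=
  x0 (Num.min 0 (Num.max (- r) (t - t0))).

Lemma constant_extension_continuous t0 x0 : 0 <= r -> C0 r x0 ->
  continuous (constant_extension t0 x0).
Proof.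
move=> r0 /C0_enormP cx.
apply/continuous_subspace_setT/within_continuous_enormP => t _ e e0.
pose cl (s : R) := Num.min 0 (Num.max (- r) (s - t0)).
have clI s : `[- r, 0]%classic (cl s).
  rewrite /= in_itv/= /cl; case: (leP 0 (Num.max (- r) (s - t0))) => h; first by lra.
  by rewrite (ltW h) andbT le_max lexx.
have [d d0 Hd] := cx _ (clI t) e e0; exists d => // s _ st.
apply: Hd; first exact: clI.
apply: le_lt_trans st.
apply: (le_trans (clamp_nonexpansive _ _ _ _)).
by rewrite [X in `|X|](_ : _ = s - t)//; ring.
Qed.

Lemma constant_extension_hist (t0 : R) x0 (th : R) : - r <= th <= 0 ->
  constant_extension t0 x0 (t0 + th) = x0 th.
Proof.
move=> /andP[h1 h2]; rewrite /constant_extension; congr x0.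
by rewrite addrAC subrr add0r max_r// min_r.
Qed.

Lemma constant_extension_after (t0 : R) x0 (t : R) : t0 <= t ->
  constant_extension t0 x0 t = x0 0.
Proof.
move=> h; rewrite /constant_extension; congr x0.
by rewrite min_l// le_max subr_ge0 h orbT.
Qed.

(** Off a null set [Z] the disturbance is Borel; the integrand is set to 0 on [Z], which an
    almost-everywhere conclusion does not notice. Elsewhere it is a Caratheodory function composed
    with [d], because [hist t y] depends continuously on t. *)
Lemma caratheodory_primitive (t0 : R) d (B : R -> R) y : 0 <= r -> rhs_continuous r D F ->
  (forall (T t : R) w x, 0 <= t <= T -> D w -> C0 r x -> enorm (F t w x) <= B T) ->
  0 <= t0 -> MD D d -> continuous y ->
  exists Y : R -> 'rV[R]_m,
  [/\ forall t : R, t <= t0 -> Y t = 0,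
      forall s t T : R, s <= t -> t <= T ->
        enorm (Y t - Y s) <= m%:R * (`|B T| * (t - s))
    & {ae mu, forall t : R, t0 < t -> is_derive t 1 Y (F t (d t) (hist t y))}].
Proof.
move=> r0 cF bF t00 Md cy.
have [Dd _ _] := Md.
have [Z [mZ Z0 md]] := MD_borel Md.
have mE : measurable (`[t0, +oo[ `\` Z : set R) by apply: measurableD.
have E0 : (`[t0, +oo[ `\` Z : set R) `<=` `[0, +oo[.
  by move=> s [] /=; rewrite !in_itv/= !andbT => h _; exact: le_trans h.
have mdE (j : 'I_l) : measurable_fun (`[t0, +oo[ `\` Z) (fun t => d t ord0 j).
  apply: measurable_funS (md j); first by apply: measurableD.
  by apply: setSD => s /=; rewrite !in_itv/= !andbT => h; exact: le_trans h.
have chy t : C0 r (hist t y) by exact: continuous_hist.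
pose ph (j : 'I_m) t w := F t w (hist t y) ord0 j.
pose phi j := (fun t => ph j t (d t)) \_ (`[t0, +oo[ `\` Z).
have mphi j : measurable_fun setT (phi j).
  apply/(measurable_restrictT _ mE).
  apply: (@measurable_fun_caratheodory _ _ D d (ph j)) => //.
  - move=> w Dw; apply/within_continuousP => t /=; rewrite in_itv/= andbT => tp e e0.
    have [d1 d10 Hd1] := cF t w (hist t y) tp Dw (chy t) e e0.
    have [d2 d20 Hd2] := hist_cvg t r0 cy d10.
    exists (Num.min d1 d2); first by rewrite lt_min d10.
    move=> s; rewrite in_itv/= andbT => sp; rewrite lt_min => /andP[s1 s2].
    have := coord_le_enorm (F s w (hist s y) - F t w (hist t y)) j; rewrite !mxE => h.
    apply: (le_lt_trans h); apply: Hd1; [exact: sp|exact: Dw|exact: chy|exact: s1| |exact: Hd2].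
    by rewrite subrr normr0.
  - move=> t w tp Dw e e0.
    have [d1 d10 Hd1] := cF t w (hist t y) tp Dw (chy t) e e0.
    exists d1 => // w' Dw' ww'.
    have := coord_le_enorm (F t w' (hist t y) - F t w (hist t y)) j; rewrite !mxE => h.
    apply: (le_lt_trans h); apply: Hd1; [exact: tp|exact: Dw'|exact: chy| |exact: ww'|].
      by rewrite subrr normr0.
    by apply: le_lt_trans d10; apply: snorm_le => // s _ /=; rewrite subrr enorm0.
have phi0 j t : t < t0 -> phi j t = 0.
  move=> tt0; rewrite /phi patchE ifF//; apply/negbTE; rewrite notin_setE => -[] /=.
  by rewrite in_itv/= andbT leNgt tt0.
have bphi j T t : t <= T -> `|phi j t| <= `|B T|.
  move=> tT; rewrite /phi patchE; case: ifPn => [|_]; last by rewrite normr0.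
  rewrite inE => /E0 /=; rewrite in_itv/= andbT => tp.
  apply: (le_trans (coord_le_enorm _ j)); apply: (le_trans (bF T t _ _ _ _ _)).
  - by rewrite tp.
  - exact: Dd.
  - exact: chy.
  - exact: ler_norm.
have prim j := primitive_exists (mphi j) (phi0 j) (bphi j).
have /choice[Phi HPhi] := prim.
exists (fun t => \row_j Phi j t); split.
- by move=> t tt0; apply/rowP => j; rewrite !mxE; have [-> //] := HPhi j.
- move=> s t T st tT; apply: enorm_le_bound => j; rewrite !mxE.
  by have [_ /(_ s t T st tT) h _] := HPhi j.
- have fmu := ae_filter_ringOfSetsType mu.
  have ae1 : {ae mu, forall t, ~ Z t}.
    by exists Z; split => // t /= /contrapT.
  have ae2 : {ae mu, forall t, forall j, t0 < t -> is_derive t 1 (Phi j) (phi j t)}.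
    by apply: filter_forall => j; have [_ _ h] := HPhi j.
  apply: filterS2 ae1 ae2 => t Zt H t0t.
  apply: is_derive_rowP => j; have := H j t0t.
  have -> : phi j t = F t (d t) (hist t y) ord0 j.
    rewrite /phi patchE ifT// inE; split => //=.
    by rewrite in_itv/= andbT ltW.
  by under [X in _ -> is_derive _ _ X _]eq_fun do rewrite mxE.
Qed.

End Caratheodory.

(** * Picard iteration *)

Section Picard.
Context {R : realType} (r : R) {l m : nat} (D : set 'rV[R]_l)
  (F : R -> 'rV[R]_l -> (R -> 'rV[R]_m) -> 'rV[R]_m).
Local Notation mu := (@lebesgue_measure R).

Lemma continuous_of_lipschitz (Y : R -> 'rV[R]_m) (K : R -> R) :
  (forall s t T : R, s <= t -> t <= T -> enorm (Y t - Y s) <= K T * (t - s)) ->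
  continuous Y.
Proof.
move=> lip; apply/continuous_subspace_setT/within_continuous_enormP => t _ e e0.
have K1 : 0 < `|K (t + 1)| + 1 by rewrite ltr_wpDl.
exists (Num.min 1 (e / (`|K (t + 1)| + 1))); first by rewrite lt_min ltr01 divr_gt0.
move=> s _; rewrite lt_min => /andP[s1 s2].
have st1 : s < t + 1 by move: s1; rewrite ltr_distl => /andP[].
have hK (u v : R) : u <= v -> v <= t + 1 -> enorm (Y v - Y u) <= (`|K (t + 1)| + 1) * (v - u).
  move=> uv vt; apply: (le_trans (lip _ _ _ uv vt)); rewrite ler_wpM2r ?subr_ge0//.
  by apply: (le_trans (ler_norm _)); rewrite lerDl.
apply: (@le_lt_trans _ _ ((`|K (t + 1)| + 1) * `|s - t|)); last first.
  by rewrite mulrC -ltr_pdivlMr.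
have [st|ts] := leP s t.
  rewrite enormB (distrC s) (@ger0_norm _ (t - s)) ?subr_ge0//; apply: hK => //.
  by rewrite lerDl.
by rewrite (@gtr0_norm _ (s - t)) ?subr_gt0//; apply: hK; exact: ltW.
Qed.

Lemma scalar_ac_expR (a b A lam t0 : R) : 0 <= A -> 0 <= lam ->
  scalar_ac a b (fun t => A * expR (lam * (t - t0))).
Proof.
move=> A0 l0; apply: (@scalar_ac_lipschitz _ _ _ (A * expR (lam * (b - t0)) * lam)) => s t _ st tb.
have e1 : expR (lam * (s - t0)) <= expR (lam * (t - t0)).
  by rewrite ler_expR ler_wpM2l// lerD2r.
have e2 : expR (lam * (t - t0)) <= expR (lam * (b - t0)).
  by rewrite ler_expR ler_wpM2l// lerD2r.
rewrite -mulrBr normrM !ger0_norm// ?subr_ge0// -!mulrA ler_wpM2l//.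
apply: (@le_trans _ _ (expR (lam * (t - t0)) * (lam * (t - s)))); last first.
  by rewrite ler_wpM2r// mulr_ge0// subr_ge0.
have := expR_ge1Dx (lam * (s - t0) - lam * (t - t0)).
rewrite expRB ler_pdivlMr ?expR_gt0// => h.
have -> : lam * (t - s) = lam * (t - t0) - lam * (s - t0) by ring.
move: h; set u := lam * (s - t0); set v := lam * (t - t0) => h.
move: h; move: (expR u) (expR v) => eu ev h; nra.
Qed.

Lemma is_derive_scaled_expR (A lam t0 t : R) :
  is_derive t 1 (fun t : R => A * expR (lam * (t - t0))) (A * (lam * expR (lam * (t - t0)))).
Proof.
have h1 : is_derive t 1 (fun t : R => lam * (t - t0)) lam.
  have := is_deriveZ lam (is_deriveB (is_derive_id t (1:R)) (is_derive_cst t0 t (1:R))).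
  by rewrite subr0 [lam *: _]mulr1.
have h2 : is_derive t 1 (fun s : R => expR (lam * (s - t0))) (expR (lam * (t - t0)) * lam).
  exact: (is_derive1_comp (f := expR) (g := fun s => lam * (s - t0)) (is_derive_expR _) h1).
rewrite [X in is_derive _ _ _ (A * X)]mulrC; exact: (is_deriveZ A h2).
Qed.

(** The unknown is the deviation from the constant extension of [x0], so that all iterates share the
    initial history. Measured with the weight exp(lam (t - t0)), the distance of successive iterates
    is halved at each step on all of [t0, T] at once, so that no continuation over short intervals
    is needed. *)
Lemma caratheodory_solution t0 x0 d : 0 < r -> rhs_continuous r D F ->
  rhs_lipschitz r D F -> rhs_bounded r D F ->
  0 <= t0 -> C0 r x0 -> MD D d ->
  exists X : R -> 'rV[R]_m,
  [/\ continuous X,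
      forall th : R, - r <= th <= 0 -> X (t0 + th) = x0 th,
      forall T : R, exists K, forall s t : R, t0 <= s -> s <= t -> t <= T ->
        enorm (X t - X s) <= K * (t - s)
    & {ae mu, forall t : R, t0 < t -> is_derive t 1 X (F t (d t) (hist t X))}].
Proof.
move=> r_gt0 cF lipF bF t00 cx0 Md; have r0 := ltW r_gt0.
have [Dd _ _] := Md.
have fmu := ae_filter_ringOfSetsType mu.
have /choice[B HB] := bF.
have /choice[L HL] : forall T, exists L : R, 0 <= L /\ forall t w x y, 0 <= t <= T -> D w ->
    C0 r x -> C0 r y -> enorm (F t w x - F t w y) <= L * snorm r (x \- y).
  by move=> T; have [L L0 H] := lipF T; exists L.
pose ext := constant_extension r t0 x0.
have cext : continuous ext by exact: constant_extension_continuous.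
pose isprim (y Y : R -> 'rV[R]_m) := [/\ forall t : R, t <= t0 -> Y t = 0,
      forall s t T : R, s <= t -> t <= T ->
        enorm (Y t - Y s) <= m%:R * (`|B T| * (t - s))
    & {ae mu, forall t : R, t0 < t -> is_derive t 1 Y (F t (d t) (hist t y))}].
(* A default value for discontinuous [y] makes [N] a total map; all the iterates are continuous. *)
have /choice[N HN] : forall y, exists Y, continuous y -> isprim y Y.
  move=> y; have [cy|ncy] := pselect (continuous y); last by exists (fun=> 0).
  by have [Y HY] := caratheodory_primitive r0 cF HB t00 Md cy; exists Y.
have lipc (Y : R -> 'rV[R]_m) : (forall s t T : R, s <= t -> t <= T ->
        enorm (Y t - Y s) <= m%:R * (`|B T| * (t - s))) -> continuous (ext \+ Y).
  move=> H; have cY : continuous Y.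
    apply: (@continuous_of_lipschitz _ (fun T => m%:R * `|B T|)) => s t T st tT.
    by rewrite -mulrA; exact: H.
  by move=> t; apply: cvgD; [exact: cext|exact: cY].
pose Y k := iter k (fun y => N (ext \+ y)) (fun=> 0).
have lipY k (s t T : R) : s <= t -> t <= T ->
    enorm (Y k t - Y k s) <= m%:R * (`|B T| * (t - s)).
  elim: k s t T => [|k IH] s t T st tT.
    by rewrite /= subrr enorm0 mulr_ge0// mulr_ge0// subr_ge0.
  by have [_ H _] := HN _ (lipc _ IH); exact: H.
have cY k : continuous (ext \+ Y k) by apply: lipc => s t T; exact: lipY.
have primY k : isprim (ext \+ Y k) (Y k.+1) by exact: HN (cY k).
have Y0 k (t : R) : t <= t0 -> Y k t = 0.
  by case: k => [//|k]; have [H _ _] := primY k; exact: H.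
have acY k (b : R) : absolutely_continuous t0 b (Y k).
  apply: (@ac_lipschitz _ _ _ _ (m%:R * `|B b|)) => s t _ st tb.
  by rewrite -mulrA; exact: lipY.
(* Integrating L A exp(lam (s - t0)) in each of [m] coordinates yields the factor m L / lam, at most
   1/2; the summand 1 keeps [lam] positive. *)
pose lam T := 2 * m%:R * L T + 1.
pose C T := m%:R * (`|B T| * (T - t0)).
have L0 T : 0 <= L T by have [] := HL T.
have lam0 T : 0 < lam T by rewrite ltr_wpDl// !mulr_ge0.
have pw (k : nat) : 0 < 2 ^+ k :> R by rewrite exprn_gt0.
have histB y z t : hist t (ext \+ y) \- hist t (ext \+ z) = hist t (y \- z) :> (R -> 'rV[R]_m).
  by apply/funext => s; rewrite /hist /= opprD addrACA subrr add0r.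
(* two primitives differ by at most the integral of [L] times the distance of their integrands *)
have cmp (T A la : R) (y z Py Pz : R -> 'rV[R]_m) : t0 <= T -> 0 <= A -> 0 < la ->
    isprim (ext \+ y) Py -> isprim (ext \+ z) Pz ->
    continuous (ext \+ y) -> continuous (ext \+ z) ->
    (forall t : R, t <= t0 -> y t = z t) ->
    (forall t : R, t0 <= t <= T -> enorm (y t - z t) <= A * expR (la * (t - t0))) ->
    forall t : R, t0 <= t <= T ->
      enorm (Py t - Pz t) <= m%:R * (L T * A / la * expR (la * (t - t0))).
  move=> t0T A0 la0 [Py0 Pyl Pyd] [Pz0 Pzl Pzd] cy cz yz0 yz t /andP[t0t tT].
  have acP (P : R -> 'rV[R]_m) : (forall s t T : R, s <= t -> t <= T ->
        enorm (P t - P s) <= m%:R * (`|B T| * (t - s))) -> absolutely_continuous t0 t P.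
    move=> H; apply: (@ac_lipschitz _ _ _ _ (m%:R * `|B t|)) => u v _ uv vt.
    by rewrite -mulrA; exact: H.
  have A1 : 0 <= L T * A / la by rewrite divr_ge0 ?mulr_ge0// ltW.
  have h0 : (Py \- Pz) t0 = 0 by rewrite /= Py0// Pz0// subrr.
  have -> : Py t - Pz t = (Py \- Pz) t - (Py \- Pz) t0 by rewrite h0 subr0.
  apply: (@le_trans _ _ (m%:R * (L T * A / la * expR (la * (t - t0)) - L T * A / la * expR (la * (t0 - t0))))).
    apply: (@ac_compare_enorm _ _ _ _ (Py \- Pz) (fun t => L T * A / la * expR (la * (t - t0))) (fun t => L T * A / la * (la * expR (la * (t - t0))))) => //.
    - by apply: acB; apply: acP.
    - by apply: scalar_ac_expR => //; exact: ltW.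
    - by move=> s _; exact: is_derive_scaled_expR.
    - apply: filterS2 Pyd Pzd => s Hy Hz /andP[t0s st].
      exists (F s (d s) (hist s (ext \+ y)) - F s (d s) (hist s (ext \+ z))).
        by apply: is_deriveB; [exact: Hy|exact: Hz].
      have s0 : 0 <= s <= T by apply/andP; split; lra.
      have [_ lipT] := HL T.
      apply: (le_trans (lipT _ _ _ _ s0 _ _ _)).
      + by apply: Dd; case/andP: s0.
      + exact: continuous_hist.
      + exact: continuous_hist.
      + rewrite histB.
        have -> : L T * A / la * (la * expR (la * (s - t0))) = L T * (A * expR (la * (s - t0))).
          by field; rewrite gt_eqF.
        rewrite ler_wpM2l//; apply: snorm_le => // u /andP[_ u0]; rewrite /hist /=.
        have [sut0|t0su] := leP (s + u) t0.
          by rewrite yz0// subrr enorm0 mulr_ge0// expR_ge0.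
        apply: (le_trans (yz _ _)); first by apply/andP; split; lra.
        rewrite ler_wpM2l// ler_expR ler_wpM2l ?(ltW la0)//; lra.
  by rewrite ler_wpM2l// gerBl mulr_ge0// expR_ge0.
have est (T : R) k (t : R) : t0 <= t <= T ->
    enorm (Y k.+1 t - Y k t) <= C T / 2 ^+ k * expR (lam T * (t - t0)).
  elim: k t => [|k IH] t tT.
    have [_ H _] := primY 0%N; move: (tT) => /andP[t0t tT'].
    rewrite expr0 divr1 subr0 -[X in enorm X]subr0 -[X in _ - X](Y0 1%N t0)//.
    apply: (le_trans (H _ _ _ t0t tT')).
    have CT : m%:R * (`|B T| * (t - t0)) <= C T.
      by rewrite /C ler_wpM2l// ler_wpM2l// lerD2r.
    apply: (le_trans CT); rewrite ler_peMr//.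
      by rewrite /C !mulr_ge0// subr_ge0; exact: le_trans tT'.
    by rewrite -expR0 ler_expR mulr_ge0 ?(ltW (lam0 T))// subr_ge0.
  have t0T : t0 <= T by case/andP: tT => h1 h2; exact: le_trans h2.
  have C1 : 0 <= C T / 2 ^+ k.
    by rewrite divr_ge0// ?(ltW (pw k))// /C !mulr_ge0// subr_ge0.
  apply: (le_trans (cmp _ _ _ _ _ _ _ t0T C1 (lam0 T) (primY k.+1) (primY k) (cY _) (cY _) _ IH _ tT)).
    by move=> s st0; rewrite !Y0.
  rewrite mulrA ler_wpM2r ?expR_ge0// exprS.
  have -> : C T / (2 * 2 ^+ k) = C T / 2 ^+ k * 2^-1 by field; rewrite gt_eqF.
  have -> : m%:R * (L T * (C T / 2 ^+ k) / lam T) = C T / 2 ^+ k * (m%:R * L T / lam T).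
    by field; rewrite !gt_eqF.
  rewrite ler_wpM2l// ler_pdivrMr//.
  by rewrite /lam mulrDr mulrA mulrA mulVf ?pnatr_eq0// mul1r mulr1 lerDl.
pose A T := C T * expR (lam T * (T - t0)).
have bnd (T t : R) k : t0 <= T -> t <= T -> forall j, `|Y k.+1 t ord0 j - Y k t ord0 j| <= A T / 2 ^+ k.
  move=> t0T tT j; have C1 : 0 <= C T by rewrite /C !mulr_ge0// subr_ge0.
  have := coord_le_enorm (Y k.+1 t - Y k t) j; rewrite !mxE => /le_trans; apply.
  have [tt0|t0t] := leP t t0.
    by rewrite !Y0// subrr enorm0 divr_ge0// ?(ltW (pw k))// mulr_ge0// expR_ge0.
  apply: (le_trans (est T _ _ _)); first by rewrite (ltW t0t).
  rewrite /A mulrAC ler_wpM2r ?invr_ge0 ?(ltW (pw k))// ler_wpM2l// ler_expR.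
  by rewrite ler_wpM2l ?(ltW (lam0 T))// lerD2r.
(* The limit at [t] must not depend on the horizon: the geometric estimate holds with a different
   [A T] for each T, and one limit has to serve them all. *)
have lim (t : R) (j : 'I_m) : exists y, forall A, (forall k, `|Y k.+1 t ord0 j - Y k t ord0 j| <= A / 2 ^+ k) ->
    forall k, `|y - Y k t ord0 j| <= 2 * A / 2 ^+ k.
  apply: (geometric_limit (u := fun k => Y k t ord0 j)).
  exists (A (Num.max t0 t)) => k; apply: bnd; first by rewrite le_max lexx.
  by rewrite le_max lexx orbT.
pose Yj (t : R) j := projT1 (cid (lim t j)).
pose YY (t : R) : 'rV[R]_m := \row_j Yj t j.
have YYE (T t : R) k : t0 <= T -> t <= T -> enorm (YY t - Y k t) <= m%:R * (2 * A T / 2 ^+ k).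
  move=> t0T tT; apply: enorm_le_bound => j; rewrite !mxE /Yj; case: cid => y /= Hy.
  by apply: Hy => i; exact: bnd.
have YY0 (t : R) : t <= t0 -> YY t = 0.
  move=> tt0; apply: enorm_eq0.
  apply: (@le_geometric _ _ _ (m%:R * (2 * A t0))) => k; rewrite add0r -mulrA.
  by have := YYE t0 t k (lexx _) tt0; rewrite Y0// subr0.
have lipYY (s t T : R) : s <= t -> t <= T -> enorm (YY t - YY s) <= m%:R * (`|B T| * (t - s)).
  move=> st tT; apply: (@le_geometric _ _ _ (2 * (m%:R * (2 * A (Num.max t0 T))))) => k.
  have t0M : t0 <= Num.max t0 T by rewrite le_max lexx.
  have TM : T <= Num.max t0 T by rewrite le_max lexx orbT.
  have h1 := YYE _ t k t0M (le_trans tT TM).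
  have h2 := YYE _ s k t0M (le_trans (le_trans st tT) TM).
  have h3 := lipY k s t T st tT.
  have -> : YY t - YY s = (YY t - Y k t) + (Y k t - Y k s) - (YY s - Y k s).
    by apply/rowP => j; rewrite !mxE; ring.
  apply: (le_trans (ler_enormB _ _)).
  have h4 := ler_enormD (YY t - Y k t) (Y k t - Y k s).
  have -> : 2 * (m%:R * (2 * A (Num.max t0 T))) / 2 ^+ k =
     m%:R * (2 * A (Num.max t0 T) / 2 ^+ k) + m%:R * (2 * A (Num.max t0 T) / 2 ^+ k).
    by field; rewrite gt_eqF.
  lra.
have cYY : continuous (ext \+ YY) by exact: lipc.
(* The limit is a fixed point: its image [Z] under one more step is within a geometric error of
   [Y k.+1], and so is the limit itself. *)
have primYY := HN _ cYY; set Z := N _ in primYY.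
have ZYY : Z = YY.
  apply/funext => t; have [tt0|t0t] := leP t t0.
    by have [H _ _] := primYY; rewrite H// YY0.
  apply/eqP; rewrite -subr_eq0; apply/eqP/enorm_eq0.
  pose q := m%:R * (L t * (m%:R * (2 * A t)) * expR (t - t0)).
  apply: (@le_geometric _ _ _ (q + m%:R * (2 * A t))) => k; rewrite add0r.
  have t0t' := ltW t0t.
  have A0 : 0 <= m%:R * (2 * A t / 2 ^+ k).
    rewrite mulr_ge0// divr_ge0 ?(ltW (pw k))// mulr_ge0// mulr_ge0 ?expR_ge0//.
    by rewrite /C !mulr_ge0// subr_ge0.
  have h1 := YYE t t k.+1 t0t' (lexx _).
  have h2 : enorm (Z t - Y k.+1 t) <= m%:R * (L t * (m%:R * (2 * A t / 2 ^+ k)) / 1 * expR (1 * (t - t0))).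
    apply: (cmp t _ 1 YY (Y k) _ _ t0t' A0 ltr01 primYY (primY k) cYY (cY k)).
    - by move=> s st0; rewrite YY0// Y0.
    - move=> s /andP[t0s st]; apply: (le_trans (YYE t s k t0t' st)).
      by rewrite ler_peMr// -[leLHS]expR0 ler_expR mul1r subr_ge0.
    - by rewrite t0t' lexx.
  have -> : Z t - YY t = (Z t - Y k.+1 t) - (YY t - Y k.+1 t).
    by apply/rowP => j; rewrite !mxE; ring.
  apply: (le_trans (ler_enormB _ _)).
  rewrite mulrDl lerD//.
    apply: (le_trans h2); rewrite /q divr1 mul1r le_eqVlt; apply/orP; left; apply/eqP.
    by field; rewrite gt_eqF.
  apply: (le_trans h1); rewrite -[leRHS]mulrA ler_wpM2l//.
  have A2 : 0 <= 2 * A t by rewrite mulr_ge0// mulr_ge0 ?expR_ge0// /C !mulr_ge0// subr_ge0.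
  rewrite ler_wpM2l// lef_pV2 ?posrE//.
  by rewrite exprS ler_peMl ?(ltW (pw k))// ler1n.
exists (ext \+ YY); split => //.
- move=> th thr; rewrite /= YY0; last by case/andP: thr; lra.
  by rewrite addr0; exact: constant_extension_hist.
- move=> T; exists (m%:R * `|B T|) => s t t0s st tT.
  rewrite /= /ext !constant_extension_after//; last exact: le_trans st.
  rewrite opprD addrACA subrr add0r -mulrA; exact: lipYY.
- have [_ _] := primYY; apply: filterS => t H t0t; have := H t0t; rewrite ZYY => dYY.
  have dext : is_derive t 1 ext 0.
    apply: (near_eq_is_derive (f := cst (x0 0))).
    apply/nbhs_ballP; exists (t - t0) => /= [|s]; first by rewrite subr_gt0.
    rewrite /ball/= ltr_distl => /andP[_ ts].
    by rewrite /ext constant_extension_after//; lra.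
  by rewrite -[X in is_derive _ _ _ X]add0r; apply: is_deriveD.
Qed.

End Picard.

(** * Truncation and global existence *)

Section Truncation.
Context {R : realType}.

(** Truncation by coordinates rather than radially, so that nonexpansiveness reduces to that of the
    scalar clamp. *)
Definition clampv {m} (M : R) (v : 'rV[R]_m) : 'rV[R]_m :=
  \row_j Num.min M (Num.max (- M) (v ord0 j)).

Lemma enorm_mono m (x y : 'rV[R]_m) :
  (forall j, `|x ord0 j| <= `|y ord0 j|) -> enorm x <= enorm y.
Proof.
move=> H; rewrite -(@ler_pXn2r _ 2)// ?nnegrE ?enorm_ge0// !enorm_sqr.
apply: ler_sum => j _; rewrite -(real_normK (num_real (x _ _))) -(real_normK (num_real (y _ _))).
by rewrite ler_pXn2r// nnegrE.
Qed.

Lemma clampv_nonexpansive m (M : R) (u v : 'rV[R]_m) :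
  enorm (clampv M u - clampv M v) <= enorm (u - v).
Proof. by apply: enorm_mono => j; rewrite !mxE; exact: clamp_nonexpansive. Qed.

Lemma clampv_bounded m (M : R) (v : 'rV[R]_m) : 0 <= M -> enorm (clampv M v) <= m%:R * M.
Proof.
move=> M0; apply: enorm_le_bound => j; rewrite mxE ler_norml.
by rewrite ge_min lexx le_min le_max lexx/= andbT; lra.
Qed.

Lemma clampv_id m (M : R) (v : 'rV[R]_m) : enorm v <= M -> clampv M v = v.
Proof.
move=> vM; apply/rowP => j; rewrite mxE.
have := le_trans (coord_le_enorm v j) vM; rewrite ler_norml => /andP[h1 h2].
by rewrite max_r// min_r.
Qed.

End Truncation.

Section GlobalSolution.
Context {R : realType} (r : R) {l m : nat} (D : set 'rV[R]_l)
  (F : R -> 'rV[R]_l -> (R -> 'rV[R]_m) -> 'rV[R]_m).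
Local Notation mu := (@lebesgue_measure R).

Definition rhs_locally_bounded := forall T M, exists B,
  forall t w x, 0 <= t <= T -> D w -> C0 r x -> snorm r x <= M -> enorm (F t w x) <= B.

Lemma C0_clampv M (x : R -> 'rV[R]_m) : C0 r x -> C0 r (clampv M \o x).
Proof. by apply: C0_comp => u v; exact: clampv_nonexpansive. Qed.

Lemma snorm_clampv M (x y : R -> 'rV[R]_m) : 0 <= r -> C0 r x -> C0 r y ->
  snorm r ((clampv M \o x) \- (clampv M \o y)) <= snorm r (x \- y).
Proof.
move=> r0 cx cy; apply: snorm_le => // s sr; apply: (le_trans (clampv_nonexpansive _ _ _)).
exact: (enorm_le_snorm r0 (C0B cx cy) sr).
Qed.

Lemma snorm_clampv_bound M (x : R -> 'rV[R]_m) : 0 <= r -> 0 <= M ->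
  snorm r (clampv M \o x) <= m%:R * M.
Proof. by move=> r0 M0; apply: snorm_le => // s sr; exact: clampv_bounded. Qed.

(** Truncated histories lie in a fixed ball, where the local bounds are uniform: the new right-hand
    side is bounded and globally Lipschitz in the history. *)
Lemma truncated_solution M t0 x0 d : 0 < r -> 0 <= M -> rhs_continuous r D F ->
  rhs_locally_lipschitz r D F -> rhs_locally_bounded ->
  0 <= t0 -> C0 r x0 -> MD D d ->
  exists X : R -> 'rV[R]_m,
  [/\ continuous X,
      forall th : R, - r <= th <= 0 -> X (t0 + th) = x0 th,
      forall T : R, exists K, forall s t : R, t0 <= s -> s <= t -> t <= T ->
        enorm (X t - X s) <= K * (t - s)
    & {ae mu, forall t : R, t0 < t ->
        is_derive t 1 X (F t (d t) (clampv M \o hist t X))}].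
Proof.
move=> r_gt0 M0 cF lipF bF t00 cx0 Md; have r0 := ltW r_gt0.
apply: (@caratheodory_solution _ r _ _ D (fun t w x => F t w (clampv M \o x))) => //.
- move=> t w x tp Dw cx e e0.
  have [de d0 Hd] := cF t w _ tp Dw (C0_clampv (M := M) cx) e e0.
  exists de => // t' w' x' tp' Dw' cx' h1 h2 h3.
  apply: Hd; [exact: tp'|exact: Dw'|exact: C0_clampv|exact: h1|exact: h2|].
  exact: le_lt_trans (snorm_clampv _ r0 cx' cx) h3.
- move=> T; have [L L0 HL] := lipF T (m%:R * M); exists L => // t w x y tT Dw cx cy.
  have := HL t w _ _ tT Dw (C0_clampv (M := M) cx) (C0_clampv (M := M) cy) (snorm_clampv_bound _ r0 M0) (snorm_clampv_bound _ r0 M0).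
  by move=> /le_trans; apply; rewrite ler_wpM2l// snorm_clampv.
- move=> T; have [B HB] := bF T (m%:R * M); exists B => t w x tT Dw cx.
  exact: (HB t w _ tT Dw (C0_clampv (M := M) cx) (snorm_clampv_bound _ r0 M0)).
Qed.

(* The solution of the system truncated above the bound of the solutions of
   the original system never reaches the truncation level. *)
Lemma global_solution t0 x0 d M : 0 < r -> rhs_continuous r D F ->
  rhs_locally_lipschitz r D F -> rhs_locally_bounded ->
  0 <= t0 -> C0 r x0 -> MD D d ->
  (forall T x, is_solution r F t0 x0 d T x ->
     forall t : R, t0 <= t -> (t%:E < T)%E -> enorm (x t) <= M) ->
  exists X, is_maximal_solution r F t0 x0 d +oo%E X.
Proof.
move=> r_gt0 cF lipF bF t00 cx0 Md apriori; have r0 := ltW r_gt0.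
have [Dd _ _] := Md.
have fmu := ae_filter_ringOfSetsType mu.
(* [M1] bounds both the initial history and the a priori estimate. The truncation level [Mc] lies 1
   above it, and this margin excludes a first crossing. *)
pose M1 : R := Num.max `|M| (snorm r x0).
have M10 : 0 <= M1 by rewrite le_max normr_ge0.
pose Mc : R := M1 + 1.
have Mc0 : 0 <= Mc by rewrite addr_ge0.
have [X [cX X0 lipX dX]] := truncated_solution r_gt0 Mc0 cF lipF bF t00 cx0 Md.
have Xinit (t : R) : t0 - r <= t <= t0 -> enorm (X t) <= M1.
  move=> tt; have h : - r <= t - t0 <= 0 by lra.
  have := X0 _ h; rewrite subrKC => ->.
  by rewrite le_max (enorm_le_snorm r0 cx0 h) orbT.
have sol (T : \bar R) : (t0%:E < T)%E ->
    (forall t : R, t0 <= t -> (t%:E < T)%E -> enorm (X t) <= Mc) ->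
    is_solution r F t0 x0 d T X.
  move=> t0T XM; split => //.
  - exact: continuous_withinT.
  - move=> b t0b bT; have [K HK] := lipX b.
    by apply: (@ac_lipschitz _ _ _ _ K) => s t t0s st tb; exact: HK.
  (* The equation is known for t > t0 only, whereas a solution includes the time [t0], which is
     discarded as a null set. *)
  - have ae0 : {ae mu, forall t, t <> t0}.
      exists [set t0]; split => //; first exact: lebesgue_measure_set1.
      by move=> t /= /contrapT.
    apply: filterS2 ae0 dX => t tt0 H t0t tT.
    have -> : F t (d t) (hist t X) = F t (d t) (clampv Mc \o hist t X).
      apply: (rhs_ext r0 cF (le_trans t00 t0t) (Dd _ (le_trans t00 t0t))).
      + exact: continuous_hist.
      + by apply: C0_clampv; exact: continuous_hist.
      + move=> s /andP[s1 s2]; rewrite /= clampv_id// /hist.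
        have [ts|st] := leP t0 (t + s).
          by apply: XM => //; apply: le_lt_trans tT; rewrite lee_fin; lra.
        by apply: (le_trans (Xinit _ _)); [lra|rewrite /Mc; lra].
    by apply: H; rewrite lt_neqAle t0t andbT eq_sym; apply/eqP.
have XMc (t : R) : t0 <= t -> enorm (X t) <= Mc.
  (* [inf E] is the first crossing. Before it the truncated equation is the original one, so |X| <=
     M1; by continuity |X| stays below [Mc] shortly after it as well, although [E] has points
     arbitrarily close to its infimum. *)
  pose E := [set t : R | t0 <= t /\ Mc < enorm (X t)].
  move=> t0t; rewrite leNgt; apply/negP => hX.
  have nE : E !=set0 by exists t; split.
  have lE : lbound E t0 by move=> s [].
  have hE : has_inf E by split => //; exists t0.
  have t0i : t0 <= inf E by apply: lb_le_inf.
  have XltT (s : R) : t0 <= s -> s < inf E -> enorm (X s) <= M1.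
    move=> t0s sE; have t0E : (t0%:E < (inf E)%:E)%E by rewrite lte_fin (le_lt_trans t0s).
    have := apriori _ _ (sol _ t0E _) s t0s; rewrite lte_fin => /(_ _ sE) h.
    apply: (le_trans (h _)); last by rewrite le_max ler_norm.
    move=> u t0u; rewrite lte_fin => uE; rewrite leNgt; apply/negP => uM.
    have : inf E <= u by apply: ge_inf; [exists t0|split].
    by rewrite leNgt uE.
  have /within_continuous_enormP/(_ (inf E) I (1/4)) := @continuous_withinT R _ [set: R] X cX.
  have q4 : (0 : R) < 1 / 4 by rewrite divr_gt0.
  move=> /(_ q4)[de de0 Hde].
  have Xi : enorm (X (inf E)) <= M1 + 1 / 4.
    have [ti|it] := leP (inf E) t0.
      by apply: (le_trans (Xinit _ _)); [apply/andP; split; lra|lra].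
    pose s : R := Num.max t0 (inf E - de / 2).
    have s1 : t0 <= s by rewrite le_max lexx.
    have s2 : s < inf E by rewrite gt_max it; lra.
    have s3 : inf E - de / 2 <= s by rewrite le_max lexx orbT.
    have := Hde s I; rewrite ltr_distl => /(_ _)h.
    have h1 := XltT _ s1 s2.
    have h2 : enorm (X s - X (inf E)) < 1 / 4 by apply: h; apply/andP; split; lra.
    have := ler_dist_enorm (X s) (X (inf E)); rewrite ler_norml => /andP[? ?]; lra.
  have [s [t0s sM] sE] : exists2 s, E s & s < inf E + de.
    by apply: inf_adherent.
  have iE : inf E <= s by apply: ge_inf; [exists t0|split].
  have h2 : enorm (X s - X (inf E)) < 1 / 4.
    by apply: Hde => //; rewrite ger0_norm ?subr_ge0//; lra.
  have := ler_dist_enorm (X s) (X (inf E)); rewrite ler_norml /Mc in sM * => /andP[? ?]; lra.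
have solX : is_solution r F t0 x0 d +oo%E X.
  by apply: sol; [rewrite ltry|move=> t t0t _; exact: XMc].
exists X; split => // T' x' solx'; split; first exact: leey.
move=> t tr tT'; apply: (solution_unique r_gt0 lipF t00 Dd solX solx') => //.
by rewrite ltry.
Qed.

End GlobalSolution.

(** * Smooth functions of prescribed growth *)

Section Entire.
Context {R : realType}.

(** A smooth function [h 0] carried along with all its derivatives [h k], so that composition with
    it can be differentiated without leaving the class [nice]. *)
Definition derivative_tower (h : nat -> R -> R) :=
  forall k (x : R), is_derive x 1 (h k) (h k.+1 x).

(** An infinite radius of convergence, stated as a bound on terms instead of convergence because
    this form passes easily to the differentiated series. *)
Definition entire_coef (c : nat -> R) :=
  forall s : R, exists m0, forall m, (m0 <= m)%N -> `|c m| * s ^+ m <= 1.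

(** The condition at 2 |x| makes the terms at x at most 2^-m from some index on; the constant [A]
    absorbs the finitely many terms before. *)
Lemma entire_coef_cvg c (x : R) : entire_coef c -> cvgn (pseries c x).
Proof.
move=> ec; have [m0 Hm0] := ec (2 * `|x|).
have bound m : (m0 <= m)%N -> `|c m| * `|x| ^+ m <= 2^-1 ^+ m.
  move=> /Hm0; rewrite exprMn mulrCA mulrC -ler_pdivlMr ?exprn_gt0//.
  by rewrite div1r exprVn.
pose A := 1 + \sum_(i < m0) (`|c i| * `|x| ^+ i * 2 ^+ i).
have S0 : 0 <= \sum_(i < m0) (`|c i| * `|x| ^+ i * 2 ^+ i) :> R.
  by apply: sumr_ge0 => i _; rewrite !mulr_ge0// exprn_ge0.
apply: normed_cvg.
apply: (@series_le_cvg _ _ (fun m => A * 2^-1 ^+ m)).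
- by move=> m; exact: normr_ge0.
- by move=> m; rewrite mulr_ge0// ?exprn_ge0// /A addr_ge0.
- move=> m /=; rewrite normrM normrX.
  have [m0m|mm0] := leqP m0 m.
    apply: (le_trans (bound _ m0m)); rewrite ler_peMl ?exprn_ge0// /A lerDl//.
  rewrite exprVn ler_pdivlMr ?exprn_gt0// /A.
  rewrite (bigD1 (Ordinal mm0))//= addrCA lerDl addr_ge0// sumr_ge0//.
- apply: is_cvg_geometric_series; rewrite ger0_norm// invf_lt1// ltr1n//.
Qed.

(** The factor m + 1 produced by differentiation is below 2^(m+1), which the condition at twice the
    radius absorbs. *)
Lemma entire_coef_diffs c : entire_coef c -> entire_coef (pseries_diffs c).
Proof.
move=> ec s; pose s1 := Num.max 1 `|s|.
have s11 : 1 <= s1 by rewrite le_max lexx.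
have s10 : 0 <= s1 by exact: le_trans s11.
have ss1 : `|s| <= s1 by rewrite le_max lexx orbT.
have [m0 Hm0] := ec (2 * s1); exists m0 => m m0m.
apply: le_trans (Hm0 m.+1 (leq_trans m0m (leqnSn _))).
rewrite /pseries_diffs normrM normr_nat exprMn -mulrA mulrCA ler_wpM2l//.
apply: (@le_trans _ _ (m.+1%:R * s1 ^+ m)).
  rewrite ler_wpM2l//; apply: (le_trans (ler_norm _)); rewrite normrX.
  by rewrite lerXn2r ?nnegrE.
apply: ler_pM => //; first by rewrite exprn_ge0.
- by rewrite -natrX ler_nat ltnW// ltn_expl.
- by rewrite ler_weXn2l.
Qed.

Lemma entire_derivative_tower c : entire_coef c ->
  derivative_tower (fun k x => limn (pseries (iter k (@pseries_diffs R) c) x)).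
Proof.
move=> ec k x.
have ek j : entire_coef (iter j (@pseries_diffs R) c).
  by elim: j => //= j IH; exact: entire_coef_diffs.
apply: (@pseries_snd_diffs _ _ (`|x| + 1)).
- exact: entire_coef_cvg (ek k).
- exact: entire_coef_cvg (ek k.+1).
- exact: entire_coef_cvg (ek k.+2).
- by rewrite [ltRHS]ger0_norm ?addr_ge0// ltrDl.
Qed.

Lemma pseries_nondecreasing c (s t : R) : entire_coef c -> (forall m, 0 <= c m) ->
  0 <= s -> s <= t -> limn (pseries c s) <= limn (pseries c t).
Proof.
move=> ec c0 s0 st; apply: lim_series_le; [exact: entire_coef_cvg|exact: entire_coef_cvg|].
move=> m /=; rewrite ler_wpM2l// lerXn2r ?nnegrE//; exact: le_trans st.
Qed.

Lemma pseries_ge_term c (s : R) m : entire_coef c -> (forall m, 0 <= c m) ->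
  0 <= s -> c m * s ^+ m <= limn (pseries c s).
Proof.
move=> ec c0 s0.
apply: (@le_trans _ _ (pseries c s m.+1)).
  rewrite /pseries /series /= big_nat_recr//= lerDr sumr_ge0// => i _.
  by rewrite mulr_ge0// exprn_ge0.
apply: nondecreasing_cvgn_le; last exact: entire_coef_cvg.
by apply: nondecreasing_series => i _ _; rewrite mulr_ge0// exprn_ge0.
Qed.

Lemma expr_unbounded (b M : R) : 1 < b -> exists q : nat, M <= b ^+ q.
Proof.
move=> b1; have x0 : 0 < b - 1 by rewrite subr_gt0.
have bern q : 1 + q%:R * (b - 1) <= b ^+ q.
  elim: q => [|q IH]; first by rewrite mul0r addr0 expr0.
  rewrite exprS; apply: (@le_trans _ _ (b * (1 + q%:R * (b - 1)))).
    rewrite -natr1; have : 0 <= q%:R * (b - 1) * (b - 1) by rewrite !mulr_ge0// ltW.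
    by set u := q%:R; nra.
  by rewrite ler_wpM2l//; lra.
exists (Num.truncn (M / (b - 1))).+1; apply: le_trans (bern _).
have := truncnS_gt (M / (b - 1)); rewrite ltr_pdivrMr// => h.
by apply: (le_trans (ltW h)); rewrite lerDr.
Qed.

(* Coefficients [omega m ^- m] with [omega] an integer sequence tending slowly
   to infinity, so that for [s >= k + 3] the term of index [n k] exceeds [M (k + 3)]. *)
Lemma smooth_domination (N : nat -> R) : exists h : nat -> R -> R,
  [/\ derivative_tower h, (forall s : R, 0 <= s -> 1 <= h 0%N s),
      (forall s t : R, 0 <= s -> s <= t -> h 0%N s <= h 0%N t)
    & forall (k : nat) (s : R), 0 <= s -> k%:R <= s + 1 -> N k <= h 0%N s].
Proof.
(* A nondecreasing majorant, above every [N k] with [k <= j.+1]. *)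
pose M j := \sum_(i < j.+2) `|N i|.
have M0 j : 0 <= M j by apply: sumr_ge0.
have MM i j : (i <= j)%N -> M i <= M j.
  move=> ij; rewrite /M -(subnKC (_ : (i.+2 <= j.+2)%N))// big_split_ord/= lerDl.
  exact: sumr_ge0.
have NM k j : (k <= j.+1)%N -> N k <= M j.
  move=> kj; apply: (le_trans (ler_norm _)).
  by rewrite /M (bigD1 (Ordinal (kj : (k < j.+2)%N)))//= lerDl sumr_ge0.
have /choice[q Hq] : forall k : nat, exists q : nat, M k.+3 <= (k.+3%:R / k.+2%:R) ^+ q.
  by move=> k; apply: expr_unbounded; rewrite ltr_pdivlMr// mul1r ltr_nat.
pose n k := (\sum_(i < k.+1) (q i).+1)%N.
have nS k : n k.+1 = (n k + (q k.+1).+1)%N by rewrite /n big_ord_recr.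
have n_mono i j : (i < j)%N -> (n i < n j)%N.
  elim: j => // j IH; rewrite ltnS leq_eqVlt => /orP[/eqP->|/IH h]; rewrite nS addnS ltnS.
    exact: leq_addr.
  by apply: leq_trans (ltnW h) _; exact: leq_addr.
have nq k : (q k <= n k)%N by rewrite /n big_ord_recr/=; apply: leq_trans (leqnSn _) (leq_addl _ _).
have nk k : (k < n k)%N.
  by elim: k => [|k IH]; [rewrite /n big_ord1|exact: leq_ltn_trans IH (n_mono _ _ (ltnSn _))].
(* One more than the number of thresholds passed. It tends to infinity, whence the infinite radius
   of convergence, and yet [omega (n k) <= k.+2], so that s / omega is at least (k+3)/(k+2) when s
   >= k+3; the power [n k >= q k] of this ratio is large enough. *)
pose omega m := (\sum_(k < m) (n k <= m)).+1.
have omega_n k : (omega (n k) <= k.+2)%N.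
  rewrite /omega ltnS -(subnKC (nk k)) big_split_ord/= [X in (_ + X)%N]big1.
    rewrite addn0; apply: (@leq_trans (\sum_(i < k.+1) 1)%N); last by rewrite sum1_card card_ord.
    by apply: leq_sum => i _; exact: leq_b1.
  move=> i _; rewrite (subnKC (nk k)); apply/eqP; rewrite eqb0 -ltnNge.
  by apply: n_mono; rewrite -[X in (X < _)%N]addn0 addSn ltnS leq_add2l.
have omega_big A m : (n A <= m)%N -> (A < omega m)%N.
  move=> nAm; rewrite /omega ltnS.
  have Am : (A <= m)%N by apply: leq_trans (ltnW (nk A)) nAm.
  rewrite -(subnKC Am) big_split_ord/=; apply: leq_trans (leq_addr _ _).
  apply: (@leq_trans (\sum_(i < A) 1)%N); first by rewrite sum1_card card_ord.
  apply: leq_sum => i _; rewrite (subnKC Am).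
  by rewrite (leq_trans _ nAm)// ltnW// n_mono.
(* The constant term [M 3] takes care of s < 4. For larger s the single term of index [n i], with i
   = floor s - 3, suffices. *)
pose c m : R := ((omega m)%:R ^+ m)^-1 + (if m == 0%N then M 3 else 0).
have c0 m : 0 <= c m.
  by rewrite /c addr_ge0 ?invr_ge0 ?exprn_ge0//; case: ifP.
have ec : entire_coef c.
  move=> s; pose A := (Num.truncn `|s|).+1.
  exists (n A) => m nAm.
  have m0 : (m == 0%N) = false.
    by apply/negbTE; rewrite -lt0n; apply: leq_trans nAm; exact: leq_ltn_trans (nk A).
  rewrite /c m0 addr0 ger0_norm ?invr_ge0 ?exprn_ge0// mulrC ler_pdivrMr ?exprn_gt0// mul1r.
  apply: (le_trans (ler_norm _)); rewrite normrX lerXn2r ?nnegrE//.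
  apply: (le_trans (ltW (truncnS_gt _))); rewrite ler_nat ltnW//; exact: omega_big.
exists (fun k x => limn (pseries (iter k (@pseries_diffs R) c) x)); split.
- exact: entire_derivative_tower.
- move=> s s0; have := pseries_ge_term 0%N ec c0 s0; apply: le_trans.
  by rewrite expr0 mulr1 /c expr0 invr1 lerDl.
- by move=> s t s0 st; exact: pseries_nondecreasing.
- move=> k s s0 ks /=.
  pose j := Num.truncn s.
  have /andP[js sj] : j%:R <= s < j.+1%:R by exact: truncn_itv.
  have kj : (k <= j.+1)%N.
    by rewrite -ltnS -(ltr_nat R) (le_lt_trans ks)// -natr1 ltrD2r.
  apply: (le_trans (NM _ _ kj)).
  have [j3|j3] := leqP j 3.
    apply: (le_trans (MM _ _ j3)); apply: le_trans (pseries_ge_term 0%N ec c0 s0).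
    by rewrite expr0 mulr1 /c expr0 invr1 lerDr.
  have jE : j = (j - 3).+3 by rewrite -addn3 subnK// ltnW.
  move: (j - 3)%N jE => i jE.
  apply: le_trans (pseries_ge_term (n i) ec c0 s0).
  rewrite jE; apply: (le_trans (Hq i)).
  have b1 : 1 <= i.+3%:R / i.+2%:R :> R by rewrite ler_pdivlMr// mul1r ler_nat.
  apply: (le_trans (ler_weXn2l b1 (nq i))).
  apply: (@le_trans _ _ (((omega (n i))%:R ^+ n i)^-1 * s ^+ n i)); last first.
    by rewrite ler_wpM2r ?exprn_ge0// /c lerDl; case: ifP.
  rewrite [leRHS]mulrC -expr_div_n lerXn2r ?nnegrE ?divr_ge0//.
  apply: ler_pM; rewrite ?invr_ge0//; first by rewrite -jE.
  by rewrite lef_pV2 ?posrE ?ltr0n// ler_nat.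
Qed.

End Entire.

(** * Locally Lipschitz smooth functions *)

Section Nice.
Context {R : realType} {m : nat}.

(* A syntactic class closed under the constructions needed here, so that
   smoothness, local Lipschitz continuity and boundedness on bounded sets follow
   by induction. *)
Inductive nice : ('rV[R]_m -> R) -> Prop :=
| nice_cst c : nice (fun=> c)
| nice_entry i : nice (fun x => entry x i)
| nice_add f g : nice f -> nice g -> nice (fun x => f x + g x)
| nice_mul f g : nice f -> nice g -> nice (fun x => f x * g x)
| nice_comp h k f : derivative_tower h -> nice f -> nice (fun x => h k (f x)).

Lemma nice_opp f : nice f -> nice (fun x => - f x).
Proof.
move=> nf; have := nice_mul (nice_cst (-1)) nf.
by congr nice; apply/funext => x; rewrite mulN1r.
Qed.

Lemma nice_sum (J : Type) (s : seq J) (f : J -> 'rV[R]_m -> R) :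
  (forall j, nice (f j)) -> nice (fun x => \sum_(j <- s) f j x).
Proof.
move=> nf; elim: s => [|j s IH].
  by rewrite (_ : (fun x => _) = fun=> 0); [exact: nice_cst|apply/funext => x; rewrite big_nil].
rewrite (_ : (fun x => _) = fun x => f j x + \sum_(i <- s) f i x); first exact: nice_add.
by apply/funext => x; rewrite big_cons.
Qed.

Lemma derivative_tower_differentiable h k (x : R) : derivative_tower h ->
  differentiable (h k) x.
Proof. by move=> H; apply/derivable1_diffP; have [] := H k x. Qed.

Lemma differentiable_entry i (x : 'rV[R]_m) : differentiable (fun x => entry x i) x.
Proof.
rewrite /entry; case: insubP => [j _ _|_]; first exact: differentiable_coord.
exact: differentiable_cst.
Qed.

Lemma nice_differentiable f x : nice f -> differentiable f x.
Proof.
elim => [c|i|f1 f2 _ d1 _ d2|f1 f2 _ d1 _ d2|h k f1 hh _ d1].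
- exact: differentiable_cst.
- exact: differentiable_entry.
- exact: differentiableD.
- exact: differentiableM.
- by apply: differentiable_comp => //; exact: derivative_tower_differentiable.
Qed.

Lemma nice_continuous f : nice f -> continuous f.
Proof. by move=> nf x; apply: differentiable_continuous; exact: nice_differentiable. Qed.

Lemma nice_derive f (v : 'rV[R]_m) : nice f -> nice (fun x => 'D_v f x).
Proof.
elim => [c|i|f1 f2 n1 d1 n2 d2|f1 f2 n1 d1 n2 d2|h k f1 hh n1 d1].
- have -> : (fun x => 'D_v (fun=> c) x) = (fun=> 0) :> ('rV[R]_m -> R).
    by apply/funext => x; exact: derive_cst.
  exact: nice_cst.
- have -> : (fun x => 'D_v (fun x => entry x i) x) = (fun=> entry v i) :> ('rV[R]_m -> R); last exact: nice_cst.
  apply/funext => x; apply: cvg_lim => //=.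
  apply: (@cvg_trans _ ((fun=> entry v i) @ 0^')); last exact: cvg_cst.
  apply: near_eq_cvg; near=> t => /=.
  rewrite entryD entryZ addrK /GRing.scale/= mulrA mulVf ?mul1r//.
  by near: t; exact: nbhs_dnbhs_neq.
- have -> : (fun x => 'D_v (fun x => f1 x + f2 x) x) = fun x => 'D_v f1 x + 'D_v f2 x; last exact: nice_add.
  by apply/funext => x; rewrite deriveD//; apply: diff_derivable; exact: nice_differentiable.
- have -> : (fun x => 'D_v (fun x => f1 x * f2 x) x) = fun x => f1 x * 'D_v f2 x + f2 x * 'D_v f1 x; last first.
    by apply: nice_add; exact: nice_mul.
  by apply/funext => x; rewrite deriveM//; apply: diff_derivable; exact: nice_differentiable.
- have -> : (fun x => 'D_v (fun x => h k (f1 x)) x) = fun x => h k.+1 (f1 x) * 'D_v f1 x; last first.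
    by apply: nice_mul => //; exact: nice_comp.
  apply/funext => x.
  have df := nice_differentiable x n1.
  have dh := derivative_tower_differentiable k (f1 x) hh.
  rewrite !deriveE//; last exact: differentiable_comp.
  rewrite [LHS](_ : _ = 'd (h k \o f1) x v)// diff_comp//=.
  have [dk <-] := hh k (f1 x).
  by rewrite -derive1E deriv1E// /GRing.scale/= mulrC.
Unshelve. all: by end_near. Qed.

Lemma nice_smooth f : nice f -> smooth f.
Proof.
move=> nf k; elim: k f nf => [|k IH] f nf /=; first exact: nice_continuous.
split; first exact: nice_continuous.
- by move=> j x; apply: diff_derivable; exact: nice_differentiable.
- by move=> j; apply: IH; exact: nice_derive.
Qed.

Lemma tower_bounded (h : nat -> R -> R) k (B : R) : derivative_tower h ->
  exists M, forall s, `|s| <= B -> `|h k s| <= M.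
Proof.
move=> hh; have [B0|B0] := leP 0 B; last first.
  by exists 0 => s /(le_trans (normr_ge0 s)); rewrite leNgt B0.
have ch : {within `[- B, B], continuous (fun s => `|h k s|)}.
  apply: continuous_withinT => s; apply: continuous_comp; last exact: norm_continuous.
  by apply: differentiable_continuous; exact: derivative_tower_differentiable.
have BB : - B <= B by lra.
have [c _ Hc] := EVT_max BB ch.
by exists (`|h k c|) => s sB; apply: Hc; rewrite in_itv/= -ler_norml.
Qed.

Lemma tower_lipschitz (h : nat -> R -> R) k (B : R) : derivative_tower h ->
  exists2 L, 0 <= L & forall s t, `|s| <= B -> `|t| <= B -> `|h k s - h k t| <= L * `|s - t|.
Proof.
move=> hh; have [M HM] := tower_bounded k.+1 B hh.
exists `|M| => // s t; wlog st : s t / s <= t => [H|].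
  have [st|/ltW ts] := leP s t; first exact: H.
  by move=> sB tB; rewrite distrC (distrC s); exact: H.
move=> /ler_normlP[s1 s2] /ler_normlP[t1 t2].
have ch : {within `[s, t], continuous (h k)}.
  apply: continuous_withinT => u.
  by apply: differentiable_continuous; exact: derivative_tower_differentiable.
have [u] := MVT_segment st (fun x _ => hh k x) ch.
rewrite in_itv/= => /andP[su ut] e.
rewrite distrC e normrM (distrC s) ler_wpM2r//.
apply: (le_trans (HM u _)); last exact: ler_norm.
by rewrite ler_norml; lra.
Qed.

(** Both bounds are carried through one induction: a product needs the bounds of its factors for its
    Lipschitz constant, and a composition needs the range of the inner function. *)
Lemma nice_lipschitz_bounded f (B : R) : nice f -> exists LM : R * R,
  [/\ 0 <= LM.1, 0 <= LM.2, forall x, enorm x <= B -> `|f x| <= LM.2 &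
   forall x y, enorm x <= B -> enorm y <= B -> `|f x - f y| <= LM.1 * enorm (x - y)].
Proof.
elim => [c|i|f1 f2 _ IH1 _ IH2|f1 f2 _ IH1 _ IH2|h k f1 hh _ IH].
- exists (0, `|c|); split => //= x y _ _; by rewrite subrr normr0 mul0r.
- exists (1, `|B|); split => //= [x xB|x y _ _].
    apply: (le_trans (entry_le_enorm _ _)); apply: (le_trans xB); exact: ler_norm.
  by rewrite mul1r -entryN -entryD entry_le_enorm.
- have [[L1 M1] /= [L10 M10 b1 l1]] := IH1; have [[L2 M2] /= [L20 M20 b2 l2]] := IH2.
  exists (L1 + L2, M1 + M2); split => /= [||x xB|x y xB yB]; rewrite ?addr_ge0//.
    by apply: (le_trans (ler_normD _ _)); rewrite lerD ?b1 ?b2.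
  have -> : f1 x + f2 x - (f1 y + f2 y) = (f1 x - f1 y) + (f2 x - f2 y) by ring.
  by apply: (le_trans (ler_normD _ _)); rewrite mulrDl lerD ?l1 ?l2.
- have [[L1 M1] /= [L10 M10 b1 l1]] := IH1; have [[L2 M2] /= [L20 M20 b2 l2]] := IH2.
  exists (M1 * L2 + M2 * L1, M1 * M2); split => /= [||x xB|x y xB yB].
  + by rewrite addr_ge0// mulr_ge0.
  + by rewrite mulr_ge0.
  + by rewrite normrM ler_pM ?b1 ?b2.
  have -> : f1 x * f2 x - f1 y * f2 y = f1 x * (f2 x - f2 y) + f2 y * (f1 x - f1 y) by ring.
  apply: (le_trans (ler_normD _ _)); rewrite !normrM mulrDl -!mulrA.
  by rewrite lerD// ler_pM ?b1 ?l2 ?b2 ?l1.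
- have [[L M] /= [L0 M0 b1 l1]] := IH.
  have [L' L'0 HL'] := tower_lipschitz k M hh; have [M' HM'] := tower_bounded k M hh.
  exists (L' * L, `|M'|); split => /= [||x xB|x y xB yB]; rewrite ?mulr_ge0//.
    by apply: (le_trans (HM' _ (b1 _ xB))); exact: ler_norm.
  apply: (le_trans (HL' _ _ (b1 _ xB) (b1 _ yB))); rewrite -mulrA ler_wpM2l//.
  exact: l1.
Qed.

Lemma nice_lipschitz f (B : R) : nice f -> exists2 L, 0 <= L &
  forall x y, enorm x <= B -> enorm y <= B -> `|f x - f y| <= L * enorm (x - y).
Proof. by move=> /(nice_lipschitz_bounded B)[[L M] /= [L0 _ _ H]]; exists L. Qed.

Lemma nice_bounded f (B : R) : nice f -> exists2 M, 0 <= M &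
  forall x, enorm x <= B -> `|f x| <= M.
Proof. by move=> /(nice_lipschitz_bounded B)[[L M] /= [_ M0 H _]]; exists M. Qed.

End Nice.

(** * First-order expansions *)

Section Expansion.
Context {R : realType} {m : nat}.

Lemma nice_expansion (f : 'rV[R]_m -> R) x : nice f -> forall e, 0 < e ->
  exists2 d, 0 < d & forall w, enorm w < d -> `|f (x + w) - f x - 'd f x w| <= e * enorm w.
Proof.
move=> nf e e0; have df := nice_differentiable x nf.
have /eqaddoP/(_ _ e0) := diff_locally df.
move=> /nbhs_ballP[d /= d0 Hd]; exists d => // w wd.
have := Hd w; rewrite -ball_normE /ball_/= sub0r normrN => /(_ (le_lt_trans (norm_le_enorm w) wd)).
have -> : f (x + w) - f x - 'd f x w = (f \o shift x) w - (cst (f x) + 'd f x : _ -> R) w.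
  by rewrite -addrA -opprD addrC [RHS]addrC; congr (_ + f _); exact: addrC.
move=> /le_trans; apply.
by rewrite ler_wpM2l ?(ltW e0)// norm_le_enorm.
Qed.

(** Only increments with t in ]0, 1[ are used, so that a Lipschitz estimate on a bounded set
    suffices. *)
Lemma diff_le_bound (f : 'rV[R]_m -> R) x v (C : R) : nice f ->
  (forall t : R, 0 < t -> t < 1 -> `|f (x + t *: v) - f x| <= C * t) ->
  `|'d f x v| <= C.
Proof.
move=> nf H; apply/ler_addgt0Pr => e e0.
have v1 : 0 < enorm v + 1 by rewrite ltr_wpDl// enorm_ge0.
have [d d0 Hd] := nice_expansion x nf (divr_gt0 e0 v1).
pose t : R := Num.min (1 / 2) (d / 2 / (enorm v + 1)).
have t0 : 0 < t by rewrite lt_min !divr_gt0.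
have t1 : t < 1 by rewrite gt_min; apply/orP; left; lra.
have tv : enorm (t *: v) < d.
  rewrite enormZ (gtr0_norm t0); apply: (@le_lt_trans _ _ (t * (enorm v + 1))).
    by rewrite ler_wpM2l ?(ltW t0)// lerDl.
  apply: (@le_lt_trans _ _ (d / 2)); last lra.
  by rewrite -ler_pdivlMr// /t ge_min lexx orbT.
have := Hd _ tv; have := H t t0 t1.
have -> : 'd f x (t *: v) = t * 'd f x v by rewrite linearZ.
rewrite enormZ (gtr0_norm t0) => h1 h2.
rewrite -(ler_pM2l t0).
have -> : t * `|'d f x v| = `|t * 'd f x v| by rewrite normrM (gtr0_norm t0).
have -> : t * 'd f x v = (f (x + t *: v) - f x) - (f (x + t *: v) - f x - t * 'd f x v) by ring.
apply: (le_trans (ler_normB _ _)); rewrite mulrDr lerD//; first by rewrite mulrC.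
apply: (le_trans h2); rewrite mulrCA ler_wpM2l ?(ltW t0)//.
by rewrite -mulrA ler_piMr ?(ltW e0)// mulrC ler_pdivrMr// mul1r lerDl.
Qed.

Lemma nice_chain (f : 'rV[R]_m -> R) (x : R -> 'rV[R]_m) (t : R) v : nice f ->
  is_derive t 1 x v -> is_derive t 1 (fun s => f (x s)) ('d f (x t) v).
Proof.
move=> nf [dx xv].
have df := nice_differentiable (x t) nf.
have dx' : differentiable x t by apply/derivable1_diffP.
have dfx : differentiable (f \o x) t by exact: differentiable_comp.
apply: DeriveDef; first exact/derivable1_diffP.
rewrite [LHS](_ : _ = 'D_1 (f \o x) t)// deriveE// diff_comp//=.
by rewrite -xv deriveE.
Qed.

End Expansion.

(** * Error coordinates and virtual controls *)

Section Backstepping.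
Context {R : realType}.
Implicit Types (h : nat -> R -> R) (hh : nat -> nat -> R -> R).

Definition sqi {m} i (x : 'rV[R]_m) : R := \sum_(j < i) entry x j ^+ 2.

(** The ambient dimension [m] is free: the same formula is [k_i] on its own space R^(i+1) and a
    function of the full state in R^(n+1), and [virtual_control_initial] identifies the two. *)
Fixpoint virtual_control {m} h i (x : 'rV[R]_m) : R :=
  if i is j.+1 then
    - h j.+1 (sqi j.+2 x) * (entry x j.+1 - virtual_control h j x)
  else - h 0%N (sqi 1 x) * entry x 0.

Definition error_coord {m} h i (x : 'rV[R]_m) : R :=
  if i is j.+1 then entry x j.+1 - virtual_control h j x else entry x 0.

Definition error_sqr {m} h n (x : 'rV[R]_m) : R :=
  \sum_(j < n.+1) error_coord h j x ^+ 2.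

Lemma virtual_controlE m h i (x : 'rV[R]_m) :
  virtual_control h i x = - h i (sqi i.+1 x) * error_coord h i x.
Proof. by case: i. Qed.

Lemma sqi_enorm m i (x : 'rV[R]_m) : sqi i x = enorm (initial i x) ^+ 2.
Proof.
by rewrite enorm_sqr; apply: eq_bigr => j _; rewrite mxE.
Qed.

Lemma sqi_ge0 m i (x : 'rV[R]_m) : 0 <= sqi i x.
Proof. by rewrite sqi_enorm sqr_ge0. Qed.

Lemma sqi_initial m i p (x : 'rV[R]_m) : (i <= p)%N -> sqi i (initial p x) = sqi i x.
Proof. by move=> ip; rewrite !sqi_enorm initial_initial. Qed.

Lemma virtual_control_initial m h i p (x : 'rV[R]_m) : (i < p)%N ->
  virtual_control h i (initial p x) = virtual_control h i x.
Proof.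
elim: i => [|i IH] ip /=; first by rewrite sqi_initial// entry_initial.
by rewrite sqi_initial// entry_initial// IH// ltnW.
Qed.

Lemma virtual_control_ext m h h' i : (forall j, (j <= i)%N -> h j = h' j) ->
  @virtual_control m h i = virtual_control h' i.
Proof.
elim: i => [|i IH] H; apply/funext => x /=; first by rewrite H.
by rewrite H// IH// => j ji; apply: H; exact: leqW.
Qed.

Lemma error_coord_ext m h h' i : (forall j, (j < i)%N -> h j = h' j) ->
  @error_coord m h i = error_coord h' i.
Proof.
by case: i => [//|i] H; apply/funext => x /=; rewrite (virtual_control_ext m (h' := h')).
Qed.

Lemma virtual_control0 m h i : virtual_control h i (0 : 'rV[R]_m) = 0.
Proof.
elim: i => [|i IH] /=; first by rewrite entry0 mulr0.
by rewrite IH entry0 subrr mulr0.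
Qed.

Lemma error_coord0 m h i : error_coord h i (0 : 'rV[R]_m) = 0.
Proof. by case: i => [|i] /=; rewrite entry0// virtual_control0 subrr. Qed.

Lemma nice_sqi m i : nice (@sqi m i).
Proof.
apply: nice_sum => j; rewrite (_ : (fun x => _) = fun x => entry x j * entry x j).
  by apply: nice_mul; exact: nice_entry.
by apply/funext => x; rewrite expr2.
Qed.

Lemma nice_virtual_control m hh i : (forall j, derivative_tower (hh j)) ->
  nice (@virtual_control m (fun j => hh j 0%N) i).
Proof.
move=> H; elim: i => [|i IH] /=.
  apply: nice_mul; last exact: nice_entry.
  by apply: nice_opp; apply: nice_comp => //; exact: nice_sqi.
apply: nice_mul.
  by apply: nice_opp; apply: nice_comp => //; exact: nice_sqi.
by apply: nice_add; [exact: nice_entry|exact: nice_opp].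
Qed.

Lemma nice_error_coord m hh i : (forall j, derivative_tower (hh j)) ->
  nice (@error_coord m (fun j => hh j 0%N) i).
Proof.
move=> H; case: i => [|i] /=; first exact: nice_entry.
by apply: nice_add; [exact: nice_entry|apply: nice_opp; exact: nice_virtual_control].
Qed.

Lemma nice_error_sqr m hh n : (forall j, derivative_tower (hh j)) ->
  nice (@error_sqr m (fun j => hh j 0%N) n).
Proof.
move=> H; apply: nice_sum => j.
rewrite (_ : (fun x => _) = fun x => error_coord (fun j => hh j 0%N) j x *
   error_coord (fun j => hh j 0%N) j x); last by apply/funext => x; rewrite expr2.
by apply: nice_mul; exact: nice_error_coord.
Qed.

Lemma error_sqr_ge0 m h n (x : 'rV[R]_m) : 0 <= error_sqr h n x.
Proof. by apply: sumr_ge0 => j _; exact: sqr_ge0. Qed.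

Lemma error_coord_le_sqr m h n (x : 'rV[R]_m) i : (i <= n)%N ->
  error_coord h i x ^+ 2 <= error_sqr h n x.
Proof.
move=> i_n; rewrite /error_sqr (bigD1 (Ordinal (i_n : (i < n.+1)%N)))//= lerDl.
by apply: sumr_ge0 => j _; exact: sqr_ge0.
Qed.

Lemma diff_sum (m p : nat) (F : 'I_p -> 'rV[R]_m -> R) x v :
  (forall i, differentiable (F i) x) ->
  'd (fun x => \sum_(i < p) F i x) x v = \sum_(i < p) 'd (F i) x v.
Proof.
move=> dF.
have dS : differentiable (fun x => \sum_(i < p) F i x) x.
  rewrite (_ : (fun x => _) = \sum_(i < p) F i); first exact: differentiable_sum.
  by apply/funext => y; rewrite fct_sumE.
rewrite -deriveE// (_ : (fun x => _) = \sum_(i < p) F i); last first.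
  by apply/funext => y; rewrite fct_sumE.
rewrite derive_sum => [|i]; last exact: diff_derivable.
by apply: eq_bigr => i _; rewrite deriveE.
Qed.

Lemma diff_error_sqr m hh n (x v : 'rV[R]_m) : (forall j, derivative_tower (hh j)) ->
  let h := fun j => hh j 0%N in
  'd (error_sqr h n) x v = \sum_(j < n.+1) 2 * (error_coord h j x * 'd (error_coord h j) x v).
Proof.
move=> H h.
have dz (j : 'I_n.+1) : differentiable (error_coord h j) x.
  by apply: nice_differentiable; exact: nice_error_coord.
rewrite diff_sum => [|j]; last first.
  rewrite (_ : (fun x => _) = error_coord h j * error_coord h j); first exact: differentiableM.
  by apply/funext => y; rewrite expr2.
apply: eq_bigr => j _.
rewrite (_ : (fun x => _) = error_coord h j * error_coord h j); last first.
  by apply/funext => y; rewrite expr2.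
rewrite diffM//= [LHS](_ : _ = error_coord h j x * 'd (error_coord h j) x v +
  error_coord h j x * 'd (error_coord h j) x v)//.
by ring.
Qed.

(* [|x_{<= i}| <= M * state_gain h i M] when the first [i.+1] error coordinates are at most [M]. *)
Fixpoint state_gain h i (M : R) : R :=
  if i is j.+1 then state_gain h j M + 1 + h j ((M * state_gain h j M) ^+ 2) else 1.

(* [|z_i| <= s * error_gain h i s] when [|x_{<= i}| <= s]. *)
Fixpoint error_gain h i (s : R) : R :=
  if i is j.+1 then 1 + h j (s ^+ 2) * error_gain h j s else 1.

Section Gains.
Variable h : nat -> R -> R.
Hypothesis h_ge1 : forall j (s : R), 0 <= s -> 1 <= h j s.
Hypothesis h_mono : forall j (s t : R), 0 <= s -> s <= t -> h j s <= h j t.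

Lemma state_gain_ge1 i M : 1 <= state_gain h i M.
Proof.
elim: i => [//|i IH] /=; have := h_ge1 i (sqr_ge0 (M * state_gain h i M)); lra.
Qed.

Lemma state_gain_mono i M M' : 0 <= M -> M <= M' -> state_gain h i M <= state_gain h i M'.
Proof.
move=> M0 MM'; elim: i => [//|i IH] /=; rewrite !lerD//.
apply: h_mono; first exact: sqr_ge0.
have g1 := state_gain_ge1 i M; have g2 := state_gain_ge1 i M'.
have g10 : 0 <= M * state_gain h i M by rewrite mulr_ge0//; lra.
have g20 : 0 <= M' * state_gain h i M' by rewrite mulr_ge0//; lra.
by rewrite ler_pXn2r ?nnegrE// ler_pM//; lra.
Qed.

(** Each new coordinate is its error coordinate plus the preceding virtual control, and the latter
    is an error coordinate times a gain evaluated where the coordinates are already bounded. *)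
Lemma enorm_le_state_gain m i M (x : 'rV[R]_m) : 0 <= M ->
  (forall j, (j <= i)%N -> `|error_coord h j x| <= M) ->
  enorm (initial i.+1 x) <= M * state_gain h i M.
Proof.
move=> M0; elim: i => [|i IH] H.
  apply: (le_trans (enorm_initialS _ _)).
  have -> : enorm (initial 0 x) = 0 by rewrite /enorm big_ord0 sqrtr0.
  by rewrite add0r mulr1; exact: (H 0%N).
apply: (le_trans (enorm_initialS _ _)) => /=.
have {}IH := IH (fun j ji => H j (leqW ji)).
rewrite -addrA mulrDr; apply: lerD => //.
have -> : entry x i.+1 = error_coord h i.+1 x + virtual_control h i x by rewrite /= subrK.
apply: (le_trans (ler_normD _ _)); rewrite mulrDr mulr1 lerD ?H//.
rewrite virtual_controlE normrM normrN mulrC.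
have h0 (s : R) : 0 <= s -> 0 <= h i s by move=> /(h_ge1 i); lra.
apply: ler_pM => //; first by apply: H; exact: leqW.
rewrite ger0_norm ?h0 ?sqi_ge0//; apply: h_mono; first exact: sqi_ge0.
rewrite sqi_enorm ler_pXn2r// nnegrE ?enorm_ge0//.
by rewrite mulr_ge0//; have := state_gain_ge1 i M; lra.
Qed.

Lemma error_gain_ge1 i s : 1 <= error_gain h i s.
Proof.
elim: i => [//|i IH] /=; rewrite lerDl mulr_ge0//; last lra.
by have := h_ge1 i (sqr_ge0 s); lra.
Qed.

Lemma error_gain_mono i s s' : 0 <= s -> s <= s' -> error_gain h i s <= error_gain h i s'.
Proof.
move=> s0 ss'; elim: i => [//|i IH] /=; rewrite lerD2l.
have h0 (u : R) : 0 <= u -> 0 <= h i u by move=> /(h_ge1 i); lra.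
apply: ler_pM => //; first by rewrite h0// sqr_ge0.
  by have := error_gain_ge1 i s; lra.
apply: h_mono; first exact: sqr_ge0.
by rewrite ler_pXn2r ?nnegrE//; exact: le_trans ss'.
Qed.

Lemma error_coord_le_gain m i s (x : 'rV[R]_m) : 0 <= s ->
  enorm (initial i.+1 x) <= s -> `|error_coord h i x| <= s * error_gain h i s.
Proof.
move=> s0; elim: i => [|i IH] xs.
  rewrite mulr1; apply: le_trans xs => /=.
  by rewrite -(@entry_initial _ _ 1%N 0%N x)// entry_le_enorm.
rewrite /= mulrDr mulr1; apply: (le_trans (ler_normB _ _)); apply: lerD.
  by apply: le_trans xs; rewrite -(@entry_initial _ _ i.+2 i.+1 x)// entry_le_enorm.
have xs' := le_trans (enorm_initial_le x (leqnSn _)) xs.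
rewrite virtual_controlE normrM normrN mulrCA.
apply: ler_pM => //; last exact: IH.
rewrite ger0_norm; last by have := h_ge1 i (sqi_ge0 i.+1 x); lra.
apply: h_mono; first exact: sqi_ge0.
by rewrite sqi_enorm ler_pXn2r// nnegrE enorm_ge0.
Qed.

End Gains.

(** The function factors through the first i+1 coordinates, so a Lipschitz constant on a ball of
    R^(i+1) bounds its differential, whatever the other coordinates of [x] and [v] are. *)
Lemma virtual_control_diff_bound m hh i (B : R) : (forall j, derivative_tower (hh j)) ->
  let h := fun j => hh j 0%N in
  exists2 L, 0 <= L & forall x v : 'rV[R]_m, enorm (initial i.+1 x) <= B ->
    `|'d (virtual_control h i) x v| <= L * enorm (initial i.+1 v).
Proof.
move=> H h.
have nk p := nice_virtual_control p i H.
have [L L0 HL] := nice_lipschitz (B + 1) (nk i.+1).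
exists L => // x v xB.
apply/ler_addgt0Pr => e e0.
have v1 : 0 < enorm (initial i.+1 v) + 1 by rewrite ltr_wpDl// enorm_ge0.
(* Rescaling [v] keeps the perturbed point in the ball of radius [B + 1]; the summand 1 covers the
   case of a vanishing initial segment. *)
pose c := (enorm (initial i.+1 v) + 1)^-1.
have c0 : 0 < c by rewrite invr_gt0.
apply: (@le_trans _ _ (L * enorm (initial i.+1 v))); last by rewrite lerDl ltW.
rewrite -(ler_pM2l c0) -[X in X * `|_|](gtr0_norm c0) -normrM.
have -> : c * 'd (virtual_control h i) x v = 'd (virtual_control h i) x (c *: v) by rewrite linearZ.
apply: diff_le_bound; first exact: nk.
move=> t t0 t1.
rewrite -(virtual_control_initial h _ (ltnSn i)) -(virtual_control_initial h x (ltnSn i)).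
have n1 : enorm (initial i.+1 (t *: (c *: v))) = t * (c * enorm (initial i.+1 v)).
  by rewrite !initialZ !enormZ !gtr0_norm.
have n2 : c * enorm (initial i.+1 v) <= 1.
  by rewrite /c mulrC ler_pdivrMr// mul1r lerDl.
have n20 : 0 <= c * enorm (initial i.+1 v) by rewrite mulr_ge0 ?enorm_ge0// ltW.
apply: (le_trans (HL _ _ _ _)).
- rewrite initialD; apply: (le_trans (ler_enormD _ _)); rewrite lerD// n1.
  by rewrite mulr_ile1// ltW.
- by apply: (le_trans xB); rewrite lerDl.
- rewrite initialD addrAC subrr add0r n1 le_eqVlt; apply/orP; left; apply/eqP; ring.
Qed.

Lemma diff_entry (m : nat) (x v : 'rV[R]_m) i : 'd (fun x => entry x i) x v = entry v i.
Proof.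
rewrite -deriveE; last exact: differentiable_entry.
apply: cvg_lim => //=.
apply: (@cvg_trans _ ((fun=> entry v i) @ 0^')); last exact: cvg_cst.
apply: near_eq_cvg; near=> t => /=.
rewrite entryD entryZ addrK /GRing.scale/= mulrA mulVf ?mul1r//.
by near: t; exact: nbhs_dnbhs_neq.
Unshelve. all: by end_near. Qed.

(** Apart from the component of index j itself, z_j' comes from the preceding virtual control, which
    sees only the components of [v] before j. *)
Lemma error_coord_diff_bound m hh j (B : R) : (forall i, derivative_tower (hh i)) ->
  let h := fun i => hh i 0%N in
  exists2 L, 0 <= L & forall x v : 'rV[R]_m, enorm (initial j x) <= B ->
    `|'d (error_coord h j) x v - entry v j| <= L * enorm (initial j v).
Proof.
move=> hT h; case: j => [|i].
  exists 0 => // x v _ /=; rewrite diff_entry subrr normr0 mul0r//.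
have [L L0 HL] := virtual_control_diff_bound m i B hT.
exists L => // x v xr; rewrite /=.
have -> : 'd (fun x => entry x i.+1 - virtual_control h i x) x v - entry v i.+1 =
    - 'd (virtual_control h i) x v.
  have -> : (fun x => entry x i.+1 - virtual_control h i x) =
      (fun x : 'rV[R]_m => entry x i.+1) - virtual_control h i by [].
  have d1 := differentiable_entry i.+1 x.
  have d2 := nice_differentiable x (nice_virtual_control m i hT).
  rewrite -deriveE; last exact: differentiableB d1 d2.
  rewrite deriveB; [|exact: diff_derivable d1|exact: diff_derivable d2].
  by rewrite (deriveE _ d1) (deriveE _ d2) diff_entry addrAC subrr sub0r.
by rewrite normrN; exact: HL.
Qed.

End Backstepping.

(** * Bounds on the terms of the system *)

Section System.
Context {R : realType} (n l : nat) (r : R) (D : set 'rV[R]_l)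
  (f g : forall i : nat, R -> 'rV[R]_l -> (R -> 'rV[R]_i.+1) -> R)
  (varphi : R -> R)
  (r_gt0 : 0 < r)
  (D_compact : compact D)
  (f_cont : forall i, (i <= n)%N ->
    continuous_on_C0 r [set z : R * 'rV[R]_l | 0 <= z.1 /\ D z.2]
      (fun z => f i z.1 z.2))
  (g_cont : forall i, (i <= n)%N ->
    continuous_on_C0 r [set z : R * 'rV[R]_l | 0 <= z.1 /\ D z.2]
      (fun z => g i z.1 z.2))
  (f_zero : forall i, (i <= n)%N ->
    forall t d, 0 <= t -> D d -> f i t d (fun=> 0) = 0)
  (g_lip : forall i, (i <= n)%N ->
    completely_locally_lipschitz r
      [set z : R * 'rV[R]_l | 0 <= z.1 /\ D z.2] (fun z => g i z.1 z.2))
  (varphi_mono : nondecreasing_Rplus varphi)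
  (varphi_gt0 : forall s : R, 0 <= s -> 0 < varphi s)
  (g_bound : forall i, (i <= n)%N -> forall t x d, 0 <= t -> C0 r x -> D d ->
    1 / varphi (snorm r x) <= g i t d x <= varphi (snorm r x))
  (f_lip : forall i, (i <= n)%N -> forall S : set (R -> 'rV[R]_i.+1),
    bounded_C0 r S ->
    finite_sup [set q | exists t d x y,
       [/\ 0 <= t /\ D d, S x, S y, 0 < snorm r (x \- y) &
           q = `|f i t d x - f i t d y| / snorm r (x \- y)]]).

Arguments f : clear implicits.
Arguments g : clear implicits.

Let r_ge0 : 0 <= r. Proof. exact: ltW. Qed.

Lemma finite_sup_bound (S : set R) : finite_sup S ->
  exists2 L, 0 <= L & forall q, S q -> q <= L.
Proof.
rewrite /finite_sup => fS.
have [L SL] : exists L : R, (ereal_sup (EFin @` S) <= L%:E)%E.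
  move: fS; case: ereal_sup => [u _|//|_]; first by exists u.
  by exists 0; exact: leNye.
exists `|L| => // q Sq; apply: le_trans (ler_norm L); rewrite -lee_fin; apply: le_trans SL.
by apply: ereal_sup_ubound; exists q.
Qed.

(** The Lipschitz hypotheses speak of pairs at positive distance; this covers pairs at distance 0,
    which may still differ outside [-r, 0]. *)
Lemma continuous_on_C0_ext {Z : normedModType R} {m : nat} (A : set Z)
    (k : Z -> (R -> 'rV[R]_m) -> R) z x y :
  continuous_on_C0 r A k -> A z -> C0 r x -> C0 r y -> snorm r (x \- y) <= 0 ->
  k z x = k z y.
Proof.
move=> ck Az cx cy xy; apply/eqP; rewrite -subr_eq0 -normr_le0.
apply/ler_addgt0Pr => e e0; rewrite add0r ltW//.
have [d d0 Hd] := ck z y Az cy e e0.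
apply: Hd => //; first by rewrite subrr normr0.
exact: le_lt_trans d0.
Qed.

Lemma f_lipschitz i rho : (i <= n)%N -> exists2 L : R, 0 <= L &
  forall (t : R) d x y, 0 <= t -> D d -> C0 r x -> C0 r y ->
    snorm r x <= rho -> snorm r y <= rho ->
    `|f i t d x - f i t d y| <= L * snorm r (x \- y).
Proof.
move=> i_n; pose S := [set x : R -> 'rV[R]_i.+1 | C0 r x /\ snorm r x <= rho].
have bS : bounded_C0 r S by split; [move=> x []|exists rho => x []].
have [L L0 HL] := finite_sup_bound (f_lip i_n bS).
exists L => // t d x y t0 Dd cx cy xr yr.
have [xy|xy] := leP (snorm r (x \- y)) 0.
  have := continuous_on_C0_ext (z := (t, d)) (f_cont i_n) (conj t0 Dd) cx cy xy => /= ->.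
  by rewrite subrr normr0 mulr_ge0// snorm_ge0.
by rewrite -ler_pdivrMr//; apply: HL; exists t, d, x, y.
Qed.

(** The hypothesis on [g] concerns closed bounded sets, whence the horizon T, in contrast to [f].
    Compactness of [D] makes the relevant set closed and bounded. *)
Lemma g_lipschitz i rho T : (i <= n)%N -> exists2 L : R, 0 <= L &
  forall (t : R) d x y, 0 <= t <= T -> D d -> C0 r x -> C0 r y ->
    snorm r x <= rho -> snorm r y <= rho ->
    `|g i t d x - g i t d y| <= L * snorm r (x \- y).
Proof.
move=> i_n; pose S := [set p : (R * 'rV[R]_l) * (R -> 'rV[R]_i.+1) |
  (0 <= p.1.1 <= T /\ D p.1.2) /\ C0 r p.2 /\ snorm r p.2 <= rho].
have cD : closed D by exact: compact_closed.
have [MD [_ HMD]] := compact_bounded D_compact.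
have cS : closed_bounded r [set z : R * 'rV[R]_l | 0 <= z.1 /\ D z.2] S.
  split.
  - by move=> p [[/andP[p0 pT] Dp] [cp _]].
  - move=> [t w] x cx H.
    have close (e : R) : 0 < e -> exists t' w' x', [/\ 0 <= t' <= T, D w', C0 r x',
        snorm r x' <= rho & [/\ `|t' - t| < e, `|w' - w| < e & snorm r (x' \- x) < e]].
      move=> e0; have [[t' w'] [x' [[[tT Dw] [cx' xr]] zz xx]]] := H e e0.
      by exists t', w', x'; split => //; move: zz; rewrite prod_normE/= gt_max => /andP[].
    split; [split; [apply/andP; split|]|split=> //].
    + apply/ler_addgt0Pr => e e0; have [t' [w' [x' [/andP[t0 _] _ _ _ [tt _ _]]]]] := close e e0.
      by move: tt; rewrite /= ltr_distl => /andP[? ?]; lra.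
    + apply/ler_addgt0Pr => e e0; have [t' [w' [x' [/andP[_ t0] _ _ _ [tt _ _]]]]] := close e e0.
      by move: tt; rewrite /= ltr_distl => /andP[? ?]; lra.
    + rewrite /=; apply: cD => U /nbhs_ballP[e /= e0 He].
      have [t' [w' [x' [_ Dw' _ _ [_ ww _]]]]] := close e e0.
      by exists w'; split => //; apply: He; rewrite -ball_normE /ball_/= distrC.
    + apply/ler_addgt0Pr => e e0; have [t' [w' [x' [_ _ cx' xr [_ _ xx]]]]] := close e e0.
      have := ler_snormD r_ge0 cx' (C0B cx cx').
      have -> : x' \+ (x \- x') = x by apply/funext => s /=; rewrite addrC subrK.
      rewrite (snormC r x) => h; rewrite /=; lra.
  - exists (Num.max (Num.max `|T| (`|MD| + 1)) rho) => -[[t w] x] /= [[/andP[t0 tT] Dw] [_ xr]].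
    split; last by rewrite le_max xr orbT.
    rewrite prod_normE /= le_max; apply/orP; left; rewrite ge_max.
    rewrite le_max (ger0_norm t0) (le_trans tT (ler_norm _))/= le_max; apply/orP; right.
    by apply: HMD => //; rewrite (le_lt_trans (ler_norm _))// ltrDl.
have [L L0 HL] := finite_sup_bound (g_lip i_n cS).
exists L => // t d x y tT Dd cx cy xr yr.
have [xy|xy] := leP (snorm r (x \- y)) 0.
  have := continuous_on_C0_ext (z := (t, d)) (g_cont i_n) (conj (andP tT).1 Dd) cx cy xy => /= ->.
  by rewrite subrr normr0 mulr_ge0// snorm_ge0.
by rewrite -ler_pdivrMr//; apply: HL; exists (t, d), x, y.
Qed.

(** Vanishing at the zero history turns the Lipschitz bound into linear growth, uniformly in time;
    this makes the terms of z_j' proportional to M rather than merely bounded. *)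
Lemma f_growth i rho : (i <= n)%N -> exists2 L : R, 0 <= L &
  forall (t : R) d x, 0 <= t -> D d -> C0 r x -> snorm r x <= rho ->
    `|f i t d x| <= L * snorm r x.
Proof.
move=> i_n; have [L L0 HL] := f_lipschitz `|rho| i_n; exists L => // t d x t0 Dd cx xr.
have := HL t d x (fun=> 0) t0 Dd cx (@C0_cst _ r _ 0); rewrite f_zero// subr0 snorm0//.
have -> : x \- (fun=> 0) = x by apply/funext => s /=; rewrite subr0.
by apply=> //; apply: le_trans (ler_norm _).
Qed.

Lemma g_range i rho : (i <= n)%N -> 0 <= rho -> exists2 N : R, 1 <= N &
  forall (t : R) d x, 0 <= t -> D d -> C0 r x -> snorm r x <= rho ->
    N^-1 <= g i t d x <= N.
Proof.
move=> i_n rho0; exists (Num.max 1 (varphi rho)); first by rewrite le_max lexx.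
move=> t d x t0 Dd cx xr; have /andP[g1 g2] := g_bound i_n t0 cx Dd.
have v1 := varphi_gt0 (snorm_ge0 r x); have v2 := varphi_mono (snorm_ge0 r x) xr.
apply/andP; split; last by rewrite le_max (le_trans g2 v2) orbT.
apply: le_trans g1; rewrite div1r lef_pV2 ?posrE//; last by rewrite lt_max ltr01.
by rewrite le_max v2 orbT.
Qed.

(* The terms of the derivative of [z_j] along the system, for a history whose
   error coordinates stay below [C * M] and an arbitrary last component of [v]. *)
Definition term_bound (C : R) (h : nat -> R -> R) (j : nat) (N : nat -> R) :=
  forall (K : nat), 1 <= N K /\
  forall (t : R) d (x : R -> 'rV[R]_n.+1) (M : R) (v : 'rV[R]_n.+1),
    0 <= t -> D d -> C0 r x -> 0 <= M -> M <= K%:R ->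
    (forall i, (i <= j)%N -> forall th : R, - r <= th <= 0 ->
       `|error_coord h i (x th)| <= C * M) ->
    (forall i, (i < j)%N -> entry v i =
       f i t d (initialC i.+1 x) + g i t d (initialC i.+1 x) * entry (x 0) i.+1) ->
    [/\ `|f j t d (initialC j.+1 x)| <= N K * M,
        (N K)^-1 <= g j t d (initialC j.+1 x) <= N K &
        `|'d (error_coord h j) (x 0) v - entry v j| <= N K * M].

(** Error coordinates of size C M with M <= K confine the state to the radius G M <= rho, where [f]
    grows linearly and [g] lies between positive constants. The differential involves only [v_i]
    with i < j, whose factor x_{i+1} has index at most j and is controlled too. *)
Lemma term_bound_exists C (hh : nat -> nat -> R -> R) j : (j <= n)%N -> 1 <= C ->
  (forall i, derivative_tower (hh i)) ->
  (forall i (s : R), 0 <= s -> 1 <= hh i 0%N s) ->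
  (forall i (s t : R), 0 <= s -> s <= t -> hh i 0%N s <= hh i 0%N t) ->
  exists N, term_bound C (fun i => hh i 0%N) j N.
Proof.
move=> j_n C1 hT h1 hM; set h := fun i => hh i 0%N.
suff H : forall K : nat, exists N : R, 1 <= N /\
  forall (t : R) d (x : R -> 'rV[R]_n.+1) (M : R) (v : 'rV[R]_n.+1),
    0 <= t -> D d -> C0 r x -> 0 <= M -> M <= K%:R ->
    (forall i, (i <= j)%N -> forall th : R, - r <= th <= 0 ->
       `|error_coord h i (x th)| <= C * M) ->
    (forall i, (i < j)%N -> entry v i =
       f i t d (initialC i.+1 x) + g i t d (initialC i.+1 x) * entry (x 0) i.+1) ->
    [/\ `|f j t d (initialC j.+1 x)| <= N * M,
        N^-1 <= g j t d (initialC j.+1 x) <= N &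
        `|'d (error_coord h j) (x 0) v - entry v j| <= N * M].
  by have /choice[N HN] := H; exists N.
move=> K.
have C0' : 0 <= C by lra.
(* The state gain is taken at C K in place of C M, so that [G] depends on K only. *)
pose G := C * state_gain h j (C * K%:R).
have G0 : 0 <= G by rewrite mulr_ge0//; have := state_gain_ge1 (h:=h) h1 j (C * K%:R); lra.
pose rho := G * K%:R.
have rho0 : 0 <= rho by rewrite mulr_ge0.
have /choice[Lf HLf] : forall i : nat, exists L : R, (i <= n)%N -> 0 <= L /\
  forall (t : R) d x, 0 <= t -> D d -> C0 r x -> snorm r x <= rho -> `|f i t d x| <= L * snorm r x.
  move=> i; have [i_n|] := leqP i n; last by exists 0.
  by have [L L0 H] := f_growth rho i_n; exists L.
have /choice[Ng HNg] : forall i : nat, exists N : R, (i <= n)%N -> 1 <= N /\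
  forall (t : R) d x, 0 <= t -> D d -> C0 r x -> snorm r x <= rho -> N^-1 <= g i t d x <= N.
  move=> i; have [i_n|] := leqP i n; last by exists 0.
  by have [N N1 H] := g_range i_n rho0; exists N.
have [Lk Lk0 HLk] := error_coord_diff_bound n.+1 j rho hT.
pose B := \sum_(i < n.+1) (`|Lf i| * G + `|Ng i| * G).
have B0 : 0 <= B by apply: sumr_ge0 => i _; rewrite addr_ge0// mulr_ge0.
pose N := `|Lf j| * G + Num.max 1 (Ng j) + Lk * (j%:R * B).
exists N; split.
  have : 1 <= Num.max 1 (Ng j) by rewrite le_max lexx.
  have : 0 <= `|Lf j| * G by rewrite mulr_ge0.
  have : 0 <= Lk * (j%:R * B) by rewrite !mulr_ge0.
  rewrite /N; lra.
have N1 : `|Lf j| * G <= N.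
  have h1' : 0 <= Lk * (j%:R * B) by rewrite !mulr_ge0.
  have h2' : 0 <= Num.max 1 (Ng j) by rewrite le_max ler01.
  by rewrite /N; lra.
have N2 : Num.max 1 (Ng j) <= N.
  have h1' : 0 <= `|Lf j| * G by rewrite mulr_ge0.
  have h2' : 0 <= Lk * (j%:R * B) by rewrite !mulr_ge0.
  by rewrite /N; lra.
have N3 : Lk * (j%:R * B) <= N.
  have h1' : 0 <= `|Lf j| * G by rewrite mulr_ge0.
  have h2' : 0 <= Num.max 1 (Ng j) by rewrite le_max ler01.
  by rewrite /N; lra.
move=> t d x M v t0 Dd cx M0 MK Hz Hv.
have CM0 : 0 <= C * M by rewrite mulr_ge0.
have xi i : (i <= j)%N -> forall th : R, - r <= th <= 0 -> enorm (initial i.+1 (x th)) <= G * M.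
  move=> ij th thr; apply: (le_trans (enorm_initial_le (x th) (ij : (i.+1 <= j.+1)%N))).
  apply: (le_trans (enorm_le_state_gain h1 hM CM0 (fun i' h' => Hz i' h' th thr))).
  rewrite /G mulrAC ler_wpM2r// ler_wpM2l//.
  by apply: state_gain_mono => //; rewrite ler_wpM2l.
have snx i : (i <= j)%N -> snorm r (initialC i.+1 x) <= G * M.
  by move=> ij; apply: snorm_le => // th thr; exact: xi.
have GM : G * M <= rho by rewrite /rho ler_wpM2l.
have x0i i : (i <= j)%N -> enorm (initial i.+1 (x 0)) <= G * M.
  by move=> ij; apply: xi => //; rewrite lexx andbT oppr_le0.
have fb i : (i <= j)%N -> `|f i t d (initialC i.+1 x)| <= `|Lf i| * G * M.
  move=> ij; have [L0 H] := HLf i (leq_trans ij j_n).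
  have h2 := H t d (initialC i.+1 x) t0 Dd (C0_initial cx) (le_trans (snx i ij) GM).
  apply: (le_trans h2).
  by rewrite -mulrA ler_pM ?snorm_ge0 ?snx// ler_norm.
split.
- apply: (le_trans (fb j (leqnn j))); rewrite ler_wpM2r//.
- have [N1' H] := HNg j j_n.
  have /andP[g1 g2] := H t d (initialC _ x) t0 Dd (C0_initial cx) (le_trans (snx j (leqnn j)) GM).
  have NgN : Ng j <= N by apply: le_trans N2; rewrite le_max lexx orbT.
  apply/andP; split; last exact: le_trans NgN.
  apply: le_trans g1; rewrite lef_pV2 ?posrE//; lra.
- apply: (le_trans (HLk _ _ _)).
    case: (j) x0i => [|i] x0i; first by rewrite /enorm big_ord0 sqrtr0.
    exact: le_trans (x0i i (leqnSn _)) GM.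
  apply: (@le_trans _ _ (Lk * (j%:R * B) * M)); last by rewrite ler_wpM2r.
  rewrite -!mulrA ler_wpM2l//; apply: enorm_le_bound => i; rewrite mxE Hv ?ltn_ord//.
  have ij := ltn_ord i; have i_n : (i <= n)%N by rewrite (leq_trans (ltnW ij)).
  apply: (le_trans (ler_normD _ _)); rewrite normrM.
  have [N1' H] := HNg i i_n.
  have /andP[g1 g2] := H t d (initialC _ x) t0 Dd (C0_initial cx) (le_trans (snx i (ltnW ij)) GM).
  have gpos : 0 <= g i t d (initialC i.+1 x) by apply: le_trans g1; rewrite invr_ge0; lra.
  have xb : `|entry (x 0) i.+1| <= G * M.
    by rewrite -(@entry_initial _ _ i.+2)//; apply: (le_trans (entry_le_enorm _ _)); exact: x0i.
  apply: (@le_trans _ _ (`|Lf i| * G * M + `|Ng i| * (G * M))).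
    rewrite lerD ?fb ?(ltnW ij)//; apply: ler_pM => //.
    by rewrite ger0_norm// (le_trans g2)// ler_norm.
  rewrite [leLHS](_ : _ = (`|Lf i| * G + `|Ng i| * G) * M); last by ring.
  rewrite ler_wpM2r// /B (bigD1 (Ordinal (i_n : (i < n.+1)%N)))//= lerDl.
  by apply: sumr_ge0 => i' _; rewrite addr_ge0// mulr_ge0.
Qed.

End System.

(** * Choice of the gains *)

Section Design.
Context {R : realType} (n l : nat) (r : R) (D : set 'rV[R]_l)
  (f g : forall i : nat, R -> 'rV[R]_l -> (R -> 'rV[R]_i.+1) -> R).
Arguments f : clear implicits.
Arguments g : clear implicits.

Definition admissible (hh : nat -> nat -> R -> R) :=
  [/\ forall i, derivative_tower (hh i),
      forall i (s : R), 0 <= s -> 1 <= hh i 0%N s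
    & forall i (s t : R), 0 <= s -> s <= t -> hh i 0%N s <= hh i 0%N t].

(** The bracket pays for the terms of index at most j, for M^2 at each of the n+1 indices, and for
    the decay rate. Passing from M to |z_j| through M <= 6 N_j |z_j| costs (6 N_j)^2 = 4 (3 N_j)^2,
    and one more factor 3 N_j covers the lower bound 1 / N_j of g_j. *)
Definition required_gain (sigma : R) (N : nat -> nat -> R) j K : R :=
  4 * (3 * N j K) ^+ 3 * (\sum_(i < j.+1) 3 * N i K + n.+1%:R * (1 + sigma)).

(** [K] is an integer bound of M in the case M = |z_i|. The gain sees only the coordinates up to j,
    hence the restriction [i <= j]. *)
Definition dominates (sigma : R) (h : nat -> R -> R) (N : nat -> nat -> R) j :=
  forall (x : 'rV[R]_n.+1) i (K : nat), (i <= j)%N ->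
    K%:R <= `|error_coord h i x| + 1 ->
    required_gain sigma N j K <= h j (sqi j.+1 x).

Lemma dominating_gain sigma hh N j : admissible hh -> exists g : nat -> R -> R,
  [/\ derivative_tower g, (forall s : R, 0 <= s -> 1 <= g 0%N s),
      (forall s t : R, 0 <= s -> s <= t -> g 0%N s <= g 0%N t)
    & forall (x : 'rV[R]_n.+1) i (K : nat), (i <= j)%N ->
      K%:R <= `|error_coord (fun i => hh i 0%N) i x| + 1 ->
      required_gain sigma N j K <= g 0%N (sqi j.+1 x)].
Proof.
move=> [hT h1 hM]; set h := fun i => hh i 0%N.
pose P K := `|required_gain sigma N j K|.
pose Bt (k : R) := \sum_(i < j.+1) error_gain h i k.
(* Of the two extra units one passes above the truncated value, the other stands for the 1 in the
   bound [|z_i| + 1] of K. *)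
pose q (k : nat) := (Num.truncn (k%:R * Bt k%:R)).+2.
have [gg [g1 g2 g3 g4]] := smooth_domination (fun k => \sum_(i < (q k).+1) P i).
exists gg; split => // x i K ij Kz.
have s0 := sqi_ge0 j.+1 x.
pose k := (Num.truncn (sqi j.+1 x)).+1.
have sk : sqi j.+1 x < k%:R by exact: truncnS_gt.
have ks : k%:R <= sqi j.+1 x + 1.
  by rewrite /k -natr1 lerD2r; have /andP[] := truncn_itv s0.
apply: le_trans (g4 k _ s0 ks).
have k1 : 1 <= k%:R :> R by rewrite ler1n.
have ek : enorm (initial j.+1 x) <= k%:R.
  rewrite -(@ler_pXn2r _ 2)// ?nnegrE ?enorm_ge0// -sqi_enorm.
  apply: (le_trans (ltW sk)); rewrite expr2; nra.
have zk : `|error_coord h i x| <= k%:R * Bt k%:R.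
  apply: (@le_trans _ _ (k%:R * error_gain h i k%:R)).
    apply: (error_coord_le_gain h1 hM); first by lra.
    apply: le_trans ek; exact: enorm_initial_le.
  rewrite ler_wpM2l// /Bt (bigD1 (Ordinal (ij : (i < j.+1)%N)))//= lerDl.
  by apply: sumr_ge0 => i' _; have := error_gain_ge1 h1 i' k%:R; apply: le_trans.
have Kq : (K <= q k)%N.
  rewrite -(ler_nat R) /q -natr1; apply: (le_trans Kz); rewrite lerD2r.
  by apply: (le_trans zk); rewrite ltW// truncnS_gt.
apply: (le_trans (ler_norm _)); rewrite -/(P K).
rewrite (bigD1 (Ordinal (Kq : (K < (q k).+1)%N)))//= lerDl.
by apply: sumr_ge0 => i' _; exact: normr_ge0.
Qed.

Lemma term_bound_ext C h h' j N : (forall i, (i < j)%N -> h i = h' i) ->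
  term_bound n r D f g C h j N -> term_bound n r D f g C h' j N.
Proof.
move=> hh' H K; have [N1 HK] := H K; split => // t d x M v t0 Dd cx M0 MK Hz Hv.
rewrite -(error_coord_ext _ hh'); apply: HK => //.
move=> i ij th thr; rewrite (error_coord_ext _ (h' := h'))//; first exact: Hz.
by move=> i' ii'; apply: hh'; exact: leq_trans ii' ij.
Qed.

(** Recursion on the number p of gains already fixed: they determine N_p, and the next gain is
    chosen to dominate it. The conditions of index j involve only gains of index at most j, so later
    choices do not disturb them. *)
Lemma gains_exist sigma C :
  (forall hh j, (j <= n)%N -> admissible hh ->
     exists N, term_bound n r D f g C (fun i => hh i 0%N) j N) ->
  exists hh N, admissible hh /\ forall j, (j <= n)%N ->
    term_bound n r D f g C (fun i => hh i 0%N) j (N j) /\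
    dominates sigma (fun i => hh i 0%N) N j.
Proof.
move=> TB.
suff H p : (p <= n.+1)%N -> exists hh N, admissible hh /\ forall j, (j < p)%N ->
    term_bound n r D f g C (fun i => hh i 0%N) j (N j) /\
    dominates sigma (fun i => hh i 0%N) N j.
  by have [hh [N [ad H']]] := H n.+1 (leqnn _); exists hh, N; split.
elim: p => [_|p IH pn].
  have [h0 [t0 h1 hM _]] := smooth_domination (fun=> 0 : R).
  by exists (fun=> h0), (fun _ _ => 0).
have [hh [N [ad H]]] := IH (ltnW pn).
have [Np HNp] := TB hh p pn ad.
pose N' i := if i == p then Np else N i.
have [gp [g1 g2 g3 g4]] := dominating_gain sigma N' p ad.
pose hh' i := if i == p then gp else hh i.
have hE i : (i < p)%N -> hh' i = hh i.
  by move=> ip; rewrite /hh' ifF// (ltn_eqF ip).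
have NE i : (i < p)%N -> N' i = N i.
  by move=> ip; rewrite /N' ifF// (ltn_eqF ip).
have zE i : (i <= p)%N ->
    @error_coord R n.+1 (fun i => hh' i 0%N) i = error_coord (fun i => hh i 0%N) i.
  by move=> ip; apply: error_coord_ext => j ji; rewrite hE//; exact: leq_trans ji ip.
exists hh', N'; split.
  have [a1 a2 a3] := ad.
  by split=> [i|i s s0|i s t s0 st]; rewrite /hh'; case: ifP => _; auto.
move=> j; rewrite ltnS leq_eqVlt => /orP[/eqP ->|jp].
  split.
    rewrite /N' eqxx; apply: (term_bound_ext _ HNp) => i ip; by rewrite hE.
  move=> x i K ip; rewrite zE// => /g4 h; apply: (le_trans (h ip)).
  by rewrite /hh' eqxx.
have [b1 b2] := H j jp; split.
  rewrite NE//; apply: (term_bound_ext _ b1) => i ij; rewrite hE//; exact: ltn_trans jp.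
move=> x i K ij; rewrite zE; last by rewrite ltnW// (leq_ltn_trans ij).
move=> /(b2 _ _ _ ij) h; rewrite hE//; apply: le_trans h.
rewrite /required_gain NE// le_eqVlt; apply/orP; left; apply/eqP.
congr (_ * (_ + _)); apply: eq_bigr => i' _; rewrite NE//.
exact: leq_ltn_trans (leq_ord i') jp.
Qed.

Lemma backstepping_decay sigma (hh : nat -> nat -> R -> R) N (C : R) : 0 < sigma -> 1 <= C -> 0 <= r ->
  admissible hh ->
  (forall j, (j <= n)%N ->
    term_bound n r D f g (C * n.+1%:R) (fun i => hh i 0%N) j (N j) /\
    dominates sigma (fun i => hh i 0%N) N j) ->
  let h := fun i => hh i 0%N in
  forall (t : R) d (x : R -> 'rV[R]_n.+1), 0 <= t -> D d -> C0 r x ->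
    (forall th : R, - r <= th <= 0 -> error_sqr h n (x th) <= C * error_sqr h n (x 0)) ->
    'd (error_sqr h n) (x 0) (closed_loop f g (virtual_control h n) t d x)
      <= - (2 * sigma * error_sqr h n (x 0)).
Proof.
move=> sigma0 C1 r0 [hT h1 hM] H h t d x t0 Dd cx HC.
set v := closed_loop _ _ _ _ _ _.
pose z i := error_coord h i (x 0).
pose imax := [arg max_(i > ord0 : 'I_n.+1) `|z i|]%O.
have zmax (i : 'I_n.+1) : `|z i| <= `|z imax|.
  by rewrite /imax; case: arg_maxP => // j _ H'; exact: H'.
pose M := `|z imax|; have M0 : 0 <= M by exact: normr_ge0.
have zM i : (i <= n)%N -> `|z i| <= M by move=> i_n; exact: (zmax (Ordinal (i_n : (i < n.+1)%N))).
pose K := (Num.truncn M).+1.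
have MK : M <= K%:R by rewrite ltW// truncnS_gt.
have KM : K%:R <= M + 1 by rewrite /K -natr1 lerD2r; have /andP[] := truncn_itv M0.
have n0 : 1 <= n.+1%:R :> R by rewrite ler1n.
have WM : error_sqr h n (x 0) <= n.+1%:R * M ^+ 2.
  rewrite -[X in X%:R]card_ord -sumr_const mulr_suml; apply: ler_sum => i _.
  rewrite mul1r -real_normK ?num_real// ler_pXn2r ?nnegrE//; exact: (zM i (leq_ord i)).
(* From z_i^2 <= C (n+1) M^2 on the history; since C (n+1) >= 1, this constant can stand for its own
   square root. *)
have Hz i : (i <= n)%N -> forall th : R, - r <= th <= 0 -> `|error_coord h i (x th)| <= C * n.+1%:R * M.
  move=> i_n th thr.
  rewrite -(@ler_pXn2r _ 2)// ?nnegrE// ?mulr_ge0//; last lra.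
  rewrite real_normK ?num_real//; apply: (le_trans (error_coord_le_sqr h (x th) i_n)).
  apply: (le_trans (HC th thr)).
  apply: (@le_trans _ _ (C * n.+1%:R * M ^+ 2)).
    by rewrite -mulrA ler_wpM2l//; lra.
  rewrite [leRHS]exprMn ler_wpM2r ?sqr_ge0// expr2 ler_peMr//; first by rewrite mulr_ge0//; lra.
  by apply: (le_trans C1); rewrite ler_peMr//; lra.
have vE i : (i < n)%N -> entry v i = f i t d (initialC i.+1 x) + g i t d (initialC i.+1 x) * entry (x 0) i.+1.
  by move=> i_n; rewrite /v /closed_loop /triangular (entryE _ (ltnW i_n : (i < n.+1)%N)) mxE /= i_n.
have vnE : entry v n = f n t d (initialC n.+1 x) + g n t d (initialC n.+1 x) * virtual_control h n (x 0).
  by rewrite /v /closed_loop /triangular (entryE _ (ltnSn n)) mxE /= ltnn.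
have N1 j : (j <= n)%N -> 1 <= N j K by move=> j_n; have [/(_ K)[]] := H j j_n.
have hg j : 0 <= h j (sqi j.+1 (x 0)) by have := h1 j _ (sqi_ge0 j.+1 (x 0)); apply: le_trans.
have term j : (j <= n)%N -> z j * 'd (error_coord h j) (x 0) v <=
    `|z j| * (3 * N j K * M) - h j (sqi j.+1 (x 0)) * z j ^+ 2 / N j K.
  move=> j_n; have [/(_ K)[N1' TB] _] := H j j_n.
  have [||fb /andP[g1 g2] eb] := TB t d x M v t0 Dd cx M0 MK.
  - by move=> i ij; apply: Hz; exact: leq_trans ij j_n.
  - by move=> i ij; apply: vE; exact: leq_trans ij j_n.
  have Np : 0 < N j K by lra.
  (* Writing x_{j+1} as z_{j+1} plus the virtual control isolates the damping term. At the last
     index the input is the virtual control itself and no error coordinate follows. *)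
  pose z' := if (j < n)%N then z j.+1 else 0.
  have z'M : `|z'| <= M by rewrite /z'; case: ifPn => [/zM//|_]; rewrite normr0.
  have vj : entry v j = f j t d (initialC j.+1 x) + g j t d (initialC j.+1 x) * z'
      - g j t d (initialC j.+1 x) * (h j (sqi j.+1 (x 0)) * z j).
    rewrite /z'; case: ltnP => jn.
      rewrite vE// /z /=.
      have -> : entry (x 0) j.+1 = (entry (x 0) j.+1 - virtual_control h j (x 0)) + virtual_control h j (x 0).
        by rewrite subrK.
      by rewrite {2}virtual_controlE; ring.
    have -> : j = n by apply/eqP; rewrite eqn_leq j_n.
    by rewrite vnE virtual_controlE /z; ring.
  set gj := g j t d _ in g1 g2 vj; set fj := f j t d _ in fb vj; set hj := h j _ in vj *.
  have gp : 0 < gj by apply: lt_le_trans g1; rewrite invr_gt0.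
  have gz : `|gj * z'| <= N j K * M by rewrite normrM ler_pM// ger0_norm// ltW.
  have dE : 'd (error_coord h j) (x 0) v = ('d (error_coord h j) (x 0) v - entry v j) + fj + gj * z'
      - gj * (hj * z j) by rewrite vj; ring.
  rewrite dE; move: eb; set e := _ - entry v j => eb.
  have -> : z j * (e + fj + gj * z' - gj * (hj * z j)) = z j * (e + fj + gj * z') - gj * (hj * z j ^+ 2) by ring.
  apply: lerB.
    apply: (le_trans (ler_norm _)); rewrite normrM ler_wpM2l//.
    apply: (le_trans (ler_normD _ _)); have := ler_normD e fj; lra.
  rewrite mulrC ler_wpM2r// mulr_ge0// ?sqr_ge0//; exact: hg.
pose Nh i := 3 * N i K.
have Nh1 i : (i <= n)%N -> 1 <= Nh i by move=> /N1; rewrite /Nh; lra.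
have imaxP : M <= 2 * Nh imax * `|z imax|.
  by rewrite -/M ler_peMl//; have := Nh1 imax (leq_ord imax); lra.
(* The index [imax] passes the test because N >= 1, so the maximum exists and [imax <= m], which is
   the condition of [dominates]. *)
have [m mP mmax] : exists2 m : 'I_n.+1, M <= 2 * Nh m * `|z m| &
    forall j : 'I_n.+1, M <= 2 * Nh j * `|z j| -> (j <= m)%N.
  exists [arg max_(i > imax | M <= 2 * Nh i * `|z i|) i]; first by case: arg_maxnP.
  by move=> j jP; case: arg_maxnP => // i _; apply.
have m_n := leq_ord m.
pose Q := \sum_(i < m.+1) Nh i + n.+1%:R * (1 + sigma).
have Q0 : 0 <= Q.
  rewrite addr_ge0//; last by rewrite mulr_ge0//; lra.
  apply: sumr_ge0 => i _; apply: le_trans (Nh1 i _) => //.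
  exact: leq_trans (leq_ord i) m_n.
have gainQ : Q * M ^+ 2 <= h m (sqi m.+1 (x 0)) * z m ^+ 2 / N m K.
  have [_ dom] := H m m_n.
  have /dom/(_ KM) : (imax <= m)%N by exact: mmax.
  rewrite /required_gain -/Q => hQ.
  have Nm1 := N1 m m_n.
  have zz : M ^+ 2 <= (2 * Nh m) ^+ 2 * z m ^+ 2.
    rewrite -(real_normK (num_real (z m))) -exprMn ler_pXn2r ?nnegrE// mulr_ge0//.
    by have := Nh1 m m_n; lra.
  rewrite ler_pdivlMr; last lra.
  apply: (@le_trans _ _ (4 * Nh m ^+ 3 * Q * z m ^+ 2)); last first.
    by rewrite ler_wpM2r ?sqr_ge0//.
  apply: (@le_trans _ _ (Q * ((2 * Nh m) ^+ 2 * z m ^+ 2) * N m K)).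
    by rewrite ler_wpM2r ?ler_wpM2l//; lra.
  rewrite (_ : Q * ((2 * Nh m) ^+ 2 * z m ^+ 2) * N m K =
    4 * Nh m ^+ 2 * Q * z m ^+ 2 * N m K); last by ring.
  rewrite (_ : 4 * Nh m ^+ 3 * Q * z m ^+ 2 = 4 * Nh m ^+ 2 * Q * z m ^+ 2 * Nh m); last by ring.
  rewrite ler_wpM2l//; last by rewrite /Nh; lra.
  by rewrite mulr_ge0 ?sqr_ge0// mulr_ge0// mulr_ge0 ?sqr_ge0.
have termj (j : 'I_n.+1) : z j * 'd (error_coord h j) (x 0) v <=
    (if (j < m.+1)%N then Nh j else 0) * M ^+ 2 + M ^+ 2 - (if j == m then Q * M ^+ 2 else 0).
  apply: (le_trans (term j (leq_ord j))); apply: lerB; last first.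
    case: eqP => [->//|_].
    have Nj := le_trans ler01 (N1 j (leq_ord j)).
    by apply: divr_ge0 => //; apply: mulr_ge0; [exact: hg|exact: sqr_ge0].
  have Nj1 := Nh1 j (leq_ord j).
  case: ltnP => jm.
    rewrite -/(Nh j) (_ : Nh j * M ^+ 2 = M * (Nh j * M)); last by ring.
    apply: (@le_trans _ _ (M * (Nh j * M))); last by rewrite lerDl sqr_ge0.
    by rewrite ler_wpM2r ?zM ?leq_ord// mulr_ge0//; lra.
  rewrite mul0r add0r -/(Nh j).
  have /negP : ~ (M <= 2 * Nh j * `|z j|) by move=> /mmax; rewrite leqNgt jm.
  rewrite -ltNge => hj.
  rewrite mulrA expr2 ler_wpM2r//.
  have : 0 <= Nh j * `|z j| by rewrite mulr_ge0//; lra.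
  lra.
rewrite (diff_error_sqr n (x 0) v hT) -mulr_sumr.
suff : \sum_(j < n.+1) z j * 'd (error_coord h j) (x 0) v <= - (n.+1%:R * sigma * M ^+ 2).
  have : sigma * error_sqr h n (x 0) <= sigma * (n.+1%:R * M ^+ 2) by rewrite ler_wpM2l// ltW.
  rewrite -/(error_sqr h n (x 0)); lra.
apply: (le_trans (ler_sum _ (fun j _ => termj j))).
rewrite sumrB big_split/= -mulr_suml sumr_const card_ord -(big_mkcond (fun j => j == m)) big_pred1_eq.
rewrite -big_mkcond/= -(big_ord_widen n.+1 Nh)//= /Q -mulr_natl.
rewrite le_eqVlt; apply/orP; left; apply/eqP; ring.
Qed.

End Design.

(** * The derivative of a weighted maximum *)

Section UpperDerivative.
Context {R : realType} {m : nat}.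

Lemma upper_deriv_le (r : R) (V : (R -> 'rV[R]_m) -> R) t x v (c : R) :
  (forall e : R, 0 < e -> exists2 delta : R, 0 < delta & forall (h : R) y,
     0 < h -> h < delta -> h < r -> C0 r y -> snorm r y < delta ->
     V (Eh h x v \+ (fun theta => h *: y theta)) <= V x + h * (c + e)) ->
  (upper_deriv r (fun _ => V) t x v <= c%:E)%E.
Proof.
move=> H; apply/lee_addgt0Pr => e e0; rewrite -EFinD.
have [de d0 Hd] := H e e0.
apply: (@le_trans _ _ (ereal_sup [set q | exists h y,
      [/\ 0 < h < de, h < r, C0 r y, snorm r y < de &
          q = ((V (Eh h x v \+ (fun theta => h *: y theta)) - V x) / h)%:E]])).
  by apply: ereal_inf_lbound; exists de.
apply: ge_ereal_sup => _ [h [y [/andP[h0 hd] hr cy yd ->]]].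
rewrite lee_fin ler_pdivrMr// lerBlDl mulrC; exact: Hd.
Qed.

Lemma expRN_quadratic (a : R) : 0 <= a -> expR (- a) <= 1 - a + a ^+ 2.
Proof.
move=> a0; rewrite expRN; have h := expR_ge1Dx a.
apply: (@le_trans _ _ (1 + a)^-1).
  by rewrite lef_pV2 ?posrE ?expR_gt0//; lra.
rewrite -div1r ler_pdivrMr; last lra.
have : 0 <= a ^+ 3 by rewrite exprn_ge0.
rewrite (_ : (1 - a + a ^+ 2) * (1 + a) = 1 + a ^+ 3); last by ring.
lra.
Qed.

End UpperDerivative.

(** The scalar inequality behind the values at th > -h, with s = th + h. The weight provides the
    decay over a time h - s and the flow that over a time s, together 2 sigma V h; what remains
    beyond the slack [c] is of second order in h and is absorbed by [e]. *)
Lemma decay_estimate {R : realType} (V c e sigma h s : R) :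
  0 <= V -> 0 <= c -> 0 < e -> 0 < sigma -> h <= 1 -> 0 < s <= h ->
  h * (8 * sigma ^+ 2 * (2 * V + c + e)) <= e ->
  let a := 2 * sigma * (h - s) in
  let A := V + s * (- (2 * sigma * V) + c) + h * (e / 2) in
  0 <= A -> (1 - a + a ^+ 2) * A <= V + h * (- (2 * sigma * V) + c + e).
Proof.
move=> V0 c0 e0 s0 h1 /andP[sp sh] t3 a A A0.
have h0 : 0 <= h by lra.
have sg0 := ltW s0.
have a0 : 0 <= a by rewrite /a !mulr_ge0 ?subr_ge0.
have ah : a <= 2 * sigma * h.
  by rewrite /a; apply: ler_wpM2l; [apply: mulr_ge0|lra].
have sV : 0 <= 2 * sigma * V by rewrite !mulr_ge0.
have hV : 0 <= 2 * sigma * h * V by rewrite !mulr_ge0.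
have ssV : 0 <= s * (2 * sigma * V) by apply: mulr_ge0 => //; exact: ltW.
have sc : 0 <= s * c by apply: mulr_ge0 => //; exact: ltW.
have he : 0 <= h * (e / 2) by apply: mulr_ge0 => //; lra.
have Ale : A <= V + c + e.
  have q1 : s * c <= 1 * c by apply: ler_wpM2r => //; lra.
  have q2 : h * (e / 2) <= 1 * e by apply: ler_pM => //; lra.
  by rewrite /A; lra.
have Age : V - 2 * sigma * h * V <= A.
  have q1 : s * (2 * sigma * V) <= h * (2 * sigma * V) by apply: ler_wpM2r.
  by rewrite /A; lra.
have t1 : - (a * A) <= - (a * V) + (2 * sigma * h) * (2 * sigma * h * V).
  have q1 : a * (V - 2 * sigma * h * V) <= a * A by apply: ler_wpM2l.
  have q2 : a * (2 * sigma * h * V) <= (2 * sigma * h) * (2 * sigma * h * V) by apply: ler_wpM2r.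
  lra.
have t2 : a ^+ 2 * A <= (2 * sigma * h) ^+ 2 * (V + c + e).
  apply: ler_pM => //; first exact: sqr_ge0.
  by rewrite ler_pXn2r// nnegrE// !mulr_ge0.
have t4 : h * (h * (8 * sigma ^+ 2 * (2 * V + c + e))) <= h * e by apply: ler_wpM2l.
have t5 : s * c <= h * c by apply: ler_wpM2r.
have -> : (1 - a + a ^+ 2) * A = A - a * A + a ^+ 2 * A by ring.
have aV : a * V = 2 * sigma * h * V - s * (2 * sigma * V) by rewrite /a; ring.
have AE : A = V - s * (2 * sigma * V) + s * c + h * (e / 2) by rewrite /A; ring.
have t6 : (2 * sigma * h) ^+ 2 * (V + c + e) + (2 * sigma * h) * (2 * sigma * h * V) =
   h * (h * (8 * sigma ^+ 2 * (2 * V + c + e))) / 2 by field.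
lra.
Qed.

Section WeightedMax.
Context {R : realType} {m : nat} (r sigma : R) (W : 'rV[R]_m -> R).

Definition weighted_max (x : R -> 'rV[R]_m) : R :=
  sup [set expR (2 * sigma * theta) * W (x theta) | theta in `[- r, 0]].

Lemma weighted_max_le x M : 0 <= r ->
  (forall th : R, - r <= th <= 0 -> expR (2 * sigma * th) * W (x th) <= M) ->
  weighted_max x <= M.
Proof.
move=> r0 H; apply: ge_sup.
  exists (expR (2 * sigma * 0) * W (x 0)); exists 0 => //=.
  by rewrite in_itv/= lexx andbT oppr_le0.
by move=> _ [th /= + <-]; rewrite in_itv/=; exact: H.
Qed.

Lemma weighted_max_bounded x : 0 <= r -> nice W -> C0 r x ->
  has_ubound [set expR (2 * sigma * theta) * W (x theta) | theta in `[- r, 0]].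
Proof.
move=> r0 nW cx; have [M M0 HM] := nice_bounded (snorm r x) nW.
exists (expR (2 * `|sigma| * r) * M) => _ [th /= + <-]; rewrite in_itv/= => thr.
apply: (@le_trans _ _ (expR (2 * sigma * th) * M)).
  rewrite ler_wpM2l ?expR_ge0//; apply: (le_trans (ler_norm _)); apply: HM.
  exact: enorm_le_snorm.
rewrite ler_wpM2r// ler_expR -!mulrA ler_wpM2l//.
apply: (le_trans (ler_norm _)); rewrite normrM ler_wpM2l//.
by case/andP: thr => ? ?; rewrite ler_norml; apply/andP; split; lra.
Qed.

Lemma weighted_max_ge x (th : R) : 0 <= r -> nice W -> C0 r x -> - r <= th <= 0 ->
  expR (2 * sigma * th) * W (x th) <= weighted_max x.
Proof.
move=> r0 nW cx thr; apply: ub_le_sup; first exact: weighted_max_bounded.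
by exists th => //=; rewrite in_itv.
Qed.

Lemma weighted_max_ge_present x : 0 <= r -> nice W -> C0 r x -> W (x 0) <= weighted_max x.
Proof.
move=> r0 nW cx; have := @weighted_max_ge x 0 r0 nW cx.
by rewrite mulr0 expR0 mul1r; apply; rewrite lexx andbT oppr_le0.
Qed.

Lemma weighted_max_lipschitz (B : R) : 0 <= r -> 0 <= sigma -> nice W ->
  exists2 L, 0 <= L & forall x y, C0 r x -> C0 r y -> snorm r x <= B -> snorm r y <= B ->
    `|weighted_max y - weighted_max x| <= L * snorm r (y \- x).
Proof.
move=> r0 s0 nW; have [L L0 HL] := nice_lipschitz B nW; exists L => //.
have one x y : C0 r x -> C0 r y -> snorm r x <= B -> snorm r y <= B ->
    weighted_max y <= weighted_max x + L * snorm r (y \- x).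
  move=> cx cy xB yB; apply: weighted_max_le => // th thr.
  have e1 : expR (2 * sigma * th) <= 1.
    case/andP: thr => ? ?; rewrite -[leRHS]expR0 ler_expR mulr_ge0_le0// mulr_ge0//.
  have h1 := HL (y th) (x th) (le_trans (enorm_le_snorm r0 cy thr) yB) (le_trans (enorm_le_snorm r0 cx thr) xB).
  have h2 := enorm_le_snorm r0 (C0B cy cx) thr.
  have h3 : W (y th) <= W (x th) + L * snorm r (y \- x).
    have := ler_norm (W (y th) - W (x th)).
    have : L * enorm (y th - x th) <= L * snorm r (y \- x) by rewrite ler_wpM2l.
    lra.
  apply: (@le_trans _ _ (expR (2 * sigma * th) * (W (x th) + L * snorm r (y \- x)))).
    by rewrite ler_wpM2l ?expR_ge0.
  rewrite mulrDr lerD ?weighted_max_ge// ler_piMl// mulr_ge0// snorm_ge0//.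
move=> x y cx cy xB yB; rewrite ler_norml.
have h1 := one x y cx cy xB yB; have := one y x cy cx yB xB.
by rewrite snormC => h2; apply/andP; split; lra.
Qed.

End WeightedMax.

(** Only the points th > -h feel the velocity [v], and they matter only if the maximum is attained
    at 0; otherwise the weight alone produces the decay. The slack [c] later carries the effect of
    an input that differs from the feedback. *)
Lemma upper_deriv_weighted_max {R : realType} m (r sigma : R) (W : 'rV[R]_m -> R) (t : R) x v (c : R) : 0 < r -> 0 < sigma -> nice W ->
  (forall u, 0 <= W u) -> C0 r x -> 0 <= c ->
  (W (x 0) = weighted_max r sigma W x -> 'd W (x 0) v <= - (2 * sigma * weighted_max r sigma W x) + c) ->
  (upper_deriv r (fun _ => weighted_max r sigma W) t x v <= (- (2 * sigma * weighted_max r sigma W x) + c)%:E)%E.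
Proof.
move=> r_gt0 s0 nW W0 cx c0 Hc; have r0 := ltW r_gt0.
set V := weighted_max r sigma W x in Hc *.
have WV : W (x 0) <= V by exact: weighted_max_ge_present.
have V0 : 0 <= V by exact: le_trans WV.
pose b := snorm r x; have b0 : 0 <= b by exact: snorm_ge0.
pose nv := enorm v; have nv0 : 0 <= nv by exact: enorm_ge0.
have [L L0 HL] := nice_lipschitz (b + nv + 1) nW.
have x0b : enorm (x 0) <= b by exact: enorm0_le_snorm.
have dWb y : enorm y <= 1 -> `|'d W (x 0) y| <= L * enorm y.
  move=> y1; apply: diff_le_bound => // u u0 u1.
  have uy : enorm (u *: y) <= 1.
    by rewrite enormZ gtr0_norm// mulr_ile1 ?enorm_ge0// ltW.
  apply: (le_trans (HL _ _ _ _)).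
  - by apply: (le_trans (ler_enormD _ _)); move: x0b uy nv0; clear; lra.
  - by move: x0b nv0; clear; lra.
  - by rewrite addrAC subrr add0r enormZ gtr0_norm// mulrCA mulrC.
apply: upper_deriv_le => e e0; rewrite -/V.
pose eps1 := e / (4 * (nv + 1)).
have eps10 : 0 < eps1 by rewrite divr_gt0// mulr_gt0//; lra.
have [d1 d10 Hd1] := nice_expansion (x 0) nW eps10.
(* The distance of the present value from the maximum; the value 1 is a default for the case in
   which there is no gap. *)
pose gap := if W (x 0) < V then V - W (x 0) else 1.
have gap0 : 0 < gap by rewrite /gap; case: ifPn => // h; rewrite subr_gt0.
(* One constant for each smallness condition: [k1] for the shifted part of the history, [k2] for
   staying below the gap, [k3] for the perturbation y, [k4] for the second-order terms. *)
pose k1 := 4 * sigma ^+ 2 * V + L + 1.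
pose k2 := L * (nv + 1) + 2 * sigma * V + 1.
pose k3 := 4 * (L + 1).
pose k4 := 8 * sigma ^+ 2 * (2 * V + c + e) + 1.
have s2 : 0 <= sigma ^+ 2 by exact: sqr_ge0.
have V4 : 0 <= 4 * sigma ^+ 2 * V by apply: mulr_ge0 => //; apply: mulr_ge0.
have Lnv : 0 <= L * (nv + 1) by apply: mulr_ge0 => //; lra.
have sV : 0 <= sigma * V by apply: mulr_ge0 => //; exact: ltW.
have k10 : 0 < k1 by rewrite /k1; lra.
have k20 : 0 < k2 by rewrite /k2; lra.
have k30 : 0 < k3 by rewrite /k3; lra.
have k40 : 0 < k4.
  have : 0 <= 8 * sigma ^+ 2 * (2 * V + c + e) by apply: mulr_ge0; [apply: mulr_ge0|lra].
  by rewrite /k4; lra.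
pose de := Num.min 1 (Num.min (e / k1) (Num.min (gap / k2) (Num.min (e / k3) (Num.min (e / k4) (d1 / (nv + 1)))))).
have nv1 : 0 < nv + 1 by lra.
have de0 : 0 < de by rewrite !lt_min ltr01 !divr_gt0.
have : de <= de := lexx de.
rewrite {2}/de !le_min !ler_pdivlMr// => /andP[de1 /andP[de2 /andP[de3 /andP[de4 /andP[de5 de6]]]]].
exists de => // h y h0 hde hr cy yde.
have yb (th : R) : - r <= th <= 0 -> enorm (y th) <= de.
  by move=> thr; rewrite (le_trans (enorm_le_snorm r0 cy thr))// ltW.
have hde' := ltW hde.
have Lde : 0 <= L * de by rewrite mulr_ge0// ltW.
apply: weighted_max_le => // th thr; rewrite /Eh /=.
have hyb : enorm (h *: y th) <= h * de.
  by rewrite enormZ gtr0_norm// ler_wpM2l ?(ltW h0)// yb.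
have h1' : h <= 1 by exact: le_trans hde' de1.
have hde1 : h * de <= 1 by apply: mulr_ile1; [exact: ltW|exact: ltW|exact: h1'|exact: de1].
case: ifPn => [thh|].
(* The point th + h belongs to the old history, and its weight has gained the factor exp(-2 sigma
   h). *)
- have thr' : - r <= th + h <= 0 by case/andP: thr => t1 _; rewrite ler_wpDr ?(ltW h0)// -lerBrDr sub0r.
  have xt := enorm_le_snorm r0 cx thr'.
  have h1 := HL (x (th + h) + h *: y th) (x (th + h)).
  have {}h1 : `|W (x (th + h) + h *: y th) - W (x (th + h))| <= L * (h * de).
    apply: (le_trans (h1 _ _)).
    + by apply: (le_trans (ler_enormD _ _)); move: xt hyb hde1 nv0; rewrite -/b; clear; lra.
    + by move: xt nv0; rewrite -/b; clear; lra.
    + by rewrite addrAC subrr add0r ler_wpM2l.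
  have {}h1 : W (x (th + h) + h *: y th) <= W (x (th + h)) + L * (h * de).
    have := ler_norm (W (x (th + h) + h *: y th) - W (x (th + h))).
    by move: h1; clear; lra.
  have e1 : expR (2 * sigma * th) <= 1.
    by case/andP: thr => ? ?; rewrite -[leRHS]expR0 ler_expR mulr_ge0_le0// mulr_ge0// ltW.
  have Lh : 0 <= L * (h * de) by rewrite !mulr_ge0// ltW.
  apply: (@le_trans _ _ (expR (2 * sigma * th) * W (x (th + h)) + L * (h * de))).
    apply: (le_trans (ler_wpM2l (expR_ge0 _) h1)); rewrite mulrDr lerD2l ler_piMl//.
  have -> : expR (2 * sigma * th) = expR (- (2 * sigma * h)) * expR (2 * sigma * (th + h)).
    by rewrite -expRD; congr expR; ring.
  have h3 : expR (2 * sigma * (th + h)) * W (x (th + h)) <= V by exact: weighted_max_ge.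
  have a0 : 0 <= 2 * sigma * h by rewrite !mulr_ge0// ltW.
  have h4 := expRN_quadratic a0.
  have h5 : expR (- (2 * sigma * h)) * expR (2 * sigma * (th + h)) * W (x (th + h)) <=
      (1 - 2 * sigma * h + (2 * sigma * h) ^+ 2) * V.
    by rewrite -mulrA ler_pM ?expR_ge0// mulr_ge0 ?expR_ge0.
  have h6 : h * de * k1 <= h * e.
    by rewrite -mulrA ler_wpM2l// ltW.
  have h7 : h * (4 * sigma ^+ 2 * V) * h <= h * (4 * sigma ^+ 2 * V) * de.
    by rewrite ler_wpM2l// !mulr_ge0// ltW.
  have hd0 : 0 <= h * de by rewrite mulr_ge0// ltW.
  have hc : 0 <= h * c by rewrite mulr_ge0// ltW.
  by move: h6 h7 hd0 hc h5; rewrite /k1 -/V; set z := expR _ * _ * W _; clearbody z; clear; lra.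
- rewrite -ltNge => hth; have thr2 : 0 < th + h <= h by move: hth; case/andP: thr => _ t2 hth; rewrite -subr_gt0 opprK in hth; rewrite hth gerDr.
  set s := th + h in thr2 *; case/andP: thr2 => sp sh.
  set w := s *: v + h *: y th.
  have -> : x 0 + s *: v + h *: y th = x 0 + w by rewrite /w addrA.
  have wb : enorm w <= h * (nv + 1).
    have q1 : enorm w <= enorm (s *: v) + enorm (h *: y th) by exact: ler_enormD.
    have q2 : enorm (s *: v) = s * nv by rewrite enormZ gtr0_norm.
    have q3 : s * nv <= h * nv by rewrite ler_wpM2r.
    have q4 : h * de <= h * 1 by rewrite ler_wpM2l// ltW.
    by rewrite mulrDr; move: q1 q3 q4 hyb; rewrite q2; clear; lra.
  have wB : enorm w <= nv + 1.
    by apply: (le_trans wb); rewrite ler_piMl ?(ltW nv1).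
  have e1 : expR (2 * sigma * th) <= 1.
    by case/andP: thr => ? ?; rewrite -[leRHS]expR0 ler_expR mulr_ge0_le0// mulr_ge0// ltW.
  (* If the maximum is not attained at 0, a short step cannot close the gap; otherwise the
     hypothesis on the differential of [W] is available. *)
  have [WltV|WgeV] := ltP (W (x 0)) V.
    have h1 : `|W (x 0 + w) - W (x 0)| <= L * (h * (nv + 1)).
      apply: (le_trans (HL _ _ _ _)).
      + by apply: (le_trans (ler_enormD _ _)); move: x0b wB b0; clear; lra.
      + by move: x0b nv0; clear; lra.
      + by rewrite addrAC subrr add0r ler_wpM2l.
    have {}h1 : W (x 0 + w) <= W (x 0) + L * (h * (nv + 1)).
      by have := ler_norm (W (x 0 + w) - W (x 0)); move: h1; clear; lra.
    apply: (@le_trans _ _ (W (x 0 + w))); first by rewrite ler_piMl.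
    apply: (le_trans h1).
    have h2 : h * k2 <= gap.
      by apply: le_trans de3; rewrite ler_wpM2r ?(ltW k20).
    move: h2; rewrite /k2 /gap WltV => h2.
    have hc : 0 <= h * (c + e) by rewrite mulr_ge0 ?addr_ge0// ltW.
    by move: h2 hc h0; clear; lra.
  have WE : W (x 0) = V by apply/eqP; rewrite eq_le WV.
  have {}Hc := Hc WE.
  have wd1 : enorm w < d1.
    apply: (le_lt_trans wb); apply: lt_le_trans de6; rewrite ltr_pM2r//.
  have h1 := Hd1 w wd1.
  have dw : 'd W (x 0) w = s * 'd W (x 0) v + h * 'd W (x 0) (y th).
    by rewrite /w linearD !linearZ.
  have dy : 'd W (x 0) (y th) <= L * de.
    apply: (le_trans (ler_norm _)); apply: (le_trans (dWb _ _)).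
      exact: le_trans (yb _ thr) de1.
    by rewrite ler_wpM2l// yb.
  have eta1 : eps1 * enorm w <= h * (e / 4).
    apply: (le_trans (ler_wpM2l (ltW eps10) wb)).
    by rewrite le_eqVlt; apply/orP; left; apply/eqP; rewrite /eps1; field; rewrite gt_eqF.
  have eta2 : L * de <= e / 4.
    by move: de4 Lde e0 de0; rewrite /k3; clear; lra.
  pose A := V + s * (- (2 * sigma * V) + c) + h * (e / 2).
  have WA : W (x 0 + w) <= A.
    have h3 : s * 'd W (x 0) v <= s * (- (2 * sigma * V) + c) by rewrite ler_wpM2l// ltW.
    have h4 : h * 'd W (x 0) (y th) <= h * (e / 4).
      by rewrite ler_wpM2l ?(ltW h0)// (le_trans dy).
    have h5 := ler_norm (W (x 0 + w) - W (x 0) - 'd W (x 0) w).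
    by move: h1 h5 h3 h4 eta1; rewrite dw WE /A; clear; lra.
  have A0 : 0 <= A by exact: le_trans WA.
  pose a := 2 * sigma * (h - s).
  have a0 : 0 <= a by rewrite /a !mulr_ge0 ?subr_ge0// ltW.
  have -> : expR (2 * sigma * th) = expR (- a) by congr expR; rewrite /a /s; ring.
  apply: (@le_trans _ _ ((1 - a + a ^+ 2) * A)).
    by rewrite ler_pM ?expR_ge0// expRN_quadratic.
  apply: decay_estimate => //; first by rewrite sp.
  apply: le_trans de5; rewrite /k4 [leRHS]mulrDr mulr1.
  apply: (@le_trans _ _ (de * (8 * sigma ^+ 2 * (2 * V + c + e)))).
    by apply: ler_wpM2r => //; apply: mulr_ge0; [apply: mulr_ge0|rewrite addr_ge0 ?(ltW e0)// addr_ge0// mulr_ge0].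
  by rewrite lerDl ltW.
Qed.

(** * Decay along solutions *)

Section AbsoluteContinuityComposition.
Context {R : realType}.

Lemma scalar_ac_comp m (a b K : R) (x : R -> 'rV[R]_m) (f : R -> R) :
  absolutely_continuous a b x -> 0 <= K ->
  (forall s t : R, a <= s -> s <= t -> t <= b ->
    `|f t - f s| <= K * ((t - s) + enorm (x t - x s))) ->
  scalar_ac a b f.
Proof.
move=> acx K0 H e e0.
have K1 : 0 < K + 1 by lra.
have e2 : 0 < e / (2 * (K + 1)) by rewrite divr_gt0// mulr_gt0.
have [d d0 Hd] := acx _ e2.
exists (Num.min d (e / (2 * (K + 1)))); first by rewrite lt_min d0.
move=> N s t H1 H2; rewrite lt_min => /andP[h1 h2].
have h3 := Hd N s t H1 H2 h1.
apply: (@le_lt_trans _ _ (\sum_(i < N) (K + 1) * ((t i - s i) + enorm (x (t i) - x (s i))))).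
  apply: ler_sum => i _; have [q1 [q2 q3]] := H1 i.
  apply: (le_trans (H _ _ q1 q2 q3)); rewrite ler_wpM2r//; last lra.
  by rewrite addr_ge0 ?enorm_ge0// subr_ge0.
rewrite -mulr_sumr big_split/=.
have -> : e = (K + 1) * (e / (2 * (K + 1)) + e / (2 * (K + 1))) by field; lra.
by rewrite ltr_pM2l// ltrD.
Qed.

Lemma scalar_ac_continuous (a b : R) (f : R -> R) :
  scalar_ac a b f -> {within `[a, b], continuous f}.
Proof.
move=> acf; apply/within_continuousP => t; rewrite /= in_itv/= => tab e e0.
have [d d0 Hd] := acf e e0.
have one (u v : R) : a <= u -> u <= v -> v <= b -> v - u < d -> `|f v - f u| < e.
  move=> au uv vb uvd; have := Hd 1%N (fun=> u) (fun=> v); rewrite !big_ord1; apply => //.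
  by move=> i j; rewrite !ord1 eqxx.
exists d => // s; rewrite in_itv/= => sab std.
have /andP[s1 s2] := sab; have /andP[t1 t2] := tab.
move: std; rewrite ltr_distl => /andP[h1 h2].
have [st|ts] := leP s t; first by rewrite distrC; apply: one => //; lra.
by apply: one => //; lra.
Qed.

End AbsoluteContinuityComposition.

Section Decay.
Context {R : realType} (r sigma : R) {l m : nat} (D : set 'rV[R]_l)
  (F : R -> 'rV[R]_l -> (R -> 'rV[R]_m) -> 'rV[R]_m) (W : 'rV[R]_m -> R).
Local Notation mu := (@lebesgue_measure R).

(** A maximum of [weighted_max] at 0 gives the bound on the history without the 2; this factor is
    spent in the comparison along solutions. *)
Definition razumikhin_decay := forall (t : R) d x, 0 <= t -> D d -> C0 r x ->
  (forall th : R, - r <= th <= 0 -> W (x th) <= 2 * expR (2 * sigma * r) * W (x 0)) ->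
  'd W (x 0) (F t d x) <= - (2 * sigma * W (x 0)).

(* If [exp(2 sigma (t - t0)) W(x(t))] exceeded its initial supremum, then on the
   last stretch before its maximum it would stay above half of that maximum;
   there the decay condition applies, so it could not increase. *)
Lemma solution_weighted_decay t0 x0 d T x : 0 < r -> 0 < sigma -> nice W ->
  (forall u, 0 <= W u) -> razumikhin_decay -> 0 <= t0 -> C0 r x0 ->
  (forall t, 0 <= t -> D (d t)) -> is_solution r F t0 x0 d T x ->
  forall t : R, t0 - r <= t -> (t%:E < T)%E ->
    expR (2 * sigma * (t - t0)) * W (x t) <= weighted_max r sigma W x0.
Proof.
move=> r_gt0 s0 nW W0 HF t00 cx0 Dd solx; have r0 := ltW r_gt0.
have [_ xinit cx acx dx] := solx.
pose phi (t : R) := expR (2 * sigma * (t - t0)) * W (x t).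
set V := weighted_max _ _ _ _.
have phi_init (t : R) : t0 - r <= t <= t0 -> phi t <= V.
  move=> tt; have h : - r <= t - t0 <= 0 by lra.
  have := xinit _ h; rewrite /phi subrKC => ->; exact: weighted_max_ge.
have V0 : 0 <= V.
  apply: le_trans (phi_init t0 _); first by rewrite mulr_ge0 ?expR_ge0.
  by rewrite lexx andbT; lra.
move=> t1 t1r t1T; rewrite -/(phi t1).
have [t1t0|t0t1] := leP t1 t0; first by apply: phi_init; rewrite t1r.
rewrite leNgt; apply/negP => Vt1.
have t0t1' := ltW t0t1.
have [B HB] : exists B, forall t : R, t0 <= t <= t1 -> enorm (x t) <= B.
  apply: (bounded_enorm_within t0t1' cx) => t; rewrite /= in_itv/= => /andP[h1 h2].
  by split; [lra|apply: le_lt_trans t1T; rewrite lee_fin].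
have [LM [L0 M0 HM HL]] := nice_lipschitz_bounded B nW.
move: LM => [L M] /= in L0 M0 HM HL.
pose E := expR (2 * sigma * (t1 - t0)).
have E0 : 0 <= E by exact: expR_ge0.
have sg0 := ltW s0.
have expL (s t : R) : s <= t -> t <= t1 ->
   `|expR (2 * sigma * (t - t0)) - expR (2 * sigma * (s - t0))| <= E * (2 * sigma) * (t - s).
  move=> st tt1.
  have e1 : expR (2 * sigma * (s - t0)) <= expR (2 * sigma * (t - t0)).
    by rewrite ler_expR ler_wpM2l ?mulr_ge0// lerD2r.
  have e2 : expR (2 * sigma * (t - t0)) <= E.
    by rewrite ler_expR ler_wpM2l ?mulr_ge0// lerD2r.
  have e3 := expR_ge1Dx (2 * sigma * (s - t0) - 2 * sigma * (t - t0)).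
  move: e3; rewrite expRB ler_pdivlMr ?expR_gt0// => e3.
  rewrite ger0_norm ?subr_ge0//.
  apply: (@le_trans _ _ (expR (2 * sigma * (t - t0)) * (2 * sigma * (t - s)))).
    by move: e3; clear; set es := expR _; set et := expR _; lra.
  by rewrite -[leRHS]mulrA; apply: ler_wpM2r => //; rewrite !mulr_ge0// subr_ge0.
have ac_phi : scalar_ac t0 t1 phi.
  apply: (@scalar_ac_comp _ _ _ _ (E * (2 * sigma) * M + E * L) x) => //.
  - exact: acx.
  - by rewrite addr_ge0// !mulr_ge0.
  move=> s t t0s st tt1.
  have hs : enorm (x s) <= B by apply: HB; apply/andP; lra.
  have ht : enorm (x t) <= B by apply: HB; apply/andP; lra.
  have -> : phi t - phi s = (expR (2 * sigma * (t - t0)) - expR (2 * sigma * (s - t0))) * W (x t)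
     + expR (2 * sigma * (s - t0)) * (W (x t) - W (x s)) by rewrite /phi; ring.
  apply: (le_trans (ler_normD _ _)); rewrite !normrM.
  have q1 := ler_pM (normr_ge0 _) (normr_ge0 _) (expL _ _ st tt1) (HM _ ht).
  have q2 : `|expR (2 * sigma * (s - t0))| * `|W (x t) - W (x s)| <= E * (L * enorm (x t - x s)).
    apply: ler_pM => //; last exact: HL.
    by rewrite ger0_norm ?expR_ge0// ler_expR ler_wpM2l ?mulr_ge0// lerD2r (le_trans st).
  have q3 : 0 <= E * (2 * sigma) * M * enorm (x t - x s) by rewrite !mulr_ge0 ?enorm_ge0.
  have q4 : 0 <= E * L * (t - s) by rewrite !mulr_ge0// subr_ge0.
  move: q1 q2 q3 q4; clear; set a := `|_ - _|; set b := `|W _|; set c := `|expR _|; set e := `|_ - _|; set g := enorm _; lra.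
have [c cI Hc] := EVT_max t0t1' (scalar_ac_continuous ac_phi).
move: (cI); rewrite in_itv/= => /andP[t0c ct1].
have Vc : V < phi c by apply: (lt_le_trans Vt1); apply: Hc; rewrite in_itv/= t0t1' lexx.
(* At least [V], so that [t0] belongs to [S]; at least half of the maximum, so that phi c <= 2 phi
   on the last stretch, as [razumikhin_decay] permits. *)
pose lam := Num.max V (phi c / 2).
have lamV : V <= lam by rewrite le_max lexx.
have lamc : phi c / 2 <= lam by rewrite le_max lexx orbT.
have lamlt : lam < phi c by rewrite gt_max Vc; move: Vc V0; clear; lra.
pose S := [set s : R | t0 <= s <= c /\ phi s <= lam].
have St0 : S t0.
  split; first by rewrite lexx.
  by apply: le_trans lamV; apply: phi_init; rewrite lexx andbT; lra.
have supS : has_sup S by split; [exists t0 | exists c => s [/andP[]]].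
have t0s : t0 <= sup S by apply: ub_le_sup => //; exact: supS.2.
have sc : sup S <= c by apply: ge_sup; [exists t0 | move=> s [/andP[]]].
have phis : phi (sup S) <= lam.
  rewrite leNgt; apply/negP => hl.
  have /within_continuousP/(_ (sup S)) := scalar_ac_continuous ac_phi.
  rewrite /= in_itv/= => /(_ _ (phi (sup S) - lam)); rewrite subr_gt0 => /(_ _ hl)[|de de0 Hde].
    by apply/andP; split => //; exact: le_trans ct1.
  have [s [/andP[s1 s2] s3] s4] := sup_adherent de0 supS.
  have s5 : s <= sup S by apply: ub_le_sup; [exact: supS.2|split => //; rewrite s1].
  have := Hde s; rewrite in_itv/= s1 (le_trans s2 ct1) => /(_ isT).
  rewrite distrC ger0_norm ?subr_ge0// => /(_ _).
  rewrite ltr_distl => /(_ _)h.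
  have : sup S - s < de by move: s4; clear; lra.
  by move=> /h; move: s3; clear; lra.
have above (s : R) : sup S < s -> s <= c -> lam < phi s.
  move=> ss sc'; rewrite ltNge; apply/negP => h.
  have : s <= sup S by apply: ub_le_sup; [exact: supS.2|split => //; rewrite sc' andbT (le_trans t0s)// ltW].
  by rewrite leNgt ss.
suff : phi c <= phi (sup S) by move: lamlt phis; clear; lra.
apply: ac_nonincreasing => //.
  move=> e e0; have [de de0 Hde] := ac_phi e e0; exists de => // N s t H1.
  by apply: Hde => i; have [q1 [q2 q3]] := H1 i; split; [exact: le_trans q1|split => //; exact: le_trans ct1].
move: dx; apply: filterS; first exact: (ae_filter_ringOfSetsType mu).
move=> t /= Ht /andP[st tc].
have t0t : t0 <= t by apply: (le_trans t0s); exact: ltW.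
have tT : (t%:E < T)%E.
  by apply: le_lt_trans t1T; rewrite lee_fin; apply: le_trans ct1; exact: ltW.
have {}Ht := Ht t0t tT.
have hx0 : hist t x 0 = x t by rewrite /hist addr0.
have tp : 0 <= t by exact: le_trans t0t.
have cht := solution_hist_C0 solx t0t tT.
have := HF t (d t) (hist t x) tp (Dd _ tp) cht.
rewrite hx0 => /(_ _)dW.
have {}dW : 'd W (x t) (F t (d t) (hist t x)) <= - (2 * sigma * W (x t)).
  apply: dW => th /andP[th1 th2]; rewrite /hist.
  have p1 : phi (t + th) <= phi c.
    have [tt0|t0t'] := leP (t + th) t0.
      by apply: (le_trans (phi_init _ _)); [rewrite tt0 andbT lerD|exact: ltW].
    by apply: Hc; rewrite in_itv/= (ltW t0t')/= (le_trans _ ct1)// (le_trans _ (ltW tc))// gerDl.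
  have p2 : phi (t + th) <= 2 * phi t.
    have p2 := above t st (ltW tc); apply: (le_trans p1).
    by rewrite mulrC -ler_pdivrMr ?ltr0n// (le_trans lamc)// ltW.
  have p3 : expR (2 * sigma * (t + th - t0)) = expR (2 * sigma * th) * expR (2 * sigma * (t - t0)).
    by rewrite -expRD; congr expR; ring.
  have p4 : expR (2 * sigma * th) * W (x (t + th)) <= 2 * W (x t).
    rewrite -(ler_pM2l (expR_gt0 (2 * sigma * (t - t0)))).
    by move: p2; rewrite /phi p3; clear; lra.
  have p5 : W (x (t + th)) = expR (- (2 * sigma * th)) * (expR (2 * sigma * th) * W (x (t + th))).
    by rewrite mulrA -expRD addNr expR0 mul1r.
  rewrite p5; apply: (@le_trans _ _ (expR (2 * sigma * r) * (2 * W (x t)))); last first.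
    by rewrite le_eqVlt; apply/orP; left; apply/eqP; ring.
  apply: ler_pM => //; rewrite ?expR_ge0//.
    by rewrite mulr_ge0 ?expR_ge0.
  by rewrite ler_expR -mulrN ler_wpM2l ?mulr_ge0// lerNl.
exists (expR (2 * sigma * (t - t0)) * (2 * sigma * W (x t) + 'd W (x t) (F t (d t) (hist t x)))).
  by rewrite mulr_ge0_le0 ?expR_ge0//; move: dW; clear; lra.
have d1 := nice_chain nW Ht.
have d2 : is_derive t 1 (fun s : R => expR (2 * sigma * (s - t0))) (2 * sigma * expR (2 * sigma * (t - t0))).
  have := is_derive_scaled_expR 1 (2 * sigma) t0 t.
  by rewrite mul1r; under [X in is_derive _ _ X _]eq_fun do rewrite mul1r.
have dd : is_derive t 1 phi _ := is_deriveM d2 d1.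
apply: (is_derive_eq dd).
by rewrite /GRing.scale/=; ring.
Qed.

(** The estimate serves twice: as an a priori bound it yields global solutions, and for these it
    yields boundedness, stability and attraction. [K] depends on the ball of initial data but not on
    [t0] or [d], hence the uniformity. *)
Lemma URGAS_of_exponential_decay : 0 < r -> 0 < sigma ->
  rhs_continuous r D F -> rhs_locally_lipschitz r D F -> rhs_locally_bounded r D F ->
  (forall S : R, 0 <= S -> exists2 K, 0 <= K & forall t0 x0 d T x, 0 <= t0 -> C0 r x0 ->
     snorm r x0 <= S -> (forall t, 0 <= t -> D (d t)) -> is_solution r F t0 x0 d T x ->
     forall t : R, t0 <= t -> (t%:E < T)%E ->
       snorm r (hist t x) <= K * expR (- (sigma * (t - t0))) * snorm r x0) ->
  URGAS r D F.
Proof.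
move=> r_gt0 s0 cF lipF bF decay; have r0 := ltW r_gt0.
have sol (p : R * (R -> 'rV[R]_m) * (R -> 'rV[R]_l)) : exists X,
    0 <= p.1.1 -> C0 r p.1.2 -> MD D p.2 -> is_maximal_solution r F p.1.1 p.1.2 p.2 +oo%E X.
  move: p => [[t0 x0] d] /=.
  have [[t00 [cx0 Md]]|nh] := pselect (0 <= t0 /\ (C0 r x0 /\ MD D d)); last first.
    by exists (fun=> 0) => h1 h2 h3; exfalso; apply: nh; split.
  have [Dd _ _] := Md.
  have [K K0 HK] := decay _ (snorm_ge0 r x0).
  have apriori : forall T x, is_solution r F t0 x0 d T x -> forall t : R, t0 <= t -> (t%:E < T)%E ->
      enorm (x t) <= K * snorm r x0.
    move=> T x solx t t0t tT.
    have h := HK t0 x0 d T x t00 cx0 (lexx _) Dd solx t t0t tT.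
    have h1 := enorm0_le_snorm r0 (solution_hist_C0 solx t0t tT).
    move: h1; rewrite /hist addr0 => /le_trans; apply; apply: (le_trans h).
    rewrite ler_wpM2r ?snorm_ge0// ler_piMr// -[leRHS]expR0 ler_expR.
    by rewrite oppr_le0 mulr_ge0 ?(ltW s0)// subr_ge0.
  by have [X HX] := global_solution r_gt0 cF lipF bF t00 cx0 Md apriori; exists X.
have [X HX] := choice sol.
pose Xf t0 x0 d := X (t0, x0, d).
have Xsol t0 x0 d : 0 <= t0 -> C0 r x0 -> MD D d ->
    is_maximal_solution r F t0 x0 d +oo%E (Xf t0 x0 d).
  by move=> h1 h2 h3; exact: (HX (t0, x0, d) h1 h2 h3).
have Xdec S : 0 <= S -> exists2 K, 0 <= K & forall t0 x0 d, 0 <= t0 -> C0 r x0 ->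
     snorm r x0 <= S -> MD D d -> forall t : R, t0 <= t ->
       snorm r (hist t (Xf t0 x0 d)) <= K * expR (- (sigma * (t - t0))) * snorm r x0.
  move=> S0; have [K K0 HK] := decay S S0; exists K => // t0 x0 d t00 cx0 xS Md t t0t.
  have [Dd _ _] := Md; have [solX _] := Xsol t0 x0 d t00 cx0 Md.
  by apply: (HK t0 x0 d +oo%E (Xf t0 x0 d) t00 cx0 xS Dd solX t t0t); rewrite ltry.
have Xbnd S : 0 <= S -> exists2 K, 0 <= K & forall t0 x0 d, 0 <= t0 -> C0 r x0 ->
     snorm r x0 <= S -> MD D d -> forall t : R, t0 <= t ->
       snorm r (hist t (Xf t0 x0 d)) <= K * snorm r x0.
  move=> S0; have [K K0 HK] := Xdec S S0; exists K => // t0 x0 d t00 cx0 xS Md t t0t.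
  apply: (le_trans (HK _ _ _ t00 cx0 xS Md _ t0t)).
  rewrite ler_wpM2r ?snorm_ge0// ler_piMr// -[leRHS]expR0 ler_expR.
  by rewrite oppr_le0 mulr_ge0 ?(ltW s0)// subr_ge0.
have fin (S : set R) (B : R) : (forall q, S q -> q <= B) -> finite_sup S.
  move=> H; rewrite /finite_sup; apply: (@le_lt_trans _ _ B%:E); last exact: ltry.
  by apply: ge_ereal_sup => _ [q Sq <-]; rewrite lee_fin; exact: H.
exists Xf; split.
- exact: Xsol.
- move=> s T s00 T0; have [K K0 HK] := Xbnd s s00.
  apply: (fin _ (K * s)) => _ [xi [t0 [x0 [d [/andP[xi0 _] [cx0 xs] /andP[t00 _] Md ->]]]]].
  apply: (le_trans (HK _ _ _ t00 cx0 xs Md _ _)); first by rewrite lerDl.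
  by rewrite ler_wpM2l.
- move=> e e0; split.
    have [K K0 HK] := Xbnd e (ltW e0).
    apply: (fin _ (K * e)) => _ [t [t0 [x0 [d [t0t [cx0 xs] t00 Md ->]]]]].
    by apply: (le_trans (HK _ _ _ t00 cx0 xs Md _ t0t)); rewrite ler_wpM2l.
  have [K K0 HK] := Xbnd 1 ler01.
  have K1 : 0 < K + 1 by lra.
  exists (Num.min 1 (e / (K + 1))); first by rewrite lt_min ltr01 divr_gt0.
  move=> t0 x0 d t00 cx0; rewrite le_min => /andP[x1 xe] Md t t0t.
  apply: (le_trans (HK _ _ _ t00 cx0 x1 Md _ t0t)).
  by move: xe; rewrite ler_pdivlMr// => /(le_trans _); apply; rewrite [leLHS]mulrC ler_wpM2l ?snorm_ge0// lerDl.
- move=> e M e0 M0; have [K K0 HK] := Xdec M M0.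
  have KM1 : 0 < K * M + 1 by rewrite ltr_wpDl// mulr_ge0.
  pose tau := (K * M + 1) / e / sigma.
  exists tau; first by rewrite /tau !divr_ge0// ?(ltW KM1)// ltW.
  move=> t0 x0 d t00 cx0 xM Md t tt.
  have tau0 : 0 <= tau by rewrite /tau !divr_ge0// ?(ltW KM1)// ltW.
  have t0t : t0 <= t by apply: le_trans tt; rewrite lerDl.
  apply: (le_trans (HK _ _ _ t00 cx0 xM Md _ t0t)).
  rewrite expRN.
  have h1 : (K * M + 1) / e <= expR (sigma * (t - t0)).
    have h2 : (K * M + 1) / e <= sigma * (t - t0).
      have -> : (K * M + 1) / e = sigma * tau by rewrite /tau; field; rewrite !gt_eqF.
      by rewrite ler_wpM2l ?(ltW s0)// lerBrDl.
    by apply: (le_trans h2); apply: le_trans (expR_ge1Dx _); rewrite lerDr.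
  apply: (@le_trans _ _ (K * M / expR (sigma * (t - t0)))).
    by rewrite mulrAC ler_wpM2r ?invr_ge0 ?expR_ge0// ler_wpM2l.
  rewrite ler_pdivrMr ?expR_gt0//.
  by move: h1; rewrite ler_pdivrMr// (mulrC (expR _)) => /(le_trans _); apply; rewrite lerDl.
Qed.

End Decay.

(** * Comparison functions *)

Section ComparisonFunctions.
Context {R : realType}.

(** Sampling at integers is enough: on [k, k+1[ the function is at most b (k+1), and
    [smooth_domination] compares the index k+1 with s + 1. *)
Lemma monotone_domination (b : R -> R) : nondecreasing_Rplus b ->
  exists h : nat -> R -> R,
  [/\ derivative_tower h, (forall s : R, 0 <= s -> 1 <= h 0%N s),
      (forall s t : R, 0 <= s -> s <= t -> h 0%N s <= h 0%N t)
    & forall s : R, 0 <= s -> b s <= h 0%N s].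
Proof.
move=> bM; have [h [h1 h2 h3 h4]] := smooth_domination (fun k => b k%:R).
exists h; split => // s s0.
apply: (@le_trans _ _ (b (Num.truncn s).+1%:R)); first by rewrite bM// ltW// truncnS_gt.
by apply: h4 => //; rewrite -natr1 lerD2r; have /andP[] := truncn_itv s0.
Qed.

Lemma derivative_tower_continuous h k : derivative_tower h -> continuous (h k : R -> R).
Proof.
move=> H x; apply: differentiable_continuous; apply/derivable1_diffP.
by have [] := H k x.
Qed.

Lemma Kinfty_upper (b : R -> R) : nondecreasing_Rplus b ->
  exists2 a, Kinfty a & forall s : R, 0 <= s -> s * b s <= a s.
Proof.
move=> /monotone_domination[h [hT h1 hM hb]].
exists (fun s => s * h 0%N s); last by move=> s s0; rewrite ler_wpM2l ?hb.
split.
- split; first by rewrite mul0r.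
  by move=> s s0; rewrite mulr_gt0// (lt_le_trans ltr01)// h1// ltW.
- move=> s t s0 st; apply: (@le_lt_trans _ _ (s * h 0%N t)).
    by rewrite ler_wpM2l// hM// ltW.
  by rewrite ltr_pM2r// (lt_le_trans ltr01)// h1// (le_trans s0)// ltW.
- by apply: continuous_withinT => s; apply: cvgM; [exact: cvg_id|exact: derivative_tower_continuous].
- apply/cvgryPge => A; near=> s.
  have s0 : 0 <= s by near: s; apply: nbhs_pinfty_ge; exact: num_real.
  apply: (@le_trans _ _ s); first by near: s; apply: nbhs_pinfty_ge; exact: num_real.
  by rewrite ler_peMr// h1.
Unshelve. all: by end_near. Qed.

(* A substitute for the inverse of [c], which is neither assumed to be continuous
   away from [0] nor strictly increasing: the infimal convolution
   [inf_y (y + max 0 (s - c y))] is 1-Lipschitz and at most [y] on [[0, c y]],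
   and the factor [1 - exp(-s)] makes it strictly increasing. *)
Lemma Kinfty_lower (c : R -> R) : nondecreasing_Rplus c ->
  (forall e : R, 0 < e -> exists2 d, 0 < d & c d <= e) ->
  exists2 a, Kinfty a & forall s y : R, 0 <= s -> 0 <= y -> s <= c y -> a s <= y.
Proof.
move=> cM c0.
pose F (s y : R) := y + Num.max 0 (s - c y).
pose a0 (s : R) := inf [set F s y | y in [set y | 0 <= y]].
have nE (s : R) : [set F s y | y in [set y | 0 <= y]] !=set0 by exists (F s 0); exists 0 => /=.
have max0 (s y : R) : 0 <= Num.max 0 (s - c y) by rewrite le_max lexx.
have lbF (s : R) : has_lbound [set F s y | y in [set y | 0 <= y]].
  by exists 0 => _ [y /= y0 <-]; rewrite addr_ge0.
have le_F (s y : R) : 0 <= y -> a0 s <= F s y.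
  by move=> y0; apply: ge_inf => //; exists y.
have ge_F (s z : R) : (forall y : R, 0 <= y -> z <= F s y) -> z <= a0 s.
  by move=> H; apply: lb_le_inf => // _ [y /= y0 <-]; exact: H.
have a0_ge0 s : 0 <= a0 s by apply: ge_F => y y0; rewrite addr_ge0.
have a0_mono (s t : R) : s <= t -> a0 s <= a0 t.
  move=> st; apply: ge_F => y y0; apply: (le_trans (le_F s y y0)).
  by rewrite lerD2l ge_max max0 le_max orbC lerD2r st.
have a0_lip (s t : R) : s <= t -> a0 t <= a0 s + (t - s).
  move=> st; rewrite -lerBlDr; apply: ge_F => y y0; rewrite lerBlDr.
  apply: (le_trans (le_F t y y0)); rewrite -addrA lerD2l ge_max.
  rewrite addr_ge0// ?subr_ge0//=.
  have : s - c y <= Num.max 0 (s - c y) by rewrite le_max lexx orbT.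
  by set m := Num.max _ _; move: m => m; clear; lra.
have a0_pos (s : R) : 0 < s -> 0 < a0 s.
  move=> s0; have [d d0 cd] := c0 (s / 2) (divr_gt0 s0 (ltr0n _ 2)).
  apply: (@lt_le_trans _ _ (Num.min d (s / 2))); first by rewrite lt_min d0 divr_gt0.
  apply: ge_F => y y0; have [dy|yd] := leP d y.
    by apply: (@le_trans _ _ d); [rewrite ge_min lexx|rewrite -[leLHS]addr0 lerD].
  apply: (@le_trans _ _ (s / 2)); first by rewrite ge_min lexx orbT.
  apply: (@le_trans _ _ (Num.max 0 (s - c y))); last by rewrite lerDr.
  have := cM y d y0 (ltW yd); rewrite le_max => cyd; apply/orP; right.
  by move: cyd cd; clear; lra.
have a0_big (M s : R) : 0 <= M -> M + c M <= s -> M <= a0 s.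
  move=> M0 Ms; apply: ge_F => y y0; have [My|yM] := leP M y.
    by rewrite -[leLHS]addr0 lerD.
  apply: (@le_trans _ _ (Num.max 0 (s - c y))); last by rewrite lerDr.
  have := cM y M y0 (ltW yM); rewrite le_max => cyd; apply/orP; right.
  by move: cyd Ms; clear; lra.
have ca0 : continuous a0.
  move=> s; apply/cvgrPdist_lt => e e0; near=> t.
  have st : `|s - t| < e by near: t; exact: cvgr_dist_lt.
  apply: le_lt_trans st; have [h|/ltW h] := leP s t.
    by rewrite distrC ger0_norm ?subr_ge0 ?a0_mono// distrC ger0_norm ?subr_ge0// lerBlDl a0_lip.
  by rewrite !ger0_norm ?subr_ge0 ?a0_mono// lerBlDl a0_lip.
pose w (s : R) := 1 - expR (- s).
have w_mono (s t : R) : s < t -> w s < w t by move=> st; rewrite ltrD2l ltrN2 ltr_expR ltrN2.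
have w_le1 s : w s <= 1 by rewrite gerBl expR_ge0.
have w0 : w 0 = 0 by rewrite /w oppr0 expR0 subrr.
have w_ge0 (s : R) : 0 <= s -> 0 <= w s.
  by rewrite le_eqVlt => /orP[/eqP<-|/w_mono]; rewrite w0// => /ltW.
have w_half (s : R) : 1 <= s -> 2^-1 <= w s.
  move=> s1; have : expR (- s) <= 2^-1.
    rewrite expRN lef_pV2 ?posrE ?expR_gt0//; apply: le_trans (expR_ge1Dx s).
    by move: s1; clear; lra.
  by rewrite /w; clear; set q := expR _; lra.
exists (fun s => a0 s * w s); last first.
  move=> s y s0 y0 sy; apply: (@le_trans _ _ (a0 s)); first by rewrite ler_piMr.
  apply: (le_trans (le_F s y y0)); rewrite /F max_l ?addr0//.
  by rewrite subr_le0.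
split.
- split; first by rewrite w0 mulr0.
  by move=> s s0; rewrite mulr_gt0 ?a0_pos// -w0 w_mono.
- move=> s t s0 st; apply: (@le_lt_trans _ _ (a0 t * w s)).
    by rewrite ler_wpM2r ?w_ge0// a0_mono// ltW.
  by rewrite ltr_pM2l ?w_mono// a0_pos// (le_lt_trans s0).
- apply: continuous_withinT => s; apply: cvgM; first exact: ca0.
  apply: cvgB; first exact: cvg_cst.
  apply: (@cvg_comp _ _ _ -%R expR); first exact: cvgN cvg_id.
  exact: continuous_expR.
- apply/cvgryPge => A; pose M := 2 * `|A|.
  have M0 : 0 <= M by rewrite mulr_ge0.
  near=> s.
  have s1 : 1 <= s by near: s; apply: nbhs_pinfty_ge; exact: num_real.
  have Ms : M + c M <= s by near: s; apply: nbhs_pinfty_ge; exact: num_real.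
  apply: (@le_trans _ _ (M * 2^-1)).
    by rewrite /M mulrAC divff ?mul1r ?ler_norm.
  by apply: ler_pM => //; [exact: a0_big|exact: w_half].
Unshelve. all: by end_near. Qed.

End ComparisonFunctions.

(** * The control Lyapunov functional *)

Section StateBounds.
Context {R : realType} (h : nat -> R -> R) (n : nat).
Hypothesis h_ge1 : forall j (s : R), 0 <= s -> 1 <= h j s.
Hypothesis h_mono : forall j (s t : R), 0 <= s -> s <= t -> h j s <= h j t.

Lemma enorm_le_error_sqr (x : 'rV[R]_n.+1) q : 0 <= q -> error_sqr h n x <= q ^+ 2 ->
  enorm x <= q * state_gain h n q.
Proof.
move=> q0 xq; rewrite -{1}(initial_id x); apply: enorm_le_state_gain => // j jn.
rewrite -(@ler_pXn2r _ 2)// ?nnegrE// real_normK ?num_real//.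
by apply: le_trans xq; exact: error_coord_le_sqr.
Qed.

Definition sqr_gain (s : R) := \sum_(j < n.+1) error_gain h j s ^+ 2.

Lemma sqr_gain_ge0 s : 0 <= sqr_gain s.
Proof. by apply: sumr_ge0 => j _; exact: sqr_ge0. Qed.

Lemma sqr_gain_mono : nondecreasing_Rplus sqr_gain.
Proof.
move=> s t s0 st; apply: ler_sum => j _.
have g1 := error_gain_ge1 h_ge1 j s; have g2 := error_gain_mono h_ge1 h_mono j s0 st.
rewrite ler_pXn2r ?nnegrE//; first exact: le_trans ler01 g1.
exact: le_trans ler01 (le_trans g1 g2).
Qed.

Lemma error_sqr_le_gain (x : 'rV[R]_n.+1) s : enorm x <= s ->
  error_sqr h n x <= s ^+ 2 * sqr_gain s.
Proof.
move=> xs; have s0 : 0 <= s by exact: le_trans (enorm_ge0 x) xs.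
rewrite /sqr_gain mulr_sumr; apply: ler_sum => j _; rewrite -exprMn.
have g1 := error_gain_ge1 h_ge1 j s.
rewrite -real_normK ?num_real// ler_pXn2r ?nnegrE//; last first.
  by rewrite mulr_ge0// (le_trans ler01).
by apply: error_coord_le_gain => //; apply: le_trans xs; exact: enorm_initial.
Qed.

End StateBounds.

Section Auxiliary.
Context {R : realType}.

Lemma initialC_id m (x : R -> 'rV[R]_m) : initialC m x = x.
Proof. by apply/funext => th; exact: initial_id. Qed.

(** The distance to [k] is convex in the input, so a convex combination can be replaced by the
    farthest of the [u i]; this produces the maximum of Psi in the decrease condition. *)
Lemma convex_combination_dist (N : nat) (u lambda : 'I_N -> R) (k : R) :
  (forall i, 0 <= lambda i <= 1) -> \sum_(i < N) lambda i = 1 ->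
  exists i, `|\sum_(i < N) lambda i * u i - k| <= `|u i - k|.
Proof.
case: N u lambda => [|N] u lambda l01 l1.
  by move: l1; rewrite big_ord0 => /eqP; rewrite eq_sym oner_eq0.
pose i := [arg max_(i > ord0 : 'I_N.+1) `|u i - k|]%O; exists i.
have imax j : `|u j - k| <= `|u i - k|.
  by rewrite /i; case: arg_maxP => // j' _ H; exact: H.
rewrite -[k in X in X <= _]mul1r -{1}l1 mulr_suml -sumrB.
apply: (le_trans (ler_norm_sum _ _ _)).
rewrite -[leRHS]mul1r -[X in _ <= X * _]l1 mulr_suml; apply: ler_sum => j _.
have /andP[l0 _] := l01 j.
by rewrite -mulrBr normrM (ger0_norm l0) ler_wpM2l.
Qed.

Lemma continuous_lt_enorm (m : nat) (F : 'rV[R]_m -> R) x (c : R) : {for x, continuous F} ->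
  F x < c -> exists2 d : R, 0 < d & forall y, enorm (y - x) < d -> F y < c.
Proof.
move=> /cvgrPdist_lt cF; rewrite -subr_gt0 => /cF/nbhs_ballP[d /= d0 Hd].
exists d => // y yd.
have : `|F x - F y| < c - F x.
  apply: Hd; rewrite -ball_normE /ball_/= distrC.
  exact: le_lt_trans (norm_le_enorm _) yd.
by rewrite distrC => /(le_lt_trans (ler_norm _)); rewrite ltrD2r.
Qed.

End Auxiliary.

Section ControlLyapunov.
Context {R : realType} (r sigma : R) (n l : nat) (D : set 'rV[R]_l)
  (f g : forall i : nat, R -> 'rV[R]_l -> (R -> 'rV[R]_i.+1) -> R)
  (varphi : R -> R) (hh : nat -> nat -> R -> R).
Arguments f : clear implicits.
Arguments g : clear implicits.
Local Notation h := (fun i => hh i 0%N).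
Local Notation W := (@error_sqr R n.+1 h n).
Local Notation V := (weighted_max r sigma W).
Local Notation kn := (@virtual_control R n.+1 h n).
Hypotheses (r_gt0 : 0 < r) (sigma_gt0 : 0 < sigma) (ad : admissible hh)
  (varphi_mono : nondecreasing_Rplus varphi)
  (g_bound : forall (t : R) (x : R -> 'rV[R]_n.+1) d, 0 <= t -> C0 r x -> D d ->
    1 / varphi (snorm r x) <= g n t d x <= varphi (snorm r x))
  (varphi_gt0 : forall s : R, 0 <= s -> 0 < varphi s)
  (decay : razumikhin_decay r sigma D (closed_loop (n := n) f g kn) W).

Let r_ge0 : 0 <= r. Proof. exact: ltW. Qed.
Let sigma_ge0 : 0 <= sigma. Proof. exact: ltW. Qed.
Let hT i : derivative_tower (hh i). Proof. by have [] := ad. Qed.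
Let h_ge1 i (s : R) : 0 <= s -> 1 <= h i s. Proof. by have [_ H _] := ad; exact: H. Qed.
Let h_mono i (s t : R) : 0 <= s -> s <= t -> h i s <= h i t.
Proof. by have [_ _ H] := ad; exact: H. Qed.
Let nW : nice W. Proof. exact: nice_error_sqr. Qed.
Let W_ge0 x : 0 <= W x. Proof. exact: error_sqr_ge0. Qed.

Let V_ge0 x : C0 r x -> 0 <= V x.
Proof. by move=> cx; apply: le_trans (weighted_max_ge_present sigma r_ge0 nW cx). Qed.

Lemma error_sqr_le_weighted_max x (th : R) : C0 r x -> - r <= th <= 0 ->
  W (x th) <= expR (2 * sigma * r) * V x.
Proof.
move=> cx thr; have := weighted_max_ge sigma r_ge0 nW cx thr.
rewrite -(ler_pM2l (expR_gt0 (- (2 * sigma * th)))) mulrA -expRD addNr expR0 mul1r.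
move=> /le_trans; apply; rewrite ler_wpM2r ?V_ge0// ler_expR -mulrN ler_wpM2l ?mulr_ge0//.
by rewrite lerNl; have /andP[] := thr.
Qed.

Lemma almost_lipschitz_weighted_max : almost_lipschitz r (fun _ => V).
Proof.
have /choice[L HL] : forall k : nat, exists L : R, 0 <= L /\ forall x y, C0 r x -> C0 r y ->
    snorm r x <= k%:R -> snorm r y <= k%:R -> `|V y - V x| <= L * snorm r (y \- x).
  by move=> k; have [L L0 H] := weighted_max_lipschitz k%:R r_ge0 sigma_ge0 nW; exists L.
(* Summation over integer radii makes the Lipschitz constant a nondecreasing function of the
   radius. *)
pose LL (s : R) := \sum_(k < (Num.truncn s).+2) L k.
have LLb (M : R) x y : 0 <= M -> C0 r x -> C0 r y -> snorm r x <= M -> snorm r y <= M ->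
    `|V y - V x| <= LL M * snorm r (y \- x).
  move=> M0 cx cy xM yM; have Mk : M <= (Num.truncn M).+1%:R by rewrite ltW// truncnS_gt.
  have [_ H] := HL (Num.truncn M).+1.
  apply: (le_trans (H x y cx cy (le_trans xM Mk) (le_trans yM Mk))).
  rewrite ler_wpM2r ?snorm_ge0// /LL big_ord_recr/= lerDr.
  by apply: sumr_ge0 => k _; have [] := HL k.
have LL0 s : 0 <= LL s by apply: sumr_ge0 => k _; have [] := HL k.
split.
- move=> t x _ cx e e0; pose B := snorm r x + 1.
  have B0 : 0 <= B by rewrite addr_ge0 ?snorm_ge0.
  have L1 : 0 < LL B + 1 by rewrite ltr_wpDl.
  exists (Num.min 1 (e / (LL B + 1))); first by rewrite lt_min ltr01 divr_gt0.
  move=> t' y _ cy _; rewrite lt_min => /andP[y1 ye].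
  have yB : snorm r y <= B.
    have -> : y = x \+ (y \- x) by apply/funext => s /=; rewrite addrC subrK.
    apply: (le_trans (ler_snormD r_ge0 cx (C0B cy cx))); rewrite lerD2l; exact: ltW.
  have xB : snorm r x <= B by rewrite lerDl.
  apply: (le_lt_trans (LLb B x y B0 cx cy xB yB)).
  apply: (@le_lt_trans _ _ ((LL B + 1) * snorm r (y \- x))).
    by rewrite ler_wpM2r ?snorm_ge0// lerDl.
  by rewrite mulrC -ltr_pdivlMr.
- by move=> t x _; exact: V_ge0.
exists LL, (fun=> 0), (fun=> 1); split.
- split=> // s t s0 st; rewrite /LL.
  have st' : ((Num.truncn s).+2 <= (Num.truncn t).+2)%N by rewrite !ltnS; apply: le_truncn.
  rewrite -(subnKC st') big_split_ord/= lerDl.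
  by apply: sumr_ge0 => k _; have [] := HL ((Num.truncn s).+2 + k)%N.
- by move=> s s0; split.
- by move=> M M0 t x y _; exact: LLb.
- by move=> M M0 x _ _ _ b t s _ _; rewrite subrr normr0 mulr0 mul0r.
Qed.

(** A bound on the history norm at level y of the functional. It is used with y = V x for the lower
    comparison function, and with y = W (x 0) when the maximum is attained at 0. *)
Definition history_bound (y : R) : R :=
  let q := Num.sqrt (expR (2 * sigma * r) * y) in q * state_gain h n q.

Lemma history_bound_mono : nondecreasing_Rplus history_bound.
Proof.
move=> s t s0 st; rewrite /history_bound; apply: ler_pM; first exact: sqrtr_ge0.
- exact: le_trans ler01 (state_gain_ge1 h_ge1 n _).
- by rewrite ler_wsqrtr// ler_wpM2l// expR_ge0.
- by apply: state_gain_mono => //; rewrite ler_wsqrtr// ler_wpM2l// expR_ge0.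
Qed.

Lemma history_bound_ge0 y : 0 <= history_bound y.
Proof. by rewrite mulr_ge0 ?sqrtr_ge0// (le_trans ler01)//; exact: state_gain_ge1. Qed.

(** Near 0 the state gain is at most its value at 1, so the bound is of the order of a square root.
    Beside monotonicity, this is all that [Kinfty_lower] asks for. *)
Lemma history_bound_small (e : R) : 0 < e -> exists2 d, 0 < d & history_bound d <= e.
Proof.
move=> e0; set G := state_gain h n 1; have G_gt0 : 0 < G := lt_le_trans ltr01 (state_gain_ge1 h_ge1 n 1).
have E0 : 0 < expR (2 * sigma * r) by exact: expR_gt0.
pose p := Num.min 1 (e / G); have p0 : 0 < p by rewrite lt_min ltr01 divr_gt0.
exists (p ^+ 2 / expR (2 * sigma * r)); first by rewrite divr_gt0// exprn_gt0.
rewrite /history_bound (mulrC (expR _)) divfK ?gt_eqF// sqrtr_sqr gtr0_norm//.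
apply: (@le_trans _ _ (p * G)).
  by rewrite ler_wpM2l ?(ltW p0)//; apply: state_gain_mono => //; [exact: ltW|rewrite ge_min lexx].
by rewrite -ler_pdivlMr// ge_min lexx orbT.
Qed.

Lemma snorm_le_history_bound x y : 0 <= y ->
  (forall th : R, - r <= th <= 0 -> W (x th) <= expR (2 * sigma * r) * y) ->
  snorm r x <= history_bound y.
Proof.
move=> y0 H; apply: snorm_le => // th thr; apply: enorm_le_error_sqr => //.
by rewrite sqr_sqrtr ?H// mulr_ge0// expR_ge0.
Qed.

Lemma SRCLF_bounds_weighted_max : SRCLF_bounds r (fun _ => V).
Proof.
have [a1 Ka1 Ha1] := Kinfty_lower history_bound_mono history_bound_small.
have bM : nondecreasing_Rplus (fun s => s * sqr_gain h n s).
  move=> s t s0 st; apply: ler_pM => //; first exact: sqr_gain_ge0.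
  exact: sqr_gain_mono.
have [a2 Ka2 Ha2] := Kinfty_upper bM.
have K1 : Kplus (fun=> 1 : R) by split=> //; apply: continuous_withinT => s; exact: cvg_cst.
exists a1, a2, (fun=> 1), (fun=> 1); split => // t x _ cx; rewrite mul1r maxxx; split.
  apply: Ha1; rewrite ?snorm_ge0 ?V_ge0//.
  by apply: snorm_le_history_bound => [|th]; [exact: V_ge0|exact: error_sqr_le_weighted_max].
apply: le_trans (Ha2 _ (snorm_ge0 r x)); rewrite mulrA -expr2.
apply: weighted_max_le => // th thr.
apply: (@le_trans _ _ (W (x th))).
  rewrite ler_piMl// -[leRHS]expR0 ler_expR mulr_ge0_le0// ?mulr_ge0//.
  by have /andP[] := thr.
by apply: error_sqr_le_gain => //; exact: enorm_le_snorm.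
Qed.

(** Among the error coordinates only the last one depends on the last component of the state, with
    derivative 1. *)
Lemma diff_error_sqr_last (x w : 'rV[R]_n.+1) : initial n w = 0 ->
  'd W x w = 2 * (error_coord h n x * entry w n).
Proof.
move=> w0.
have dz j : (j <= n)%N -> 'd (error_coord h j) x w = entry w j.
  move=> jn; have [L _ HL] := error_coord_diff_bound n.+1 j (enorm (initial j x)) hT.
  have := HL x w (lexx _); rewrite -(initial_initial w jn) w0.
  have -> : initial j (0 : 'rV[R]_n) = 0 by apply/rowP => i; rewrite !mxE entry0.
  by rewrite enorm0 mulr0 normr_le0 subr_eq0 => /eqP.
rewrite (diff_error_sqr n x w hT) big_ord_recr/= big1 ?add0r ?dz// => j _.
have jn := ltn_ord j; rewrite dz ?(ltnW jn)//.
by rewrite -(entry_initial _ jn) w0 entry0 !mulr0.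
Qed.

Lemma triangular_input (t : R) d (x : R -> 'rV[R]_n.+1) (u u' : R) :
  let w := triangular f g t d x u - triangular f g t d x u' in
  initial n w = 0 /\ entry w n = g n t d x * (u - u').
Proof.
move=> w; split.
  apply/rowP => i; rewrite !mxE (entryE _ (ltnW (ltn_ord i) : (i < n.+1)%N)) !mxE /=.
  by rewrite ltn_ord subrr.
rewrite (entryE _ (ltnSn n)) !mxE /= ltnn initialC_id.
by rewrite mulrBr opprD addrACA subrr add0r.
Qed.

(* The present state [x 0] determines the size of the history whenever the
   maximum defining [V] is attained at [theta = 0], so the input gain
   [2 |z_n| g_n] is bounded by a function of [x 0] alone. *)
Lemma SRCLF_small_control_weighted_max :
  SRCLF_small_control r D (triangular f g) (fun _ => V).
Proof.
split; [exact: almost_lipschitz_weighted_max|exact: SRCLF_bounds_weighted_max|].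
have vM : nondecreasing_Rplus (fun y => 2 * varphi (history_bound y)).
  by move=> s t s0 st; rewrite ler_pM2l// varphi_mono ?history_bound_ge0// history_bound_mono.
have [H [HT H1 _ Hv]] := monotone_domination vM.
have H0 x : 0 <= H 0%N (W x) by exact: le_trans ler01 (H1 _ (W_ge0 x)).
(* This is Psi: the input changes the derivative of [W] by 2 z_n g_n (u - k_n), and [H] bounds 2
   g_n. It vanishes at u = k_n, so q = 0 is admissible and k_n serves as the small control. *)
pose P (phi : 'rV[R]_n.+1) u := H 0%N (W phi) * `|error_coord h n phi| * `|u - kn phi|.
pose rho (s : R) := 2 * sigma * s.
exists n.+1, (fun _ phi u => (P phi u)%:E), (fun=> 0), (fun _ x => x 0), rho.
have Pkn phi : P phi (kn phi) = 0 by rewrite /P subrr normr0 mulr0.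
split=> //; last first.
  have bM : nondecreasing_Rplus (fun s => h n (s ^+ 2) * error_gain h n s).
    move=> s t s0 st; apply: ler_pM.
    - by apply: le_trans ler01 (h_ge1 _ (sqr_ge0 s)).
    - exact: le_trans ler01 (error_gain_ge1 h_ge1 n s).
    - apply: h_mono; first exact: sqr_ge0.
      by rewrite ler_pXn2r ?nnegrE//; exact: le_trans st.
    - exact: (error_gain_mono h_ge1 h_mono n s0 st).
  have [a Ka Ha] := Kinfty_upper bM.
  exists a, (fun=> 1); split => //.
    by split=> //; apply: continuous_withinT => s; exact: cvg_cst.
  move=> t phi _; exists (kn phi); rewrite Pkn; split => //.
  rewrite mul1r; apply: le_trans (Ha _ (enorm_ge0 phi)).
  rewrite virtual_controlE normrM normrN.
  have sp : sqi n.+1 phi = enorm phi ^+ 2 by rewrite sqi_enorm initial_id.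
  have hp : 0 <= h n (enorm phi ^+ 2) by exact: le_trans ler01 (h_ge1 n (sqr_ge0 (enorm phi))).
  have zb : `|error_coord h n phi| <= enorm phi * error_gain h n (enorm phi).
    by apply: error_coord_le_gain; rewrite ?enorm_ge0// initial_id.
  by rewrite sp (ger0_norm hp) (le_trans (ler_wpM2l hp zb))// mulrCA.
split.
- split=> // [t _|u t phi _ b].
    by rewrite /P error_coord0 normr0 mulr0 mul0r.
  rewrite lte_fin => Pb.
  have cP : {for phi, continuous (fun phi => P phi u)}.
    have cn (F : 'rV[R]_n.+1 -> R) : nice F -> {for phi, continuous (fun x => `|F x|)}.
      move=> nF; apply: (@continuous_comp _ _ _ F (fun y => `|y|)).
        exact: nice_continuous.
      exact: norm_continuous.
    rewrite /P /=; apply: continuousM; first apply: continuousM.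
    - exact: (nice_continuous (nice_comp 0 HT nW)).
    - exact: cn (nice_error_coord n.+1 n hT).
    - exact: cn (nice_add (nice_cst u) (nice_opp (nice_virtual_control n.+1 n hT))).
  have [d d0 Hd] := continuous_lt_enorm cP Pb.
  by exists d => // t' phi' _ _ /Hd; rewrite lte_fin.
- split=> //; first by apply: continuous_withinT => s; exact: cvg_cst.
    by rewrite integral0 ltry.
  exact: cvg_cst.
- split=> //.
    move=> t x _ cx e e0; exists e => // t' y _ cy _; apply: le_lt_trans.
    by apply: (le_trans (norm_le_enorm _)); exact: (enorm0_le_snorm r_ge0 (C0B cy cx)).
  move=> S [S1 _ _]; rewrite /finite_sup; apply: (@le_lt_trans _ _ 1%:E); last exact: ltry.
  apply: ge_ereal_sup => _ [_ [t [x [y [Sx Sy xy ->]]]] <-].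
  have [_ /= cx] := S1 _ Sx; have [_ /= cy] := S1 _ Sy.
  rewrite lee_fin ler_pdivrMr// mul1r.
  by apply: (le_trans (norm_le_enorm _)); exact: (enorm0_le_snorm r_ge0 (C0B cx cy)).
- split; first by apply: continuous_withinT => s; exact: mulrl_continuous.
  by split=> [|s s0]; rewrite /rho ?mulr0// !mulr_gt0.
- split=> [t phi _|N u lambda l01 l1 t x t0 cx].
    by rewrite -(Pkn phi); apply: ereal_inf_lbound; exists (kn phi).
  apply: ge_ereal_sup => _ [d Dd <-].
  set us := \sum_(i < N) _.
  have := @upper_deriv_weighted_max _ _ r sigma W t x (triangular f g t d x us) (P (x 0) us)
    r_gt0 sigma_gt0 nW W_ge0 cx.
  move=> /(_ _ _)/le_trans; apply.
  + by rewrite !mulr_ge0.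
  + move=> WV.
    have WE (th : R) : - r <= th <= 0 -> W (x th) <= expR (2 * sigma * r) * W (x 0).
      by move=> thr; rewrite WV; exact: error_sqr_le_weighted_max.
    have := decay t0 Dd cx _ => /(_ _)dc.
    pose w := triangular f g t d x us - closed_loop f g kn t d x.
    have [w0 wn] := triangular_input t d x us (kn (x 0)).
    have -> : triangular f g t d x us = closed_loop f g kn t d x + w by rewrite subrKC.
    (* The closed-loop part is handled by [decay]; the other part is the effect of the deviation of
       the input from k_n. *)
    rewrite linearD -WV; apply: lerD.
      apply: dc => th thr; apply: (le_trans (WE th thr)).
      by rewrite ler_wpM2r// ler_peMl ?expR_ge0// ler1n.
    rewrite diff_error_sqr_last// wn.
    have sx := snorm_le_history_bound (W_ge0 (x 0)) WE.
    have /andP[gl gu] := g_bound t0 cx Dd.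
    have g0 : 0 <= g n t d x.
      by apply: le_trans gl; rewrite div1r invr_ge0 ltW// varphi_gt0// snorm_ge0.
    have gH : 2 * g n t d x <= H 0%N (W (x 0)).
      apply: le_trans (Hv _ (W_ge0 _)); rewrite ler_pM2l//.
      by apply: (le_trans gu); apply: varphi_mono; rewrite ?snorm_ge0.
    apply: (le_trans (ler_norm _)); rewrite !normrM (ger0_norm g0) ger0_norm//.
    have -> : 2 * (`|error_coord h n (x 0)| * (g n t d x * `|us - kn (x 0)|)) =
       2 * g n t d x * (`|error_coord h n (x 0)| * `|us - kn (x 0)|) by ring.
    by rewrite /P -[leRHS]mulrA ler_wpM2r// mulr_ge0.
  + rewrite EFinD; apply: leeD => //.
    have [i Hi] := convex_combination_dist u (kn (x 0)) l01 l1.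
    apply: (@le_trans _ _ (P (x 0) (u i))%:E).
      by rewrite lee_fin ler_wpM2l// mulr_ge0.
    exact: (le_bigmax (-oo)%E (fun i => (P (x 0) (u i))%:E) i).
Qed.

End ControlLyapunov.

(** * The closed loop *)

Section ContinuityOnC0.
Context {R : realType} (r : R) {Z : normedModType R} {m : nat} (A : set Z).
Implicit Types k : Z -> (R -> 'rV[R]_m) -> R.

Lemma continuous_on_C0D k k' : continuous_on_C0 r A k -> continuous_on_C0 r A k' ->
  continuous_on_C0 r A (fun z x => k z x + k' z x).
Proof.
move=> ck ck' z x Az cx e e0; have e2 : 0 < e / 2 by rewrite divr_gt0.
have [d d0 Hd] := ck z x Az cx _ e2; have [d' d'0 Hd'] := ck' z x Az cx _ e2.
exists (Num.min d d'); first by rewrite lt_min d0.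
move=> z' x' Az' cx'; rewrite !lt_min => /andP[z1 z2] /andP[x1 x2].
rewrite opprD addrACA (splitr e); apply: (le_lt_trans (ler_normD _ _)).
by apply: ltrD; [exact: Hd|exact: Hd'].
Qed.

Lemma continuous_on_C0M k k' : continuous_on_C0 r A k -> continuous_on_C0 r A k' ->
  continuous_on_C0 r A (fun z x => k z x * k' z x).
Proof.
move=> ck ck' z x Az cx e e0.
set a := k z x; set b := k' z x.
pose s := `|a| + `|b| + 1; have s0 : 0 < s by rewrite ltr_wpDl// addr_ge0.
pose eta := Num.min 1 (e / s).
have eta0 : 0 < eta by rewrite lt_min ltr01 divr_gt0.
have [d d0 Hd] := ck z x Az cx _ eta0; have [d' d'0 Hd'] := ck' z x Az cx _ eta0.
exists (Num.min d d'); first by rewrite lt_min d0.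
move=> z' x' Az' cx'; rewrite !lt_min => /andP[z1 z2] /andP[x1 x2].
have ha := Hd z' x' Az' cx' z1 x1; have hb := Hd' z' x' Az' cx' z2 x2.
set a' := k z' x' in ha *; set b' := k' z' x' in hb *.
have -> : a' * b' - a * b = (a' - a) * (b' - b) + ((a' - a) * b + a * (b' - b)) by ring.
have eta1 : eta <= 1 by rewrite ge_min lexx.
have etas : eta * s <= e by rewrite -ler_pdivlMr// ge_min lexx orbT.
apply: lt_le_trans etas.
have q1 : `|(a' - a) * (b' - b)| < eta.
  rewrite normrM; apply: (@le_lt_trans _ _ (`|a' - a| * 1)); last by rewrite mulr1.
  by rewrite ler_wpM2l// (le_trans (ltW hb)).
have q2 : `|(a' - a) * b| <= eta * `|b| by rewrite normrM ler_wpM2r// ltW.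
have q3 : `|a * (b' - b)| <= eta * `|a| by rewrite normrM mulrC ler_wpM2r// ltW.
apply: (le_lt_trans (ler_normD _ _)).
have -> : eta * s = eta + (eta * `|b| + eta * `|a|) by rewrite /s; ring.
by apply: ltr_leD => //; apply: (le_trans (ler_normD _ _)); exact: lerD.
Qed.

Lemma continuous_on_C0_initial i (k : Z -> (R -> 'rV[R]_i) -> R) : 0 <= r ->
  continuous_on_C0 r A k -> continuous_on_C0 r A (fun z (x : R -> 'rV[R]_m) => k z (initialC i x)).
Proof.
move=> r0 ck z x Az cx e e0; have [d d0 Hd] := ck z _ Az (C0_initial cx) e e0.
exists d => // z' x' Az' cx' zz xx; apply: (Hd z' _ Az' (C0_initial cx') zz).
apply: le_lt_trans xx.
have -> : initialC i x' \- initialC i x = initialC i (x' \- x).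
  by apply/funext => s; rewrite /initialC /= initialB.
exact: (snorm_initial i r0 (C0B cx' cx)).
Qed.

Lemma continuous_on_C0_present (F : 'rV[R]_m -> R) : 0 <= r -> nice F ->
  continuous_on_C0 r A (fun _ x => F (x 0)).
Proof.
move=> r0 nF z x _ cx e e0.
have [L L0 HL] := nice_lipschitz (enorm (x 0) + 1) nF.
have L1 : 0 < L + 1 by rewrite ltr_wpDl.
exists (Num.min 1 (e / (L + 1))); first by rewrite lt_min ltr01 divr_gt0.
move=> z' x' _ cx' _; rewrite lt_min => /andP[x1 xe].
have h := enorm0_le_snorm r0 (C0B cx' cx).
have b1 : enorm (x 0) <= enorm (x 0) + 1 by rewrite lerDl.
have b2 : enorm (x' 0) <= enorm (x 0) + 1.
  rewrite -(subrKC (x 0) (x' 0)); apply: (le_trans (ler_enormD _ _)).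
  by rewrite lerD2l (le_trans h)// ltW.
apply: (le_lt_trans (HL _ _ b2 b1)).
apply: (@le_lt_trans _ _ ((L + 1) * snorm r (x' \- x))).
  by apply: ler_pM; rewrite ?enorm_ge0// lerDl.
by rewrite mulrC -ltr_pdivlMr.
Qed.

Lemma uniform_positive (p : nat) (P : 'I_p -> R -> Prop) :
  (forall i (d d' : R), 0 < d' -> d' <= d -> P i d -> P i d') ->
  (forall i, exists2 d : R, 0 < d & P i d) -> exists2 d : R, 0 < d & forall i, P i d.
Proof.
move=> mono H; have /choice[d Hd] : forall i, exists d : R, 0 < d /\ P i d.
  by move=> i; have [d d0 Pd] := H i; exists d.
have d0 : 0 < \big[Num.min/1]_i d i by apply: lt_bigmin => // i _; have [] := Hd i.
exists (\big[Num.min/1]_i d i) => // i; have [_] := Hd i; apply: mono => //.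
exact: bigmin_le.
Qed.

End ContinuityOnC0.

Section ClosedLoop.
Context {R : realType} (n l : nat) (r : R) (D : set 'rV[R]_l)
  (f g : forall i : nat, R -> 'rV[R]_l -> (R -> 'rV[R]_i.+1) -> R)
  (varphi : R -> R)
  (r_gt0 : 0 < r)
  (D_compact : compact D)
  (f_cont : forall i, (i <= n)%N ->
    continuous_on_C0 r [set z : R * 'rV[R]_l | 0 <= z.1 /\ D z.2]
      (fun z => f i z.1 z.2))
  (g_cont : forall i, (i <= n)%N ->
    continuous_on_C0 r [set z : R * 'rV[R]_l | 0 <= z.1 /\ D z.2]
      (fun z => g i z.1 z.2))
  (f_zero : forall i, (i <= n)%N ->
    forall t d, 0 <= t -> D d -> f i t d (fun=> 0) = 0)
  (g_lip : forall i, (i <= n)%N ->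
    completely_locally_lipschitz r
      [set z : R * 'rV[R]_l | 0 <= z.1 /\ D z.2] (fun z => g i z.1 z.2))
  (varphi_mono : nondecreasing_Rplus varphi)
  (varphi_gt0 : forall s : R, 0 <= s -> 0 < varphi s)
  (g_bound : forall i, (i <= n)%N -> forall t x d, 0 <= t -> C0 r x -> D d ->
    1 / varphi (snorm r x) <= g i t d x <= varphi (snorm r x))
  (f_lip : forall i, (i <= n)%N -> forall S : set (R -> 'rV[R]_i.+1),
    bounded_C0 r S ->
    finite_sup [set q | exists t d x y,
       [/\ 0 <= t /\ D d, S x, S y, 0 < snorm r (x \- y) &
           q = `|f i t d x - f i t d y| / snorm r (x \- y)]])
  (kn : 'rV[R]_n.+1 -> R) (nice_kn : nice kn).

Arguments f : clear implicits.
Arguments g : clear implicits.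

Let r_ge0 : 0 <= r. Proof. exact: ltW. Qed.
Let F := closed_loop (n := n) f g kn.

Definition feedback i (x : 'rV[R]_n.+1) : R := if (i < n)%N then entry x i.+1 else kn x.

Lemma nice_feedback i : nice (feedback i).
Proof. by rewrite /feedback; case: ltnP => _ //; exact: nice_entry. Qed.

Lemma closed_loopE (t : R) d (x : R -> 'rV[R]_n.+1) (i : 'I_n.+1) :
  F t d x ord0 i = f i t d (initialC i.+1 x) + g i t d (initialC i.+1 x) * feedback i (x 0).
Proof. by rewrite /F /closed_loop /triangular mxE. Qed.

Lemma closed_loop_continuous : rhs_continuous r D F.
Proof.
move=> t w x t0 Dw cx e e0.
have e1 : 0 < e / n.+2%:R by rewrite divr_gt0// ltr0n.
have ci (i : 'I_n.+1) := continuous_on_C0D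
  (continuous_on_C0_initial (m := n.+1) r_ge0 (f_cont (leq_ord i)))
  (continuous_on_C0M (continuous_on_C0_initial (m := n.+1) r_ge0 (g_cont (leq_ord i)))
     (continuous_on_C0_present r_ge0 (nice_feedback i))).
have [d d0 Hd] : exists2 d : R, 0 < d & forall i, forall t' w' x', 0 <= t' -> D w' -> C0 r x' ->
    `|t' - t| < d -> `|w' - w| < d -> snorm r (x' \- x) < d ->
    `|F t' w' x' ord0 i - F t w x ord0 i| < e / n.+2%:R.
  apply: uniform_positive.
    move=> i d d' d'0 dd H t' w' x' t'0 Dw' cx' tt ww xx.
    by apply: H => //; exact: lt_le_trans dd.
  move=> i; have [d d0 Hd] := ci i (t, w) x (conj t0 Dw) cx _ e1.
  exists d => // t' w' x' t'0 Dw' cx' tt ww xx; rewrite !closed_loopE.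
  apply: (Hd (t', w') x' (conj t'0 Dw') cx') => //.
  by rewrite prod_normE/= gt_max tt ww.
exists d => // t' w' x' t'0 Dw' cx' tt ww xx.
apply: (@le_lt_trans _ _ (n.+1%:R * (e / n.+2%:R))).
  apply: enorm_le_bound => i; rewrite !mxE ltW//.
  by have := Hd i t' w' x' t'0 Dw' cx' tt ww xx; rewrite !mxE.
by rewrite mulrA ltr_pdivrMr ?ltr0n// mulrC ltr_pM2l// ltr_nat.
Qed.

Lemma closed_loop_locally_bounded : rhs_locally_bounded r D F.
Proof.
move=> T M; have M0 : 0 <= `|M| by [].
have /choice[B HB] : forall i : 'I_n.+1, exists B : R, forall t w x, 0 <= t <= T -> D w ->
    C0 r x -> snorm r x <= M -> `|F t w x ord0 i| <= B.
  move=> i; have [L L0 HL] := f_growth r_gt0 f_cont f_zero f_lip `|M| (leq_ord i).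
  have [N N1 HN] := g_range varphi_mono varphi_gt0 g_bound (leq_ord i) M0.
  have [K K0 HK] := nice_bounded `|M| (nice_feedback i).
  exists (L * `|M| + N * K) => t w x /andP[t0 _] Dw cx xM; rewrite closed_loopE.
  have {}xM : snorm r x <= `|M| by exact: le_trans (ler_norm _).
  have ix := le_trans (snorm_initial i.+1 r_ge0 cx) xM.
  have cix := C0_initial (i := i.+1) cx.
  apply: (le_trans (ler_normD _ _)); apply: lerD.
    by apply: (le_trans (HL t w _ t0 Dw cix ix)); rewrite ler_wpM2l.
  have /andP[g1 g2] := HN t w _ t0 Dw cix ix.
  have g0 : 0 <= g i t w (initialC i.+1 x).
    by apply: le_trans g1; rewrite invr_ge0 (le_trans ler01).
  rewrite normrM (ger0_norm g0); apply: ler_pM => //.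
  by apply: HK; exact: le_trans (enorm0_le_snorm r_ge0 cx) xM.
exists (n.+1%:R * \sum_i `|B i|) => t w x tT Dw cx xM; apply: enorm_le_bound => i.
apply: (le_trans (HB i t w x tT Dw cx xM)); apply: (le_trans (ler_norm _)).
by rewrite (bigD1 i)//= lerDl sumr_ge0.
Qed.

Lemma closed_loop_locally_lipschitz : rhs_locally_lipschitz r D F.
Proof.
move=> T M; have M0 : 0 <= `|M| by [].
have /choice[B HB] : forall i : 'I_n.+1, exists B : R, forall t w x y, 0 <= t <= T -> D w ->
    C0 r x -> C0 r y -> snorm r x <= M -> snorm r y <= M ->
    `|F t w x ord0 i - F t w y ord0 i| <= B * snorm r (x \- y).
  move=> i; have [Lf Lf0 Hf] := f_lipschitz f_cont f_lip `|M| (leq_ord i).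
  have [Lg Lg0 Hg] := g_lipschitz r_gt0 D_compact g_cont g_lip `|M| T (leq_ord i).
  have [N N1 HN] := g_range varphi_mono varphi_gt0 g_bound (leq_ord i) M0.
  have [K K0 HK] := nice_bounded `|M| (nice_feedback i).
  have [L L0 HL] := nice_lipschitz `|M| (nice_feedback i).
  exists (Lf + (N * L + Lg * K)) => t w x y tT Dw cx cy xM yM; rewrite !closed_loopE.
  have /andP[t0 _] := tT.
  have {}xM : snorm r x <= `|M| by exact: le_trans (ler_norm _).
  have {}yM : snorm r y <= `|M| by exact: le_trans (ler_norm _).
  have ix := le_trans (snorm_initial i.+1 r_ge0 cx) xM.
  have iy := le_trans (snorm_initial i.+1 r_ge0 cy) yM.
  have cix := C0_initial (i := i.+1) cx; have ciy := C0_initial (i := i.+1) cy.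
  have x0 := le_trans (enorm0_le_snorm r_ge0 cx) xM.
  have y0 := le_trans (enorm0_le_snorm r_ge0 cy) yM.
  have xy0 := enorm0_le_snorm r_ge0 (C0B cx cy).
  have ixy : snorm r (initialC i.+1 x \- initialC i.+1 y) <= snorm r (x \- y).
    have -> : initialC i.+1 x \- initialC i.+1 y = initialC i.+1 (x \- y).
      by apply/funext => s; rewrite /initialC /= initialB.
    exact: (snorm_initial i.+1 r_ge0 (C0B cx cy)).
  have /andP[g1 g2] := HN t w _ t0 Dw cix ix.
  have g0 : 0 <= g i t w (initialC i.+1 x).
    by apply: le_trans g1; rewrite invr_ge0 (le_trans ler01).
  have q1 := le_trans (Hf t w _ _ t0 Dw cix ciy ix iy) (ler_wpM2l Lf0 ixy).
  have q2 := le_trans (Hg t w _ _ tT Dw cix ciy ix iy) (ler_wpM2l Lg0 ixy).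
  have q3 := le_trans (HL _ _ x0 y0) (ler_wpM2l L0 xy0).
  have q4 := HK _ y0.
  set fx := f i t w _; set fy := f i t w _; set gx := g i t w _; set gy := g i t w _.
  set ux := feedback i (x 0); set uy := feedback i (y 0); set s := snorm r (x \- y).
  have -> : fx + gx * ux - (fy + gy * uy) = (fx - fy) + (gx * (ux - uy) + (gx - gy) * uy) by ring.
  rewrite [leRHS]mulrDl; apply: (le_trans (ler_normD _ _)); apply: lerD => //.
  rewrite [leRHS]mulrDl; apply: (le_trans (ler_normD _ _)); rewrite !normrM (ger0_norm g0).
  apply: lerD; first by rewrite -mulrA; apply: ler_pM.
  by rewrite mulrAC; apply: ler_pM.
exists (n.+1%:R * \sum_i `|B i|) => [|t w x y tT Dw cx cy xM yM].
  by rewrite mulr_ge0// sumr_ge0.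
rewrite -mulrA; apply: enorm_le_bound => i.
have -> : (F t w x - F t w y) ord0 i = F t w x ord0 i - F t w y ord0 i by rewrite !mxE.
apply: (le_trans (HB i t w x y tT Dw cx cy xM yM)); rewrite ler_wpM2r ?snorm_ge0//.
by apply: (le_trans (ler_norm _)); rewrite (bigD1 i)//= lerDl sumr_ge0.
Qed.

End ClosedLoop.

(** * Exponential decay of solutions *)

Section ExponentialDecay.
Context {R : realType} (r sigma : R) (n l : nat) (D : set 'rV[R]_l)
  (F : R -> 'rV[R]_l -> (R -> 'rV[R]_n.+1) -> 'rV[R]_n.+1) (hh : nat -> nat -> R -> R).
Local Notation h := (fun i => hh i 0%N).
Local Notation W := (@error_sqr R n.+1 h n).

(** The initial maximum of [W] is at most (|x0| A)^2, so taking square roots turns the rate 2 sigma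
    into sigma and keeps the bound linear in |x0|. The factor [E] accounts for the oldest part of
    the history. *)
Lemma exponential_decay : 0 < r -> 0 < sigma -> admissible hh ->
  razumikhin_decay r sigma D F W ->
  forall S : R, 0 <= S -> exists2 K, 0 <= K & forall t0 x0 d T x, 0 <= t0 -> C0 r x0 ->
     snorm r x0 <= S -> (forall t, 0 <= t -> D (d t)) -> is_solution r F t0 x0 d T x ->
     forall t : R, t0 <= t -> (t%:E < T)%E ->
       snorm r (hist t x) <= K * expR (- (sigma * (t - t0))) * snorm r x0.
Proof.
move=> r_gt0 s0 [hT h1 hM] HF S S0; have r0 := ltW r_gt0.
pose A := Num.sqrt (sqr_gain h n S); have A0 : 0 <= A by exact: sqrtr_ge0.
have AE : A ^+ 2 = sqr_gain h n S by rewrite sqr_sqrtr// sqr_gain_ge0.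
pose E := expR (sigma * r); have E0 : 0 <= E by exact: expR_ge0.
(* Taken at an upper bound for [q] below, so that [G] depends on the ball only. *)
pose G := state_gain h n (E * (S * A)).
have G1 : 1 <= G := state_gain_ge1 h1 n _.
have G0 : 0 <= G by exact: le_trans ler01 G1.
exists (E * A * G); first by rewrite !mulr_ge0.
move=> t0 x0 d T x t00 cx0 xS Dd solx t t0t tT.
have sx0 := snorm_ge0 r x0.
have nW : nice W by exact: nice_error_sqr.
have W0 u : 0 <= W u by exact: error_sqr_ge0.
have V0 : weighted_max r sigma W x0 <= (snorm r x0 * A) ^+ 2.
  rewrite exprMn AE; apply: weighted_max_le => // th thr.
  apply: (@le_trans _ _ (W (x0 th))).
    rewrite ler_piMl// -[leRHS]expR0 ler_expR mulr_ge0_le0 ?mulr_ge0 ?(ltW s0)//.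
    by have /andP[] := thr.
  apply: le_trans (@error_sqr_le_gain _ h n h1 hM (x0 th) _ (enorm_le_snorm r0 cx0 thr)) _.
  by rewrite ler_wpM2l ?sqr_ge0//; apply: sqr_gain_mono.
apply: snorm_le => // th /andP[th1 th2]; rewrite /hist.
set s := t + th.
have st0 : t0 - r <= s by rewrite lerD.
have sT : (s%:E < T)%E by apply: le_lt_trans tT; rewrite lee_fin gerDl.
have Ws := solution_weighted_decay r_gt0 s0 nW W0 HF t00 cx0 Dd solx st0 sT.
pose p := expR (- (sigma * (s - t0))); have p0 : 0 <= p by exact: expR_ge0.
pose q := p * (snorm r x0 * A); have q0 : 0 <= q by rewrite !mulr_ge0.
have pE : p <= E * expR (- (sigma * (t - t0))).
  rewrite -expRD ler_expR -!mulrN -mulrDr ler_wpM2l ?(ltW s0)//.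
  have -> : - (s - t0) = - th - (t - t0) by rewrite /s; ring.
  by rewrite lerD2r lerNl.
have pE1 : p <= E by rewrite ler_expR -mulrN ler_wpM2l ?(ltW s0)// lerNl lerBrDl.
have Wq : W (x s) <= q ^+ 2.
  have p2 : p ^+ 2 * expR (2 * sigma * (s - t0)) = 1.
    by rewrite -expRM_natl -expRD -[RHS]expR0; congr expR; ring.
  rewrite -[W (x s)]mul1r -p2 -mulrA exprMn ler_wpM2l ?sqr_ge0//.
  exact: le_trans Ws V0.
apply: (le_trans (enorm_le_error_sqr h1 hM q0 Wq)).
have qQ : q <= E * (S * A) by rewrite ler_pM ?mulr_ge0// ler_wpM2r.
apply: (@le_trans _ _ (q * G)); first by rewrite ler_wpM2l//; apply: state_gain_mono.
have -> : E * A * G * expR (- (sigma * (t - t0))) * snorm r x0 =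
  E * expR (- (sigma * (t - t0))) * (snorm r x0 * A) * G by ring.
by rewrite ler_wpM2r// ler_wpM2r// mulr_ge0.
Qed.

End ExponentialDecay.

(** * The functional of the theorem and the final assembly *)

Lemma lyapunov_weighted_max (R : realType) n (r sigma : R) (h : nat -> R -> R) :
  lyapunov r sigma (fun i => @virtual_control R i.+1 h i) =
  weighted_max r sigma (@error_sqr R n.+1 h n).
Proof.
apply/funext => x; congr sup; apply/seteqP.
have E (u : 'rV[R]_n.+1) : entry u 0 ^+ 2 +
    \sum_(j < n) `|entry u j.+1 - virtual_control h j (initial j.+1 u)| ^+ 2 = error_sqr h n u.
  rewrite /error_sqr big_ord_recl/=; congr (_ + _); apply: eq_bigr => j _.
  by rewrite real_normK ?num_real// virtual_control_initial.
by split => _ [th thr <-]; exists th; rewrite // E.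
Qed.

Theorem theorem5p1 (R : realType) (n l : nat) (r : R) (D : set 'rV[R]_l)
  (f g : forall i : nat, R -> 'rV[R]_l -> (R -> 'rV[R]_i.+1) -> R)
  (varphi : R -> R)
  (r_gt0 : 0 < r)
  (D_compact : compact D)
  (f_cont : forall i, (i <= n)%N ->
    continuous_on_C0 r [set z : R * 'rV[R]_l | 0 <= z.1 /\ D z.2]
      (fun z => f i z.1 z.2))
  (g_cont : forall i, (i <= n)%N ->
    continuous_on_C0 r [set z : R * 'rV[R]_l | 0 <= z.1 /\ D z.2]
      (fun z => g i z.1 z.2))
  (f_zero : forall i, (i <= n)%N ->
    forall t d, 0 <= t -> D d -> f i t d (fun=> 0) = 0)
  (g_lip : forall i, (i <= n)%N ->
    completely_locally_lipschitz r
      [set z : R * 'rV[R]_l | 0 <= z.1 /\ D z.2] (fun z => g i z.1 z.2))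
  (varphi_mono : nondecreasing_Rplus varphi)
  (varphi_smooth : smooth_Rplus varphi)
  (varphi_gt0 : forall s, 0 <= s -> 0 < varphi s)
  (g_bound : forall i, (i <= n)%N -> forall t x d, 0 <= t -> C0 r x -> D d ->
    1 / varphi (snorm r x) <= g i t d x <= varphi (snorm r x))
  (f_lip : forall i, (i <= n)%N -> forall S : set (R -> 'rV[R]_i.+1),
    bounded_C0 r S ->
    finite_sup [set q | exists t d x y,
       [/\ 0 <= t /\ D d, S x, S y, 0 < snorm r (x \- y) &
           q = `|f i t d x - f i t d y| / snorm r (x \- y)]]) :
  forall sigma : R, 0 < sigma ->
  exists mu k : forall i : nat, 'rV[R]_i.+1 -> R,
  [/\ (forall i, (i <= n)%N ->
         [/\ smooth (mu i), forall xi, 0 < mu i xi & smooth (k i)]),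
      (forall xi : 'rV[R]_1, k 0%N xi = - mu 0%N xi * entry xi 0) /\
      (forall j, (j < n)%N -> forall xi : 'rV[R]_j.+2,
         k j.+1 xi = - mu j.+1 xi * (entry xi j.+1 - k j (initial j.+1 xi))),
      SRCLF_small_control r D (triangular (n := n) f g)
        (fun _ => lyapunov r sigma k),
      URGAS r D (closed_loop f g (k n))
    & forall t (x : R -> 'rV[R]_n.+1) d, 0 <= t -> C0 r x -> D d ->
        (upper_deriv r (fun _ => lyapunov r sigma k) t x
           (closed_loop f g (k n) t d x)
         <= (- (2 * sigma * lyapunov r sigma k x))%:E)%E].
Proof.
move=> sigma s0; have r0 := ltW r_gt0.
(* The constant of [razumikhin_decay]. It enters [term_bound] multiplied by n + 1, since [W] is
   compared with the square of the largest of n + 1 error coordinates. *)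
pose C := 2 * expR (2 * sigma * r).
have C1 : 1 <= C.
  have : 1 <= expR (2 * sigma * r) by rewrite -[leLHS]expR0 ler_expR !mulr_ge0// ltW.
  by rewrite /C; move=> h; apply: (le_trans h); rewrite ler_peMl ?expR_ge0// ler1n.
have Cn1 : 1 <= C * n.+1%:R by rewrite (le_trans C1)// ler_peMr ?ler1n// (le_trans ler01).
have [hh [N [ad HN]]] : exists hh N, admissible hh /\ forall j, (j <= n)%N ->
    term_bound n r D f g (C * n.+1%:R) (fun i => hh i 0%N) j (N j) /\
    dominates n sigma (fun i => hh i 0%N) N j.
  apply: gains_exist => hh j jn [a1 a2 a3].
  exact: (term_bound_exists r_gt0 f_cont f_zero varphi_mono varphi_gt0 g_bound f_lip jn Cn1 a1 a2 a3).
have [hT h1 hM] := ad.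
set h := fun i => hh i 0%N in HN.
have decay : razumikhin_decay r sigma D (closed_loop (n := n) f g (virtual_control h n)) (error_sqr h n).
  by move=> t d x t0 Dd cx HW; exact: (backstepping_decay s0 C1 r0 ad HN t0 Dd cx HW).
have nk : nice (@virtual_control R n.+1 h n) by exact: nice_virtual_control.
exists (fun i xi => h i (sqi i.+1 xi)), (fun i => @virtual_control R i.+1 h i).
rewrite lyapunov_weighted_max; split.
- move=> i _; split.
  + by apply: nice_smooth; exact: (nice_comp 0 (hT i) (nice_sqi _ _)).
  + by move=> xi; exact: lt_le_trans ltr01 (h1 i _ (sqi_ge0 _ _)).
  + by apply: nice_smooth; exact: nice_virtual_control.
- by split=> // j _ xi; rewrite virtual_control_initial.
- apply: (SRCLF_small_control_weighted_max r_gt0 s0 ad varphi_mono _ varphi_gt0 decay).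
  by move=> t x d; exact: g_bound.
- apply: (URGAS_of_exponential_decay r_gt0 s0).
  + exact: (closed_loop_continuous r_gt0 f_cont g_cont nk).
  + exact: (closed_loop_locally_lipschitz r_gt0 D_compact f_cont g_cont g_lip
      varphi_mono varphi_gt0 g_bound f_lip nk).
  + exact: (closed_loop_locally_bounded r_gt0 f_cont f_zero varphi_mono varphi_gt0 g_bound f_lip nk).
  + exact: exponential_decay.
(* The case c = 0: a maximum at 0 gives the bound on the history that [decay] requires, with a
   factor 2 to spare. *)
- move=> t x d t0 cx Dd; rewrite -[X in (_ <= X%:E)%E]addr0.
  apply: upper_deriv_weighted_max => //; first exact: nice_error_sqr.
    by move=> u; exact: error_sqr_ge0.
  move=> WV; rewrite addr0 -WV; apply: decay => // th thr.
  have V0 : 0 <= error_sqr h n (x 0) by exact: error_sqr_ge0.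
  have := error_sqr_le_weighted_max r_gt0 s0 ad cx thr; rewrite -/h -WV => /le_trans; apply.
  by rewrite ler_wpM2r// ler_peMl ?expR_ge0// ler1n.
Qed.
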